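(* Fix $p\in(0,1)$, and let $\widehat\sigma$ be such that $\Phi_{\widehat\sigma}(\tau)=p$, where $\Phi_{\widehat\sigma}$ is the CDF of $\mathcal N(0,\widehat\sigma^2)$. For any $\alpha\subseteq R$ let $\mathrm{Sw}(K_{1,\alpha}):=\prod_{u\in\alpha}(\sigma(\langle\mathbf x_u,\mathbf x\rangle)-p)$, where $(\mathbf x_u)_{u\in R}$ are the columns of $\mathbf X_R$. Then there are functions $\Lambda_\alpha(\mathbf X_R), r_\alpha(\mathbf X_R)$ such that for all $\alpha\subseteq R$, $$\mathbb E_{\mathbf x}\big[\mathrm{Sw}(K_{1,\alpha})\mid\mathbf X_R\big]=\Lambda_\alpha(\mathbf X_R)+r_\alpha(\mathbf X_R)\qquad\text{whenever }\mathbf X_R\in S_\rho.$$ With $\ell:=\lceil|\alpha|/2\rceil$, one further has $$\Lambda_\alpha(\mathbf X_R):=\frac{(-1)^\ell}{2^\ell\,\ell!}\sum_{\substack{r_1,\dots,r_\ell\in\alpha\times\alpha\\ \mathrm{Supp}(r_1,\dots,r_\ell)=\alpha}}\Bigg(\prod_{j=1}^{\ell}\Big(\tfrac1d\langle\mathbf x_{r_j(1)},\mathbf x_{r_j(2)}\rangle-\widehat\sigma^2\,\mathbf I_{r_j(1),r_j(2)}\Big)\Bigg)\Bigg(\prod_{e\in\alpha}\phi^{(s_e-1)}(\tau)\Bigg).$$ Moreover, there is an absolute constant $C>0$ such that (for $\mathbf X_R\in S_\rho$) $$|\Lambda_\alpha(\mathbf X_R)|\le\Big(\frac{C\rho|\alpha|}{\sqrt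 d}\Big)^{\ell}\quad\text{and}\quad |r_\alpha(\mathbf X_R)|\le\Big(\frac{C\rho|\alpha|}{\sqrt d}\Big)^{\ell+1}.$$
   Context: $R$ is a finite set with $|R|=n$, $\mathbf X_R=(\mathbf x_u)_{u\in R}$ is a family of vectors in $\mathbb R^d$, and $\mathbb E_{\mathbf x}$ is the expectation over $\mathbf x\sim\mathcal N(0,\mathbf I_d)$ with $\mathbf X_R$ fixed. $\tau=\tau(d,p)$ is defined by $\mathbb P(d^{-1/2}\langle\mathbf x,\mathbf y\rangle\le\tau)=p$ for independent $\mathbf x,\mathbf y\sim\mathcal N(0,\mathbf I_d)$, and $\sigma(\langle\mathbf x,\mathbf y\rangle)$ is the indicator of the event $d^{-1/2}\langle\mathbf x,\mathbf y\rangle\le\tau$. For $p=\frac12$ (where $\tau=0$) one takes $\widehat\sigma=1$. For a parameter $\rho$, $S_\rho$ is the set (event) of families $(\mathbf x_u)_{u\in R}$ of vectors in $\mathbb R^d$ with $\big|\tfrac1d\langle\mathbf x_u,\mathbf x_v\rangle-\mathbf I_{u,v}\big|\le\rho/\sqrt d$ for all $u,v\in R$, where $\mathbf I$ is the identity matrix ($\mathbf I_{u,v}=1$ if $u=v$ and $0$ otherwise). For pairs $r_1,\dots,r_\ell\in\alpha\times\alpha$, $r_j=(r_j(1),r_j(2))$, $\mathrm{Supp}(r_1,\dots,r_\ell):=\{e\in\alpha: r_j(1)=e\text{ or }r_j(2)=e\text{ for some }j\}$ is the set of elements covered by the pairs, and for $e\in\alpha$, $s_e:=|\{j\in[\ell]:r_j(1)=e\}|+|\{j\in[\ell]:r_j(2)=e\}|$.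 $\phi^{(s)}$ is the $s$-th derivative of the standard Gaussian density. $K_{1,\alpha}$ is the star with set of leaves $\alpha$.
   Formalization: The printed sign (-1)^ℓ in Λ_α is dropped, as the remainder bound fails with it for p=1/2, |α|=2; for p≠1/2 the condition ρ ≥ d^{-1/2} is added, as the bounds fail when ρ→0 with |α|=1; d ≥ 1 is made explicit. *)

(* Defs.v *)
From HB Require Import structures.
From mathcomp Require Import all_boot all_order all_algebra.
From mathcomp Require Import all_classical all_reals all_analysis.

Set Implicit Arguments.
Unset Strict Implicit.
Unset Printing Implicit Defensive.

Import Order.TTheory GRing.Theory Num.Theory.
Import numFieldNormedType.Exports.

Local Open Scope classical_set_scope.
Local Open Scope ring_scope.

(* Vectors of K^d are d-tuples: this is the type on which the library puts
   the product sigma-algebra. *)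

Section cons_tuple.
Context (K : realType) (d : nat).

Definition cons_tuple (z : measurableTypeR K * d.-tuple (measurableTypeR K)) :
  d.+1.-tuple (measurableTypeR K) := [tuple of z.1 :: z.2].

Lemma measurable_cons_tuple : measurable_fun [set: _] cons_tuple.
Proof. exact: measurable_cons. Qed.

HB.instance Definition _ := @isMeasurableFun.Build _ _ _ _
  cons_tuple measurable_cons_tuple.

End cons_tuple.

(* N(0, I_d): the law of d independent standard normal coordinates, as an
   iterated product measure. *)
Fixpoint gaussian (K : realType) (d : nat) :
    probability (d.-tuple (measurableTypeR K)) K :=
  match d with
  | 0 => \d_[tuple]
  | d'.+1 =>
      distribution (normal_prob (0 : K) 1 \x gaussian K d')%E (@cons_tuple K d')
  end.

Definition inner (K : realType) (d : nat) (x y : d.-tuple (measurableTypeR K)) :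
  K := \sum_(i < d) tnth x i * tnth y i.

(* tau = tau(d, p) *)
Definition is_threshold (K : realType) (d : nat) (p tau : K) : Prop :=
  (gaussian K d \x gaussian K d)%E
    [set z | (Num.sqrt d%:R)^-1 * inner z.1 z.2 <= tau] = p%:E.

(* For p = 1/2 one has tau = 0, the CDF equation says nothing about the
   variance, and the convention is to take it equal to 1. *)
Definition is_sigma_hat (K : realType) (p tau sigmah : K) : Prop :=
  [/\ 0 < sigmah,
      normal_prob 0 sigmah `]-oo, tau]%classic = p%:E &
      p = 2^-1 -> sigmah = 1].

Section star.
Context (K : realType) (d : nat) (R : finType).
Notation vec := (d.-tuple (measurableTypeR K)).

(* When p != 1/2, sigmah differs from 1 by a quantity of order 1/d, so bounds in
   powers of rho / sqrt d can only hold for rho / sqrt d at least of order 1/d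
   (for rho = 0 they fail: a vector of norm sqrt d has
   P(<X u, x> <= sqrt d tau) - p = Phi(tau) - Phi(tau / sigmah)).  Hence the
   side condition 1 <= rho * sqrt d in the theorem when p != 1/2. *)
Definition Sgood (rho : K) : set (R -> vec) :=
  [set X | forall u v : R,
    `| d%:R^-1 * inner (X u) (X v) - (u == v)%:R | <= rho / Num.sqrt d%:R].

Definition Sw (p tau : K) (X : R -> vec) (alpha : {set R}) (x : vec) : K :=
  \prod_(u in alpha)
    (((Num.sqrt d%:R)^-1 * inner (X u) x <= tau)%R%:R - p).

Definition Supp (l : nat) (r : {ffun 'I_l -> R * R}) : {set R} :=
  [set e | [exists j, ((r j).1 == e) || ((r j).2 == e)]]%SET.

Definition mult (l : nat) (r : {ffun 'I_l -> R * R}) (e : R) : nat :=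
  (#|[set j | (r j).1 == e]%SET| + #|[set j | (r j).2 == e]%SET|)%N.

(* Order-l Taylor term of the expectation, as a function of the covariance,
   at sigmah^2 I, where l = ceil(#|alpha| / 2).  Since
   d/dt E_(N(0, S + t D)) f = 1/2 sum_(u, v) D_uv E (f_uv), and the mean of the
   s-th derivative of x |-> 1_(x <= tau) is (-1)^s phi^(s - 1)(tau), the total
   sign is the product of the (-1)^(mult r e), that is (-1)^(2 l) = 1.  A factor
   (-1)^l in front of the sum would be wrong: two vectors with normalized inner
   product c > 0 and p = 1/2 give the positive expectation asin c / (2 pi). *)
Definition Lambda (tau sigmah : K) (alpha : {set R}) (X : R -> vec) : K :=
  let l := uphalf #|alpha| in
  (2 ^+ l * l`!%:R)^-1 *
  \sum_(r : {ffun 'I_l -> R * R} |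
          [forall j, ((r j).1 \in alpha) && ((r j).2 \in alpha)] && (Supp r == alpha))
    ((\prod_(j < l)
        (d%:R^-1 * inner (X (r j).1) (X (r j).2)
         - sigmah ^+ 2 * ((r j).1 == (r j).2)%:R)) *
     (\prod_(e in alpha) derive1n (mult r e - 1) (normal_pdf (0 : K) 1) tau)).

End star.

(* Main.v *)
Require Import Defs.
From HB Require Import structures.
From mathcomp Require Import all_boot all_order all_algebra.
From mathcomp Require Import all_classical all_reals all_analysis.
From mathcomp Require Import measurable_realfun ring lra zify.

(** Write k = #|alpha|, eps = rho / sqrt d, G for the normalized Gram matrix of
the vectors X u with u in alpha, and D = G - I, whose entries are at most eps on
S_rho.  The vector of the inner products <X u, x> / sqrt d is Gaussian with
covariance G, so the conditional expectation is the mean of a product of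
centred indicators under N(0, G).

Only the Gram matrix matters (Eind_law): along the Gaussian interpolation
sqrt t a + sqrt (1 - t) b of two orthogonal families, Stein's identity gives
d/dt E f = 1/2 sum_(u, v) (G_a - G_b)_uv E (f_uv) (is_derive_Psi), and this
vanishes if the two Gram matrices agree.

The expectation is then expanded at the identity covariance (star_expansion).
Indicators have no derivative, so half of the identity is split off: if
eps k <= 1/4, then G - I/2 is diagonally dominant, hence is itself the Gram
matrix of explicit vectors, and the independent Gaussian noise of covariance I/2
turns the indicators into smooth functions whose derivatives of order s are at
most 2 * 4^s * s!.  Interpolating from I/2 to G - I/2 and applying Taylor's
formula in t produces the coefficients (2^m m!)^-1 sum_r prod_j D(r_j) prod_e
psi(s_e), the sum being over sequences r of m pairs, with psi(s) equal to
(-1)^s phi^(s-1)(tau) for s > 0 and psi(0) = eta := Phi(tau) - p.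
Weighted by prod_e s_e!, the sequences of m pairs number k(k+1)...(k+2m-1)
(paircountE), which is at most 2^m m! 2^k (16k)^m; so a term of order m carries a
factor of order (eps k)^m.

An element of alpha covered by no pair contributes eta, which is O(1/d) = O(eps).
A sequence of m pairs leaves at least k - 2m elements uncovered, so its term is
of order eps^(m + (k - 2m)^+), which is eps^l or smaller.  Order eps^l itself
occurs for m = l with full support, and also, if k is odd, for m = l - 1 with
exactly one uncovered element.  The latter terms are what is gained by replacing
I with sigmah^2 I in Lambda: full support allows at most one diagonal pair
(diag_pairs_le1), and the extra contribution of that pair is the term of order
l - 1 in which eta is replaced by kappa := (1 - sigmah^2)/2 phi'(tau)
(Tsum_diag_split).  So the remainder has order eps^(l+1) as soon as
eta - kappa = O(eps^2).

That last estimate (threshold_bounds) is where sigmah enters.  Conditioning on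
one of the two vectors, p is the average of H(S), where H(v) = Phi(tau/sqrt v)
and S = |y|^2/d, while p = H(sigmah^2); so eta = H(1) - H(v) and kappa is its
linearization -H'(1)(v - 1), with v = sigmah^2.  A fourth-order Taylor expansion
of H at 1 gives p - H(1) = A/d + O(1/d^2), and the inverse of H is controlled
uniformly in tau: all constants have to be absolute, and so the weights
1 + tau^2 and tau phi(tau) are carried through the computation.

If eps k > 1/4 there is nothing to expand: the expectation is at most 1 and the
bound on Lambda suffices. *)

Set Implicit Arguments.
Unset Strict Implicit.
Unset Printing Implicit Defensive.

Import Order.TTheory GRing.Theory Num.Theory.
Import numFieldNormedType.Exports.

Local Open Scope classical_set_scope.
Local Open Scope ring_scope.

(** * Integrals against a probability *)

Section probability_integral.
Context d (T : measurableType d) (K : realType) (P : probability T K).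

Lemma bounded_integrable (f : T -> K) (M : K) :
  measurable_fun [set: T] f -> (forall x, `|f x| <= M) ->
  P.-integrable [set: T] (EFin \o f).
Proof.
move=> mf fM; apply: measurable_bounded_integrable => //.
  by rewrite (le_lt_trans (probability_le1 P _)) ?ltry.
exists M; split; first exact: num_real.
by move=> y My x _ /=; rewrite (le_trans (fM x))// ltW.
Qed.

Lemma integrable_le (f g : T -> K) :
  measurable_fun [set: T] f -> P.-integrable [set: T] (EFin \o g) ->
  (forall x, `|f x| <= `|g x|) -> P.-integrable [set: T] (EFin \o f).
Proof.
move=> mf ig fg; apply: le_integrable ig => //; first exact/measurable_EFinP.
by move=> x _; rewrite lee_fin.
Qed.

Lemma integrable_bounded_mul (f g : T -> K) (M : K) :
  measurable_fun [set: T] g -> (forall x, `|g x| <= M) ->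
  P.-integrable [set: T] (EFin \o f) ->
  P.-integrable [set: T] (EFin \o (fun x => f x * g x)).
Proof.
move=> mg gM fi; apply: (@integrable_le _ (fun x => M * f x)).
- apply: measurable_funM => //.
  by move: (fi) => /integrableP[/measurable_EFinP].
- have := integrableZl measurableT M fi.
  by apply: eq_integrable => // x _ /=; rewrite EFinM.
- move=> x; rewrite !normrM mulrC ler_wpM2r//.
  by rewrite (le_trans (gM x))// ler_norm.
Qed.

Lemma Rintegral_cstT (c : K) : \int[P]_x c = c.
Proof.
rewrite Rintegral_cst//.
exact: (etrans (congr1 (fun z => c * fine z) (probability_setT P)) (mulr1 c)).
Qed.

Lemma Rintegral_sumT (I : Type) (r : seq I) (p : pred I) (f : I -> T -> K) :
  (forall i, P.-integrable [set: T] (EFin \o f i)) ->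
  \int[P]_x (\sum_(i <- r | p i) f i x) = \sum_(i <- r | p i) \int[P]_x f i x.
Proof.
move=> fi.
have isum s : P.-integrable [set: T] (EFin \o (fun x => \sum_(i <- s | p i) f i x)).
  have := integrable_sum measurableT s (fun i (_ : p i) => fi i).
  by apply: eq_integrable => // x _ /=; rewrite sumEFin.
elim: r => [|i r IH]; first by under eq_Rintegral do rewrite big_nil;
  rewrite Rintegral_cstT big_nil.
rewrite big_cons -IH; case: ifP => pi.
  rewrite -RintegralD//; apply: eq_Rintegral => x _; by rewrite big_cons pi.
by apply: eq_Rintegral => x _; rewrite big_cons pi.
Qed.

Lemma Rintegral_norm_le (f : T -> K) (M : K) :
  measurable_fun [set: T] f -> (forall x, `|f x| <= M) ->
  `|\int[P]_x f x| <= M.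
Proof.
move=> mf fM; have fi := bounded_integrable mf fM.
apply: (le_trans (le_normr_Rintegral measurableT fi)).
rewrite -[leRHS]Rintegral_cstT; apply: le_Rintegral => //.
- exact: integrable_norm.
- by apply: (@bounded_integrable _ `|M|).
Qed.

End probability_integral.

Section Rfubini.
Context d1 d2 (T1 : measurableType d1) (T2 : measurableType d2) (K : realType).
Context (P1 : probability T1 K) (P2 : probability T2 K).

Lemma Rfubini1 (f : T1 * T2 -> K) :
  (P1 \x P2)%E.-integrable [set: T1 * T2] (EFin \o f) ->
  \int[(P1 \x P2)%E]_z f z = \int[P1]_x \int[P2]_y f (x, y).
Proof.
move=> fi; rewrite /Rintegral -integral12_prod_meas1//; congr fine.
apply: ae_eq_integral => //=.
- exact: (measurable_fubini_F fi).
- apply/measurable_EFinP/measurableT_comp => //.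
  exact: (measurable_fubini_F fi).
- have := integrable_ae measurableT (integrable_fubini_F fi).
  apply: filterS => x /= /(_ I) h _.
  by rewrite fineK.
Qed.

Lemma Rfubini2 (f : T1 * T2 -> K) :
  (P1 \x P2)%E.-integrable [set: T1 * T2] (EFin \o f) ->
  \int[(P1 \x P2)%E]_z f z = \int[P2]_y \int[P1]_x f (x, y).
Proof.
move=> fi; rewrite /Rintegral -integral21_prod_meas1//; congr fine.
apply: ae_eq_integral => //=.
- exact: (measurable_fubini_G fi).
- apply/measurable_EFinP/measurableT_comp => //.
  exact: (measurable_fubini_G fi).
- have := ae_integrable2 fi; apply: filterS => y /= h _.
  by rewrite fineK//; exact: integrable_fin_num.
Qed.

End Rfubini.

(** * Standard Gaussian vectors *)

Section gaussian_vectors.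
Context (K : realType).
Notation vec n := (n.-tuple (measurableTypeR K)).
Notation g1 := (normal_prob (0 : K) 1).

Definition gaussE n (f : vec n -> K) : K := \int[gaussian K n]_x f x.

Definition gint n (f : vec n -> K) := (gaussian K n).-integrable [set: vec n] (EFin \o f).

Lemma gint_meas n (f : vec n -> K) : gint f -> measurable_fun [set: vec n] f.
Proof. by move=> /integrableP[/measurable_EFinP]. Qed.

Lemma gint_consP n (f : vec n.+1 -> K) : measurable_fun [set: vec n.+1] f ->
  gint f <-> (g1 \x gaussian K n)%E.-integrable [set: _] (EFin \o (f \o @Defs.cons_tuple K n)).
Proof.
move=> mf.
have mfc : measurable_fun [set: _] (f \o @Defs.cons_tuple K n).
  by apply: measurableT_comp => //; exact: Defs.measurable_cons_tuple.
have E : (\int[gaussian K n.+1]_x `|(f x)%:E| =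
          \int[(g1 \x gaussian K n)]_x `|(f (Defs.cons_tuple x))%:E|)%E.
  rewrite (@ge0_integral_distribution _ _ _ _ _ _ _ (fun x => `|(f x)%:E|)%E) //.
  by apply: measurableT_comp => //; exact/measurable_EFinP.
split=> /integrableP[_ h]; apply/integrableP; split.
- exact/measurable_EFinP.
- by rewrite -E.
- exact/measurable_EFinP.
- by rewrite [ltLHS]E.
Qed.

Lemma gaussE_cons n (f : vec n.+1 -> K) : gint f ->
  gaussE f = \int[g1]_x gaussE (fun y => f (Defs.cons_tuple (x, y))).
Proof.
move=> fi; have mf := gint_meas fi.
rewrite -[RHS](@Rfubini1 _ _ _ _ K g1 (gaussian K n) (f \o @Defs.cons_tuple K n)); last exact/gint_consP.
rewrite /gaussE /Rintegral integral_distribution//; first exact/measurable_EFinP.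
by have /(gint_consP mf) := fi.
Qed.

Lemma gaussE_cons2 n (f : vec n.+1 -> K) : gint f ->
  gaussE f = gaussE (fun y => \int[g1]_x f (Defs.cons_tuple (x, y))).
Proof.
move=> fi; have mf := gint_meas fi.
rewrite [RHS]/gaussE -[RHS](@Rfubini2 _ _ _ _ K g1 (gaussian K n) (f \o @Defs.cons_tuple K n)); last exact/gint_consP.
rewrite /gaussE /Rintegral integral_distribution//; first exact/measurable_EFinP.
by have /(gint_consP mf) := fi.
Qed.

Lemma gaussE0 (f : vec 0 -> K) : measurable_fun [set: vec 0] f -> gaussE f = f [tuple].
Proof.
move=> mf; rewrite /gaussE /Rintegral /= integral_dirac// ?diracT ?mul1e//.
exact/measurable_EFinP.
Qed.

Lemma measurable_cons_r n (x : measurableTypeR K) :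
  measurable_fun [set: vec n] (fun y => Defs.cons_tuple (x, y)).
Proof.
apply: (measurableT_comp (@Defs.measurable_cons_tuple K n)).
exact: measurable_fun_pair.
Qed.

Lemma measurable_tnthK n (i : 'I_n) : measurable_fun [set: vec n] (fun x => tnth x i : K).
Proof. exact: measurable_tnth. Qed.

Lemma measurable_cat m n :
  measurable_fun [set: vec m * vec n] (fun z => [tuple of z.1 ++ z.2] : vec (m + n)).
Proof.
apply/measurable_fun_tnthP => i; rewrite /= /comp /=.
case: (split_ordP i) => j ->.
  under eq_fun do rewrite tnth_lshift.
  by apply: (measurableT_comp (measurable_tnth j)); exact: measurable_fst.
under eq_fun do rewrite tnth_rshift.
by apply: (measurableT_comp (measurable_tnth j)); exact: measurable_snd.
Qed.

Lemma gaussE_partial_meas d (T : measurableType d) n (f : T * vec n -> K) (M : K) :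
  measurable_fun [set: _] f -> (forall x, `|f x| <= M) ->
  measurable_fun [set: T] (fun x => gaussE (fun y => f (x, y))).
Proof.
move=> mf fM.
have h : measurable_fun [set: T] (fubini_F (gaussian K n) (fun z => (`|M| + f z)%:E)).
  apply: measurable_fun_fubini_tonelli_F.
    by apply/measurable_EFinP/measurable_funD.
  move=> z; rewrite lee_fin -lerBlDl sub0r lerNl (le_trans _ (ler_norm M))//.
  by rewrite (le_trans (ler_norm _))// normrN.
have -> : (fun x => gaussE (fun y => f (x, y))) =
    (fun x => fine (fubini_F (gaussian K n) (fun z => (`|M| + f z)%:E) x) - `|M|).
  apply/funext => x; rewrite /fubini_F.
  have fi : (gaussian K n).-integrable [set: _] (EFin \o (fun y => f (x, y))).
    apply: (@bounded_integrable _ _ _ _ _ M) => //.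
    exact: measurableT_comp mf (measurable_pair1 _).
  have -> : fine (\int[gaussian K n]_y (`|M| + f (x, y))%:E)%E =
     \int[gaussian K n]_y (`|M| + f (x, y)) by [].
  rewrite RintegralD//; first by rewrite Rintegral_cstT addrAC subrr add0r.
  by apply: (@bounded_integrable _ _ _ _ _ `|M|) => // y; rewrite normr_id.
apply: measurable_funB => //.
by apply: measurableT_comp => //.
Qed.

Lemma gint_bounded n (f : vec n -> K) (M : K) :
  measurable_fun [set: vec n] f -> (forall x, `|f x| <= M) -> gint f.
Proof. exact: bounded_integrable. Qed.

Lemma gaussE_bound n (f : vec n -> K) (M : K) :
  measurable_fun [set: vec n] f -> (forall x, `|f x| <= M) -> `|gaussE f| <= M.
Proof. exact: Rintegral_norm_le. Qed.

Lemma gaussE_cat_meas m n (f : vec (m + n) -> K) (M : K) :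
  measurable_fun [set: vec (m + n)] f -> (forall x, `|f x| <= M) ->
  measurable_fun [set: vec m]
    (fun x : vec m => gaussE (fun y : vec n => f [tuple of x ++ y])).
Proof.
move=> mf fM.
apply: (@gaussE_partial_meas _ (vec m) n
  (fun z : vec m * vec n => f [tuple of z.1 ++ z.2]) M); last by move=> z.
exact: measurableT_comp mf (@measurable_cat m n).
Qed.

Lemma gaussE_cat m n (f : vec (m + n) -> K) (M : K) :
  measurable_fun [set: vec (m + n)] f -> (forall x, `|f x| <= M) ->
  gaussE f = gaussE (fun x : vec m => gaussE (fun y : vec n => f [tuple of x ++ y])).
Proof.
elim: m f => [|m IH] f mf fM.
  rewrite gaussE0; last exact: gaussE_cat_meas fM.
  by congr gaussE; apply/funext => y; congr f; apply: val_inj.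
rewrite (@gaussE_cons (m + n)); last exact: (@gint_bounded (m + n).+1 f M).
rewrite (@gaussE_cons m); last first.
  apply: (@gint_bounded _ _ M).
    exact: (@gaussE_cat_meas m.+1 n f M).
  move=> x; apply: gaussE_bound => //.
  apply: (measurableT_comp mf).
  exact: measurableT_comp (@measurable_cat m.+1 n) (measurable_pair1 x).
apply: eq_Rintegral => x _.
have mx := measurableT_comp mf (@measurable_cons_r (m + n) x).
apply: (etrans (IH _ mx (fun y => fM _))).
congr gaussE; apply/funext => y; congr gaussE; apply/funext => z.
by congr f; apply: val_inj.
Qed.

End gaussian_vectors.

(** * The standard normal density *)

Section normal_density.
Context (K : realType).
Notation g1 := (normal_prob (0 : K) 1).
Notation mu := (@lebesgue_measure K).
Definition gphi : K -> K := normal_pdf 0 1.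

Lemma gphi_ge0 x : 0 <= gphi x. Proof. exact: normal_pdf_ge0. Qed.

Lemma measurable_gphi : measurable_fun [set: K] gphi.
Proof. exact: measurable_normal_pdf. Qed.

Lemma ge0_integral_g1 (f : measurableTypeR K -> \bar K) : (forall x, 0 <= f x)%E ->
  measurable_fun [set: _] f ->
  (\int[g1]_x f x = \int[mu]_x (f x * (gphi x)%:E))%E.
Proof.
move=> f0 mf; have dom := normal_prob_dominates (0 : K) 1.
rewrite -(Radon_Nikodym_SigmaFinite.change_of_variables dom)//.
have mphi : measurable_fun [set: _] (fun x => (gphi x)%:E).
  by apply/measurable_EFinP; exact: measurable_gphi.
have fint := Radon_Nikodym_SigmaFinite.f_integrable dom.
apply: ae_eq_integral => //.
- exact: emeasurable_funM (measurable_int _ fint).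
- exact: emeasurable_funM.
- apply: ae_eqe_mul2l; apply: integral_ae_eq => // E _ mE.
  by rewrite -Radon_Nikodym_SigmaFinite.f_integral.
Qed.

Lemma integrable_g1P (f : K -> K) : measurable_fun [set: K] f ->
  g1.-integrable [set: _] (EFin \o f) <->
  mu.-integrable [set: K] (EFin \o (fun x => f x * gphi x)).
Proof.
move=> mf.
have mfp : measurable_fun [set: K] (fun x => f x * gphi x).
  by apply: measurable_funM => //; exact: measurable_gphi.
have E : (\int[g1]_x `|(f x)%:E| = \int[mu]_x `|(f x * gphi x)%:E|)%E.
  rewrite ge0_integral_g1//; last first.
    by apply: measurableT_comp => //; exact/measurable_EFinP.
  apply: eq_integral => x _.
  rewrite EFinM abseM; congr (_ * _)%E.
  by rewrite /= ger0_norm// gphi_ge0.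
split=> /integrableP[_ h]; apply/integrableP; split; try exact/measurable_EFinP.
- by rewrite -E.
- by rewrite [ltLHS]E.
Qed.

Lemma integral_g1 (f : K -> K) : measurable_fun [set: K] f ->
  g1.-integrable [set: _] (EFin \o f) ->
  \int[g1]_x f x = \int[mu]_x (f x * gphi x).
Proof.
move=> mf fi; rewrite /Rintegral; congr fine.
rewrite integralE [RHS]integralE !ge0_integral_g1//.
- congr (_ - _)%E; apply: eq_integral => x _.
  + by rewrite !funeposE EFinM !(muleC _ (gphi x)%:E) maxe_pMr ?mule0 ?lee_fin ?gphi_ge0.
  + rewrite !funenegE EFinM !(muleC _ (gphi x)%:E) -muleN.
    by rewrite maxe_pMr ?mule0 ?lee_fin ?gphi_ge0.
- by apply: measurable_funeneg; exact/measurable_EFinP.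
- by apply: measurable_funepos; exact/measurable_EFinP.
Qed.

Lemma gphiE x : gphi x = gphi 0 * expR (- (x ^+ 2 / 2)).
Proof.
rewrite /gphi !normal_pdfE ?oner_neq0// /normal_fun !subr0 expr0n/= oppr0 mul0r.
by rewrite expR0 mulr1 expr1n mulNr.
Qed.

Lemma gphi0_gt0 : 0 < gphi 0.
Proof.
rewrite /gphi !normal_pdfE ?oner_neq0// mulr_gt0 ?expR_gt0//.
exact: normal_peak_gt0 (oner_neq0 _).
Qed.

Lemma gphi_gt0 x : 0 < gphi x.
Proof. by rewrite gphiE mulr_gt0 ?gphi0_gt0 ?expR_gt0. Qed.

Lemma gphi0_le1 : gphi 0 <= 1.
Proof.
rewrite /gphi !normal_pdfE ?oner_neq0// /normal_fun subr0 expr0n/= oppr0 mul0r expR0 mulr1.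
have h : 1 <= Num.sqrt (pi *+ 2) :> K.
  rewrite -[leLHS]sqrtr1 ler_sqrt mulr2n; last by have := pi_ge0 K; lra.
  by have := pi_ge2 K; lra.
by rewrite /normal_peak expr1n mul1r invf_le1// (lt_le_trans ltr01).
Qed.

Lemma gphi_le0 x : gphi x <= gphi 0.
Proof.
rewrite gphiE ler_piMr ?gphi_ge0// -expR0 ler_expR oppr_le0.
by rewrite mulr_ge0 ?sqr_ge0// invr_ge0.
Qed.

Lemma is_derive_gphi (x : K) : is_derive x 1 gphi (- (x * gphi x)).
Proof.
have -> : gphi = (fun x => gphi 0 * expR (- (x ^+ 2 / 2))) by apply/funext/gphiE.
apply: is_derive_eq.
rewrite /= !scaler1 !scaler0 /GRing.scale/=; by field.
Qed.

Lemma continuous_gphi : continuous gphi.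
Proof. by apply: continuous_normal_pdf; rewrite oner_neq0. Qed.

(** Since |x|^m <= m! e^|x|, and e^|x| phi(x) is bounded because |x| - x^2/2 <=
1/2. *)
Lemma expn_gphi_le m x : `|x| ^+ m * gphi x <= 2 * m`!%:R.
Proof.
have h1 : `|x| ^+ m <= m`!%:R * expR `|x|.
  rewrite -ler_pdivrMl ?ltr0n ?fact_gt0// mulrC.
  case: m => [|m]; first by rewrite expr0 fact0 divr1 -expR0 ler_expR.
  by apply: le_trans (expR_ge1Dxn m (normr_ge0 x)); rewrite lerDr.
have h2 : expR `|x| * gphi x <= 2.
  rewrite gphiE mulrCA -expRD (le_trans (ler_piMl (expR_ge0 _) gphi0_le1))//.
  have e : expR (2^-1 : K) <= 2.
    rewrite -[2^-1]opprK expRN -[leRHS]invrK lef_pV2 ?posrE ?expR_gt0 ?invr_gt0//.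
    by apply: le_trans (expR_ge1Dx _); lra.
  apply: le_trans e; rewrite ler_expR -real_normK ?num_real//.
  by have := sqr_ge0 (`|x| - 1); lra.
apply: (le_trans (ler_wpM2r (gphi_ge0 x) h1)).
by rewrite -mulrA mulrC ler_wpM2r.
Qed.

(** The fundamental theorem of calculus on [-n, n], as n tends to infinity. *)
Lemma integral_derive0 (G G' : K -> K) :
  (forall x : K, is_derive x 1 G (G' x)) -> continuous G' ->
  mu.-integrable [set: K] (EFin \o G') ->
  G n%:R @[n --> \oo] --> (0 : K) -> G (- n%:R) @[n --> \oo] --> (0 : K) ->
  \int[mu]_x G' x = 0.
Proof.
move=> dG cG' iG' G0 GN0.
have E n : (\int[mu]_x ((G' \_ `[- n.+1%:R, n.+1%:R]) x)%:E = (G n.+1%:R - G (- n.+1%:R))%:E)%E.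
  have -> : (fun x => ((G' \_ `[- n.+1%:R, n.+1%:R]) x)%:E) = (EFin \o G') \_ `[- n.+1%:R, n.+1%:R].
    by rewrite restrict_EFin.
  rewrite -integral_mkcond /= (@continuous_FTC2 _ _ G)//.
  - by rewrite ltrNl (lt_trans _ (ltr0Sn _ _))// oppr_lt0.
  - by apply: continuous_subspaceT => x; exact: cG'.
  - have dGx x : derivable G x 1 by have [] := dG x.
    split => //.
    + by apply: cvg_at_right_filter; apply/differentiable_continuous/derivable1_diffP.
    + by apply: cvg_at_left_filter; apply/differentiable_continuous/derivable1_diffP.
  - by move=> x _; rewrite derive1E; have [_ ->] := dG x.
have mG' : measurable_fun [set: K] G' by move: (iG') => /integrableP[/measurable_EFinP].
have cv := @dominated_cvg _ _ _ mu [set: K] measurableT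
  (fun n x => ((G' \_ `[- n.+1%:R, n.+1%:R]) x)%:E) (EFin \o G') (fun x => `|(G' x)%:E|)%E.
have {}cv : (\int[mu]_x ((G' \_ `[- n.+1%:R, n.+1%:R]) x)%:E)%E @[n --> \oo] -->
    (\int[mu]_x (EFin \o G') x)%E.
  apply: cv.
  - move=> n; apply/measurable_EFinP/(measurable_restrictT _ _).1 => //.
    exact: measurable_funTS.
  - move=> x _; apply: cvg_near_cst; near=> n; rewrite /= patchE ifT//.
    rewrite inE/= in_itv/= -ler_norml (@le_trans _ _ n%:R)// ?ler_nat//.
    by near: n; exact: nbhs_infty_ger.
  - by [].
  - exact: integrable_abse.
  - move=> n x _; rewrite lee_fin patchE; case: ifP => // _.
    by rewrite normr0 normr_ge0.
move: cv; under eq_fun do rewrite E.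
have h : (G n.+1%:R - G (- n.+1%:R))%:E @[n --> \oo] --> (0 : K)%:E.
  apply: cvg_EFin; first exact: nearW.
  rewrite -[X in _ --> X](subrr 0).
  by apply: cvgB; [move: G0|move: GN0]; rewrite -(cvg_shiftn 1);
    under eq_fun do rewrite addn1.
move=> cv; have /(_ _ _ h cv) : forall x y : \bar K,
  (G n.+1%:R - G (- n.+1%:R))%:E @[n --> \oo] --> x ->
  (G n.+1%:R - G (- n.+1%:R))%:E @[n --> \oo] --> y -> x = y.
  by move=> x y hx hy; exact: (cvg_unique (@ereal_hausdorff K) hx hy).
by rewrite /Rintegral => <-.
Unshelve. all: by end_near. Qed.

End normal_density.

(** * Stein's identity on the line *)

Section stein.
Context (K : realType).
Notation vec n := (n.-tuple (measurableTypeR K)).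
Notation g1 := (normal_prob (0 : K) 1).
Notation mu := (@lebesgue_measure K).

Lemma gphiN (x : K) : gphi (- x) = gphi x.
Proof. by rewrite gphiE sqrrN -gphiE. Qed.

Lemma cvg_mul_gphi m (H : K -> K) (M : K) : (forall x, `|H x| <= M * `|x| ^+ m) ->
  (H n%:R * gphi n%:R @[n --> \oo] --> (0 : K)) /\
  (H (- n%:R) * gphi (- n%:R) @[n --> \oo] --> (0 : K)).
Proof.
move=> HM; have M0 : 0 <= M by have := HM 1; rewrite normr1 expr1n mulr1; exact: le_trans.
have b (x : K) : `|H x * gphi x| * `|x| <= M * (2 * m.+1`!%:R).
  rewrite normrM (ger0_norm (gphi_ge0 x)).
  apply: (@le_trans _ _ (M * (`|x| ^+ m.+1 * gphi x))); last first.
    by rewrite ler_wpM2l// expn_gphi_le.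
  have -> : M * (`|x| ^+ m.+1 * gphi x) = (M * `|x| ^+ m) * gphi x * `|x| by rewrite exprS; ring.
  by rewrite !ler_wpM2r ?gphi_ge0.
have cvg0 (u : nat -> K) : (forall n, `|u n| * n%:R <= M * (2 * m.+1`!%:R)) ->
    u n @[n --> \oo] --> (0 : K).
  move=> ub; apply/cvgrPdist_le => e e0.
  near=> n; rewrite sub0r normrN.
  have n0 : 0 < n%:R :> K by near: n; exact: nbhs_infty_gtr.
  rewrite -(ler_pM2r n0) (le_trans (ub n))// -ler_pdivrMl//.
  by near: n; exact: nbhs_infty_ger.
split; apply: cvg0 => n.
  by have := b n%:R; rewrite (ger0_norm (ler0n K n)).
by have := b (- n%:R); rewrite normrN (ger0_norm (ler0n K n)).
Unshelve. all: by end_near. Qed.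

Lemma integrable_gphiM (f : K -> K) (C : K) m : measurable_fun [set: K] f ->
  (forall x, `|f x| <= C * `|x| ^+ m) ->
  mu.-integrable [set: K] (EFin \o (fun x => f x * gphi x)).
Proof.
move=> mf fC.
have C0 : 0 <= C by have := fC 1; rewrite normr1 expr1n mulr1; exact: le_trans.
have s2 : Num.sqrt 2 != 0 :> K by rewrite sqrtr_eq0 -ltNge.
have := integrable_normal_pdf (0 : K) (Num.sqrt 2).
set q := normal_pdf 0 (Num.sqrt 2).
have qE x : q x = normal_peak (Num.sqrt 2) * expR (- (x ^+ 2 / 4)).
  rewrite /q normal_pdfE// /normal_fun subr0 sqr_sqrtr//.
  by congr (_ * expR _); rewrite mulNr -mulr_natr; congr (- (_ / _)); ring.
have p0 := normal_peak_gt0 s2.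
pose A := C * (2 ^+ m * (2 * m`!%:R)) / normal_peak (Num.sqrt 2).
have A0 : 0 <= A.
  by rewrite /A divr_ge0 ?(ltW p0)// !mulr_ge0 ?exprn_ge0.
move=> qi; have := integrableZl measurableT A qi.
apply: le_integrable => //.
  by apply/measurable_EFinP/measurable_funM => //; exact: measurable_gphi.
move=> x _; rewrite -EFinM /= lee_fin [leLHS]normrM [leRHS]normrM (ger0_norm (gphi_ge0 x)) (ger0_norm (normal_pdf_ge0 _ _ _)).
apply: (le_trans (ler_wpM2r (gphi_ge0 x) (fC x))).
have e : expR (- (x ^+ 2 / 2)) = expR (- (x ^+ 2 / 4)) * expR (- (x ^+ 2 / 4)) :> K.
  by rewrite -expRD; congr expR; field.
have h : `|x / 2| ^+ m * gphi (x / 2) <= 2 * m`!%:R by exact: expn_gphi_le.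
have g4 : gphi 0 * expR (- (x ^+ 2 / 4)) <= gphi (x / 2).
  rewrite [leRHS]gphiE ler_wpM2l ?gphi_ge0// ler_expR lerN2.
  by have := sqr_ge0 x; rewrite exprMn; lra.
rewrite (ger0_norm A0) -/q qE mulrA divfK ?gt_eqF//.
have -> : C * `|x| ^+ m * gphi x = C * (2 ^+ m * (`|x / 2| ^+ m * (gphi 0 * expR (- (x ^+ 2 / 4))))) * expR (- (x ^+ 2 / 4)).
  rewrite [gphi x]gphiE e normrM exprMn normfV (ger0_norm (ler0n _ 2)) exprVn.
  by field; rewrite expf_neq0.
rewrite ler_wpM2r ?expR_ge0// ler_wpM2l// ler_wpM2l ?exprn_ge0//.
by apply: le_trans h; rewrite ler_wpM2l// exprn_ge0.
Qed.

Lemma integrable_g1_poly (f : K -> K) (C : K) m : measurable_fun [set: K] f ->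
  (forall x, `|f x| <= C * `|x| ^+ m) -> g1.-integrable [set: _] (EFin \o f).
Proof. by move=> mf fC; apply/integrable_g1P => //; exact: integrable_gphiM fC. Qed.

Lemma measurable_exprn m : measurable_fun [set: K] (fun x : K => x ^+ m).
Proof. exact: measurable_funX. Qed.

Lemma integrable_g1_exp m : g1.-integrable [set: _] (EFin \o (fun x : K => x ^+ m)).
Proof.
apply: (@integrable_g1_poly _ 1 m); first exact: measurable_exprn.
by move=> x; rewrite mul1r normrX.
Qed.

Lemma integrable_g1_bounded (f : K -> K) (M : K) : measurable_fun [set: K] f ->
  (forall x, `|f x| <= M) -> g1.-integrable [set: _] (EFin \o f).
Proof. by move=> mf fM; exact: (@bounded_integrable _ _ _ g1 f M). Qed.

(** Integration of the derivative of H phi, which tends to 0 at both ends. *)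
Lemma stein1 (H H' : K -> K) (M : K) :
  (forall x : K, is_derive x 1 H (H' x)) -> continuous H' ->
  (forall x, `|H x| <= M) -> (forall x, `|H' x| <= M) ->
  \int[g1]_x (x * H x) = \int[g1]_x H' x.
Proof.
move=> dH cH' HM H'M.
have cH : continuous H.
  by move=> x; apply/differentiable_continuous/derivable1_diffP; have [] := dH x.
have mH : measurable_fun [set: K] H by exact: continuous_measurable_fun.
have mH' : measurable_fun [set: K] H' by exact: continuous_measurable_fun.
have mxH : measurable_fun [set: K] (fun x => x * H x) by exact: measurable_funM.
have i1 : mu.-integrable [set: K] (EFin \o (fun x => H' x * gphi x)).
  by apply: (@integrable_gphiM _ M 0) => // x; rewrite expr0 mulr1.
have xHM x : `|x * H x| <= M * `|x| ^+ 1.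
  by rewrite expr1 normrM mulrC ler_wpM2r.
have i2 : mu.-integrable [set: K] (EFin \o (fun x => x * H x * gphi x)).
  exact: integrable_gphiM xHM.
have [c1 c2] : (H n%:R * gphi n%:R @[n --> \oo] --> (0 : K)) /\
   (H (- n%:R) * gphi (- n%:R) @[n --> \oo] --> (0 : K)).
  by apply: (@cvg_mul_gphi 0 H M) => x; rewrite expr0 mulr1.
have := @integral_derive0 K (fun x => H x * gphi x) (fun x => H' x * gphi x - x * H x * gphi x).
have -> : \int[mu]_x (H' x * gphi x - x * H x * gphi x) =
  \int[mu]_x (H' x * gphi x) - \int[mu]_x (x * H x * gphi x) by exact: RintegralB.
rewrite -integral_g1//; last by apply/integrable_g1P.
rewrite -integral_g1//; last by apply/integrable_g1P.
move=> /(_ _ _ _ c1 c2) h; apply/esym/eqP; rewrite -subr_eq0; apply/eqP/h.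
- move=> x; have := dH x => dHx; have dp := is_derive_gphi x.
  by apply: is_derive_eq; rewrite /GRing.scale/=; ring.
- move=> x; apply: cvgB; first by apply: cvgM; [exact: cH'|exact: continuous_gphi].
  apply: cvgM; last exact: continuous_gphi.
  by apply: cvgM; [exact: cvg_id|exact: cH].
- have := integrableB measurableT i1 i2.
  by apply: eq_integrable => // x _ /=; rewrite EFinB.
Qed.

Lemma g1_var : \int[g1]_x ((x : K) ^+ 2) = 1.
Proof.
have [c1 c2] := @cvg_mul_gphi 1 id 1 (fun x => ltac:(by rewrite mul1r)).
have i1 : mu.-integrable [set: K] (EFin \o (fun x => 1 * gphi x)).
  by apply: (@integrable_gphiM _ 1 0) => // x; rewrite expr0 mulr1 normr1.
have i2 : mu.-integrable [set: K] (EFin \o (fun x => x ^+ 2 * gphi x)).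
  apply: (@integrable_gphiM _ 1 2); first exact: measurable_exprn.
  by move=> x; rewrite mul1r normrX.
have := @integral_derive0 K (fun x => x * gphi x) (fun x => 1 * gphi x - x ^+ 2 * gphi x).
have -> : \int[mu]_x (1 * gphi x - x ^+ 2 * gphi x) =
  \int[mu]_x (1 * gphi x) - \int[mu]_x (x ^+ 2 * gphi x) by exact: RintegralB.
rewrite -(@integral_g1 _ (cst 1))//; last first.
  by apply: (@integrable_g1_bounded _ 1) => // x; rewrite normr1.
rewrite -integral_g1//; last exact: integrable_g1_exp.
rewrite Rintegral_cstT.
move=> /(_ _ _ _ c1 c2) h; apply/esym/eqP; rewrite -subr_eq0; apply/eqP/h.
- move=> x; have dp := is_derive_gphi x.
  by apply: is_derive_eq; rewrite /GRing.scale/=; ring.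
- move=> x; apply: cvgB.
    by apply: cvgM; [exact: cvg_cst|exact: continuous_gphi].
  by apply: cvgM; [exact: exprn_continuous|exact: continuous_gphi].
- have := integrableB measurableT i1 i2.
  by apply: eq_integrable => // x _ /=; rewrite EFinB.
Qed.

End stein.

(** * Stein's identity for Gaussian vectors *)

Section gaussian_stein.
Context (K : realType).
Notation vec n := (n.-tuple (measurableTypeR K)).
Notation g1 := (normal_prob (0 : K) 1).

(** The i-th partial derivative of a function H of a vector is expressed as the
derivative of t |-> H (upd x i t). *)
Definition upd n (x : vec n) (i : 'I_n) (t : K) : vec n :=
  [tuple if j == i then t else tnth x j | j < n].

Lemma tnth_cons0 n (t : K) (y : vec n) : tnth (Defs.cons_tuple (t, y)) ord0 = t.
Proof. by rewrite tnth0. Qed.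

Lemma tnth_consS n (t : K) (y : vec n) i :
  tnth (Defs.cons_tuple (t, y)) (lift ord0 i) = tnth y i.
Proof. by rewrite tnthS. Qed.

Lemma upd_cons0 n (x0 t : K) (y : vec n) :
  upd (Defs.cons_tuple (x0, y)) ord0 t = Defs.cons_tuple (t, y).
Proof.
apply: eq_from_tnth => j; rewrite tnth_mktuple.
case: (unliftP ord0 j) => [k|] ->; last by rewrite eqxx tnth_cons0.
by rewrite [_ == _]eq_sym (negbTE (neq_lift _ _)) !tnth_consS.
Qed.

Lemma upd_consS n (x0 t : K) (y : vec n) i :
  upd (Defs.cons_tuple (x0, y)) (lift ord0 i) t = Defs.cons_tuple (x0, upd y i t).
Proof.
apply: eq_from_tnth => j; rewrite tnth_mktuple.
case: (unliftP ord0 j) => [k|] ->; last by rewrite (negbTE (neq_lift _ _)) !tnth_cons0.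
by rewrite !tnth_consS tnth_mktuple (inj_eq lift_inj).
Qed.

Lemma gint_mul n (f : K -> K) (h : vec n -> K) :
  measurable_fun [set: K] f -> g1.-integrable [set: _] (EFin \o f) -> gint h ->
  (g1 \x gaussian K n)%E.-integrable [set: _] (EFin \o (fun z => f z.1 * h z.2)).
Proof.
move=> mf fi hi; have mh := gint_meas hi.
have m2 : measurable_fun [set: _] (fun z : measurableTypeR K * vec n => f z.1 * h z.2).
  apply: measurable_funM.
    exact: measurableT_comp mf (measurable_fst).
  exact: measurableT_comp mh (measurable_snd).
apply/integrable12ltyP => /=; first exact/measurable_EFinP.
have hfin : (\int[gaussian K n]_y `|(h y)%:E| < +oo)%E by move: hi => /integrableP[].
have ffin : (\int[g1]_y `|(f y)%:E| < +oo)%E by move: fi => /integrableP[].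
have h0 : (0 <= \int[gaussian K n]_y `|(h y)%:E|)%E by apply: integral_ge0.
have E x : (\int[gaussian K n]_y `|(f x * h y)%:E| =
    `|(f x)%:E| * \int[gaussian K n]_y `|(h y)%:E|)%E.
  rewrite -ge0_integralZl//.
  - by apply: eq_integral => y _; rewrite EFinM abseM.
  - by apply: measurableT_comp => //; exact/measurable_EFinP.
under eq_integral do rewrite E.
rewrite ge0_integralZr//.
  by rewrite lte_mul_pinfty// ?integral_ge0// ge0_fin_numE// integral_ge0.
by apply: measurableT_comp => //; exact/measurable_EFinP.
Qed.

(** A function of the first coordinate is independent of the other ones. *)
Lemma gint_cons_mul n (f : K -> K) (h : vec n -> K) (F : vec n.+1 -> K) :
  measurable_fun [set: _] F ->
  (forall x y, F (Defs.cons_tuple (x, y)) = f x * h y) ->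
  measurable_fun [set: K] f -> g1.-integrable [set: _] (EFin \o f) -> gint h ->
  gint F /\ gaussE F = (\int[g1]_x f x) * gaussE h.
Proof.
move=> mF FE mf fi hi.
have gF : gint F.
  apply/gint_consP => //; apply: eq_integrable (gint_mul mf fi hi) => //.
  by move=> [x y] _ /=; rewrite FE.
split => //; rewrite gaussE_cons// -RintegralZr//.
apply: eq_Rintegral => x _; rewrite -RintegralZl//.
by apply: eq_Rintegral => y _; rewrite FE.
Qed.

Lemma gint_tnth n (i : 'I_n) : gint (fun x : vec n => tnth x i : K).
Proof.
elim: n i => [[]//|n IH] i.
have m := @measurable_tnthK K _ i.
case: (unliftP ord0 i) m => [j|] -> m.
  have := @gint_cons_mul n (cst 1) (fun y => tnth y j) _ m.
  case=> //; first by move=> x y; rewrite tnth_consS mul1r.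
  by apply: (@integrable_g1_bounded _ _ 1) => // x; rewrite normr1.
have := @gint_cons_mul n id (cst 1) _ m.
case=> //; first by move=> x y; rewrite tnth_cons0 mulr1.
- exact: (@integrable_g1_exp K 1).
- by apply: (@gint_bounded _ _ _ 1) => // x; rewrite normr1.
Qed.

(** Induction on the dimension: by Fubini, coordinate i of a vector is either
its head, where the one-dimensional identity applies, or a coordinate of its
tail. *)
Lemma stein n (i : 'I_n) (H H' : vec n -> K) (M : K) :
  measurable_fun [set: vec n] H -> measurable_fun [set: vec n] H' ->
  (forall x (t : K), is_derive t 1 (fun s => H (upd x i s)) (H' (upd x i t))) ->
  (forall x, continuous (fun t : K => H' (upd x i t))) ->
  (forall x, `|H x| <= M) -> (forall x, `|H' x| <= M) ->
  gaussE (fun x => tnth x i * H x) = gaussE H'.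
Proof.
elim: n i H H' => [[]//|n IH] i H H' mH mH' dH cH' HM H'M.
have gi : gint (fun x => tnth x i * H x).
  exact: (integrable_bounded_mul mH HM (gint_tnth i)).
have gi' : gint H' by exact: gint_bounded H'M.
case: (unliftP ord0 i) => [j|] ei; rewrite {}ei in gi dH cH' *.
  rewrite (gaussE_cons gi) [RHS](gaussE_cons gi'); apply: eq_Rintegral => x _.
  apply: (etrans _ (IH j (fun y => H (Defs.cons_tuple (x, y))) (fun y => H' (Defs.cons_tuple (x, y))) _ _ _ _ _ _)) => //.
  - by congr gaussE; apply/funext => y; rewrite tnth_consS.
  - exact: measurableT_comp mH (measurable_cons_r _).
  - exact: measurableT_comp mH' (measurable_cons_r _).
  - move=> y t; have := dH (Defs.cons_tuple (x, y)) t.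
    by rewrite upd_consS; under eq_fun do rewrite upd_consS.
  - move=> y; have := cH' (Defs.cons_tuple (x, y)).
    by under eq_fun do rewrite upd_consS.
rewrite (gaussE_cons2 gi) [RHS](gaussE_cons2 gi'); congr gaussE; apply/funext => y.
apply: (etrans _ (@stein1 K (fun x => H (Defs.cons_tuple (x, y))) (fun x => H' (Defs.cons_tuple (x, y))) M _ _ _ _)) => //.
- move=> t; have := dH (Defs.cons_tuple (0, y)) t.
  by rewrite upd_cons0; under eq_fun do rewrite upd_cons0.
- have := cH' (Defs.cons_tuple (0, y)).
  by under eq_fun do rewrite upd_cons0.
Qed.

End gaussian_stein.

(** * Products of smooth functions of linear forms *)

Section smooth_product.
Context (K : realType) (R : finType) (alpha : {set R}) (n : nat).
Notation vec n := (n.-tuple (measurableTypeR K)).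
Context (F : R -> nat -> K -> K) (B : R -> nat -> K).
Hypothesis dF : forall u s (x : K), is_derive x 1 (F u s) (F u s.+1 x).
Hypothesis FB : forall u s x, `|F u s x| <= B u s.

Definition inc (s : R -> nat) (u : R) : R -> nat := fun e => (s e + (e == u))%N.

(** The families F u : nat -> K -> K list the successive derivatives of a smooth
function attached to u, so s is a multi-index of derivatives; inc s u
differentiates once more in the direction u. *)
Definition sprod (s : R -> nat) (w : R -> K) : K := \prod_(u in alpha) F u (s u) (w u).

Definition bprod (s : R -> nat) : K := \prod_(u in alpha) B u (s u).

Lemma sprod_le s w : `|sprod s w| <= bprod s.
Proof. by rewrite normr_prod; apply: ler_prod => u _; rewrite normr_ge0 FB. Qed.

Lemma bprod_ge0 s : 0 <= bprod s.
Proof. exact: le_trans (sprod_le s (fun=> 0)). Qed.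

Lemma continuous_F u s : continuous (F u s).
Proof.
by move=> x; apply/differentiable_continuous/derivable1_diffP; have [] := dF u s x.
Qed.

Lemma measurable_F u s : measurable_fun [set: K] (F u s).
Proof. by apply: continuous_measurable_fun; exact: continuous_F. Qed.

Lemma is_derive_sprod s (w : R -> K -> K) (dw : R -> K) (t : K) :
  (forall u, is_derive t 1 (w u) (dw u)) ->
  is_derive t 1 (fun t => sprod s (fun u => w u t))
    (\sum_(u in alpha) dw u * sprod (inc s u) (fun u => w u t)).
Proof.
move=> wd; rewrite /sprod.
have -> : (fun t => \prod_(u in alpha) F u (s u) (w u t)) =
  (fun t => \prod_(u <- enum alpha) F u (s u) (w u t)).
  by apply/funext => x; rewrite big_enum.
have -> : \sum_(u in alpha) dw u * \prod_(v in alpha) F v (inc s u v) (w v t) =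
  \sum_(u <- enum alpha) dw u * \prod_(v <- enum alpha) F v (inc s u v) (w v t).
  by rewrite big_enum /=; apply: eq_bigr => u _; rewrite big_enum.
elim: (enum alpha) (enum_uniq alpha) => [_|u r IH /= /andP[ur /IH {}IH]].
  under eq_fun do rewrite big_nil.
  by rewrite big_nil; apply: is_derive_cst.
have -> : (fun t0 : K => \prod_(u0 <- (u :: r)) F u0 (s u0) (w u0 t0)) =
  ((F u (s u) \o w u) * (fun t0 => \prod_(u0 <- r) F u0 (s u0) (w u0 t0)))%R.
  by apply/funext => x; rewrite big_cons.
have d1 := is_derive1_comp (dF u (s u) (w u t)) (wd u).
apply: is_derive_eq; rewrite /GRing.scale /= !big_cons addrC; congr (_ + _).
  have -> : inc s u u = (s u).+1 by rewrite /inc eqxx addn1.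
  rewrite [X in _ = _ * (_ * X)](eq_big_seq (fun v => F v (s v) (w v t))).
    by ring.
  move=> v vr; rewrite /inc; case: eqP => [vu|_]; last by rewrite addn0.
  by rewrite -vu vr in ur.
rewrite mulr_sumr; apply: eq_big_seq => v vr; rewrite !big_cons.
rewrite mulrCA; congr (_ * (_ * _)); rewrite /inc; case: eqP => [uv|_]; last by rewrite addn0.
by rewrite uv vr in ur.
Qed.

Definition lin (c : 'I_n -> K) (x : vec n) : K := \sum_(i < n) c i * tnth x i.

Lemma measurable_lin c : measurable_fun [set: vec n] (lin c).
Proof.
by apply: measurable_sum => i; apply: measurable_funM => //; exact: measurable_tnthK.
Qed.

Lemma gint_lin c : gint (lin c).
Proof.
rewrite /gint; have := @integrable_sum _ _ _ (gaussian K n) _ measurableT 'I_n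
   (index_enum 'I_n) predT (fun i x => (c i * tnth x i)%:E).
move=> h; apply: eq_integrable (h _) => //.
  by move=> x _ /=; rewrite sumEFin.
move=> i _; have := integrableZl measurableT (c i) (@gint_tnth K n i).
by apply: eq_integrable.
Qed.

Lemma measurable_sprod s (c : R -> 'I_n -> K) :
  measurable_fun [set: vec n] (fun x => sprod s (fun u => lin (c u) x)).
Proof.
rewrite /sprod; under eq_fun do rewrite -big_enum.
apply: measurable_prod => u _; apply: measurableT_comp (measurable_F _ _) _.
exact: measurable_lin.
Qed.

Definition Esprod s (c : R -> 'I_n -> K) : K :=
  gaussE (fun x => sprod s (fun u => lin (c u) x)).

Lemma Esprod_le s c : `|Esprod s c| <= bprod s.
Proof. by apply: gaussE_bound; [exact: measurable_sprod|move=> x; exact: sprod_le]. Qed.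

Lemma gint_sprod s c : gint (fun x => sprod s (fun u => lin (c u) x)).
Proof.
by apply: (gint_bounded (measurable_sprod s c)) => x; exact: sprod_le.
Qed.

Lemma lin_upd c (x : vec n) i t : lin c (upd x i t) = lin c x + c i * (t - tnth x i).
Proof.
rewrite /lin (bigD1 i)//= [in RHS](bigD1 i)//= tnth_mktuple eqxx.
rewrite (eq_bigr (fun j => c j * tnth x j)); last first.
  by move=> j ji; rewrite tnth_mktuple (negbTE ji).
by ring.
Qed.

(** Stein's identity in each coordinate i, followed by the chain rule: the i-th
partial derivative of <c v, x> is c v i. *)
Lemma stein_sprod s (c : R -> 'I_n -> K) (d : 'I_n -> K) :
  gaussE (fun x => lin d x * sprod s (fun u => lin (c u) x)) =
  \sum_(v in alpha) (\sum_i d i * c v i) * Esprod (inc s v) c.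
Proof.
pose H x := sprod s (fun u => lin (c u) x).
pose H' i x := \sum_(v in alpha) c v i * sprod (inc s v) (fun u => lin (c u) x).
have mH : measurable_fun [set: vec n] H by exact: measurable_sprod.
have HM x : `|H x| <= bprod s by exact: sprod_le.
have gx i : gint (fun x => tnth x i * H x).
  exact: (integrable_bounded_mul mH HM (@gint_tnth K n i)).
have mH' i : measurable_fun [set: vec n] (H' i).
  rewrite /H'; under eq_fun do rewrite -big_enum.
  apply: measurable_sum => u; apply: measurable_funM => //; exact: measurable_sprod.
have H'M i x : `|H' i x| <= \sum_(v in alpha) `|c v i| * bprod (inc s v).
  rewrite (le_trans (ler_norm_sum _ _ _))//; apply: ler_sum => v _.
  by rewrite normrM ler_wpM2l// sprod_le.
have dl x i (t : K) u : is_derive t 1 (fun t => lin (c u) (upd x i t)) (c u i).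
  under eq_fun do rewrite lin_upd.
  by apply: is_derive_eq; rewrite /GRing.scale /=; ring.
have st i : gaussE (fun x => tnth x i * H x) = gaussE (H' i).
  apply: (@stein _ _ _ _ _ (bprod s + \sum_(v in alpha) `|c v i| * bprod (inc s v))) => //.
  - by move=> x t; exact: (is_derive_sprod s (dl x i t)).
  - move=> x; rewrite /H'.
    have cs v : continuous (fun t : K => sprod (inc s v) (fun u => lin (c u) (upd x i t))).
      move=> t; apply/differentiable_continuous/derivable1_diffP.
      by have [] := is_derive_sprod (inc s v) (dl x i t).
    apply: continuous_big => [|v _]; first exact: add_continuous.
    by move=> t; apply: cvgM; [exact: cvg_cst|exact: cs].
  - move=> x; rewrite (le_trans (sprod_le _ _))// lerDl sumr_ge0// => v _.
    by rewrite mulr_ge0// bprod_ge0.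
  - by move=> x; rewrite (le_trans (H'M i x))// lerDr bprod_ge0.
have -> : (fun x => lin d x * sprod s (fun u => lin (c u) x)) =
    (fun x => \sum_i d i * (tnth x i * H x)).
  by apply/funext => x; rewrite mulr_suml; apply: eq_bigr => i _; rewrite mulrA.
have gZ i : gint (fun x => d i * (tnth x i * H x)).
  by have := integrableZl measurableT (d i) (gx i); apply: eq_integrable.
rewrite {1}/gaussE Rintegral_sumT//.
transitivity (\sum_i d i * gaussE (H' i)).
  by apply: eq_bigr => i _; rewrite -st; exact: (RintegralZl _ measurableT (gx i)).
have EH' i : gaussE (H' i) = \sum_(v in alpha) c v i * Esprod (inc s v) c.
  rewrite {1}/gaussE Rintegral_sumT.
    apply: eq_bigr => v _.
    exact: (RintegralZl _ measurableT (gint_sprod (inc s v) c)).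
  move=> v; have := integrableZl measurableT (c v i) (gint_sprod (inc s v) c).
  exact: eq_integrable.
under eq_bigr => i _ do rewrite EH' mulr_sumr.
rewrite exchange_big /=; apply: eq_bigr => v _.
by rewrite mulr_suml; apply: eq_bigr => i _; rewrite mulrA.
Qed.

End smooth_product.

(** * Gaussian interpolation *)

Section interpolation.
Context (K : realType) (R : finType) (alpha : {set R}) (n : nat).
Notation vec n := (n.-tuple (measurableTypeR K)).
Context (F : R -> nat -> K -> K) (B : R -> nat -> K).
Hypothesis dF : forall u s (x : K), is_derive x 1 (F u s) (F u s.+1 x).
Hypothesis FB : forall u s x, `|F u s x| <= B u s.
Context (a b : R -> 'I_n -> K).
Hypothesis orth : forall u v, u \in alpha -> v \in alpha -> \sum_i a u i * b v i = 0.

(** The square roots make the covariance of the mixture of two orthogonal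
families linear in t: it is t G_a + (1 - t) G_b. *)
Definition mixc (t : K) (u : R) (i : 'I_n) : K :=
  Num.sqrt t * a u i + Num.sqrt (1 - t) * b u i.

Definition Psi s t := Esprod alpha F s (mixc t).

Lemma lin_mixc t u (x : vec n) :
  lin (mixc t u) x = Num.sqrt t * lin (a u) x + Num.sqrt (1 - t) * lin (b u) x.
Proof.
rewrite /lin !mulr_sumr -big_split/=; apply: eq_bigr => i _.
by rewrite /mixc mulrDl !mulrA.
Qed.

Lemma Psi_continuous s (t : K) : -1 < t < 2 -> {for t, continuous (Psi s)}.
Proof.
move=> tI.
have := @continuity_under_integral K _ _ (gaussian K n)
  (fun t x => sprod alpha F s (fun u => lin (mixc t u) x)) [set: _] measurableT (-1) 2.
move=> /(_ _ _ (fun=> bprod alpha B s)) h.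
apply: h; last by rewrite inE/= in_itv.
- by move=> x _; exact: (@gint_sprod K R alpha n F B dF FB s (mixc x)).
- apply: aeW => y _ x _; rewrite /sprod.
  have -> : (fun t0 => \prod_(u in alpha) F u (s u) (lin (mixc t0 u) y)) =
     (fun t0 => \prod_(u <- enum alpha) F u (s u) (lin (mixc t0 u) y)).
    by apply/funext => z; rewrite big_enum.
  apply: continuous_big => [|u _]; first exact: mul_continuous.
  move=> z; apply: continuous_comp; last exact: (@continuous_F K R F dF).
  have -> : (fun t0 => lin (mixc t0 u) y) =
     (fun t0 => Num.sqrt t0 * lin (a u) y + Num.sqrt (1 - t0) * lin (b u) y).
    by apply/funext => w; rewrite lin_mixc.
  apply: cvgD; apply: cvgM; try exact: cvg_cst.
    exact: sqrt_continuous.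
  apply: (@continuous_comp _ _ _ (fun t0 : K => 1 - t0)); last exact: sqrt_continuous.
  by apply: cvgB; [exact: cvg_cst|exact: cvg_id].
- by apply: (@gint_bounded _ _ _ `|bprod alpha B s|) => // x.
- by move=> x _; apply: aeW => y _; exact: (@sprod_le K R alpha F B FB).
Qed.

Let dmix (t : K) u i : K := (2 * Num.sqrt t)^-1 * a u i - (2 * Num.sqrt (1 - t))^-1 * b u i.

Let lin_dmix t u (x : vec n) :
  lin (dmix t u) x = (2 * Num.sqrt t)^-1 * lin (a u) x - (2 * Num.sqrt (1 - t))^-1 * lin (b u) x.
Proof.
rewrite /lin !mulr_sumr -sumrB; apply: eq_bigr => i _.
by rewrite /dmix mulrBl !mulrA.
Qed.

Let is_derive_mix (t : K) u (x : vec n) : 0 < t < 1 ->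
  is_derive t 1 (fun t => lin (mixc t u) x) (lin (dmix t u) x).
Proof.
move=> /andP[t0 t1]; under eq_fun do rewrite lin_mixc.
have d1 := is_derive1_sqrt t0.
have d2 : is_derive (1 - t) 1 Num.sqrt (2 * Num.sqrt (1 - t))^-1.
  by apply: is_derive1_sqrt; rewrite subr_gt0.
have d3 : is_derive t 1 (fun t : K => 1 - t) (- 1).
  by apply: is_derive_eq; ring.
have d4 := @is_derive1_comp K Num.sqrt (fun t => 1 - t) t _ _ d2 d3.
have -> : (fun t0 : K => Num.sqrt t0 * lin (a u) x + Num.sqrt (1 - t0) * lin (b u) x) =
  (fun t0 : K => Num.sqrt t0 * lin (a u) x + (Num.sqrt \o (fun t => 1 - t)) t0 * lin (b u) x) by [].
by apply: is_derive_eq; rewrite lin_dmix /GRing.scale/=; ring.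
Qed.

(** The cross terms vanish by orthogonality, and the factors sqrt t and sqrt (1
- t) cancel against those of the derivative. *)
Lemma mix_gram t u v : 0 < t < 1 -> u \in alpha -> v \in alpha ->
  \sum_i dmix t u i * mixc t v i =
  2^-1 * (\sum_i a u i * a v i - \sum_i b u i * b v i).
Proof.
move=> /andP[t0 t1] ua va.
have s0 : Num.sqrt t != 0 by rewrite sqrtr_eq0 -ltNge.
have s1 : Num.sqrt (1 - t) != 0 by rewrite sqrtr_eq0 -ltNge subr_gt0.
transitivity (2^-1 * (\sum_i a u i * a v i - \sum_i b u i * b v i)
  + (2 * Num.sqrt t)^-1 * Num.sqrt (1 - t) * (\sum_i a u i * b v i)
  - (2 * Num.sqrt (1 - t))^-1 * Num.sqrt t * (\sum_i a v i * b u i)).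
  rewrite -sumrB !mulr_sumr -big_split -sumrB/=; apply: eq_bigr => i _.
  by rewrite /dmix /mixc; field; rewrite s0 s1.
by rewrite !orth// !mulr0 addr0 subr0.
Qed.

(** Differentiation under the integral gives sum_u E <c'_u, x> F_u, where c' is
the derivative of the mixture c; Stein's identity turns <c'_u, x> into sum_v
<c'_u, c_v> times a further derivative in v. For orthogonal families <c'_u, c_v>
is half the difference of the two Gram matrices, independently of t. *)
Lemma is_derive_Psi s (t : K) : 0 < t < 1 ->
  is_derive t 1 (Psi s)
   (2^-1 * \sum_(u in alpha) \sum_(v in alpha)
      (\sum_i a u i * a v i - \sum_i b u i * b v i) * Psi (inc (inc s u) v) t).
Proof.
move=> t01; have /andP[t0 t1] := t01.
pose f t (x : vec n) := sprod alpha F s (fun u => lin (mixc t u) x).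
have df (t' : K) x : 0 < t' < 1 -> is_derive t' 1 (f ^~ x)
    (\sum_(u in alpha) lin (dmix t' u) x * sprod alpha F (inc s u) (fun u => lin (mixc t' u) x)).
  by move=> h; apply: (@is_derive_sprod K R alpha F dF) => u; exact: is_derive_mix.
pose c1 := (2 * Num.sqrt (t / 2))^-1; pose c2 := (2 * Num.sqrt ((1 - t) / 2))^-1.
pose G (x : vec n) := \sum_(u in alpha) (`|c1 * lin (a u) x| + `|c2 * lin (b u) x|) * bprod alpha B (inc s u).
have b0 s' : 0 <= bprod alpha B s' by exact: (bprod_ge0 _ FB).
have G0 x : 0 <= G x.
  by apply: sumr_ge0 => u _; rewrite mulr_ge0// addr_ge0.
have lI c d : (gaussian K n).-integrable [set: _] (EFin \o (fun x => `|c * @lin K n d x|)).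
  apply: (@integrable_norm _ _ _ _ _ (fun x => c * @lin K n d x)).
  have := integrableZl measurableT c (@gint_lin K n d).
  exact: eq_integrable.
have GI : (gaussian K n).-integrable [set: _] (EFin \o G).
  rewrite /G.
  have := @integrable_sum _ _ _ (gaussian K n) _ measurableT R (index_enum R)
    (mem alpha) (fun u x => ((`|c1 * lin (a u) x| + `|c2 * lin (b u) x|) * bprod alpha B (inc s u))%:E).
  move=> h; apply: eq_integrable (h _) => //.
    by move=> x _ /=; rewrite sumEFin.
  move=> u _; have := integrableZr measurableT (bprod alpha B (inc s u)) (integrableD measurableT (lI c1 (a u)) (lI c2 (b u))).
  by apply: eq_integrable => // x _ /=; rewrite EFinM EFinD.
have I01 (t' : K) : `]t / 2, (1 + t) / 2[%classic t' -> 0 < t' < 1.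
  by rewrite /= in_itv/= => /andP[h1 h2]; lra.
have It : `]t / 2, (1 + t) / 2[%classic t by rewrite /= in_itv/=; lra.
have fI (t' : K) : (gaussian K n).-integrable [set: _] (EFin \o f t').
  exact: (@gint_sprod K R alpha n F B dF FB s (mixc t')).
have fub (t' : K) x : `]t / 2, (1 + t) / 2[%classic t' -> [set: vec n] x ->
    `|partial1of2 f t' x| <= G x.
  move=> h _; rewrite partial1of2E; have [_ ->] := df t' x (I01 _ h).
  rewrite (le_trans (ler_norm_sum _ _ _))//; apply: ler_sum => u _.
  rewrite normrM ler_pM//; last exact: sprod_le.
  move: h; rewrite /= in_itv/= => /andP[h1 h2].
  rewrite lin_dmix (le_trans (ler_normB _ _))// lerD// !normrM ler_wpM2r//.
  - rewrite !normfV !normrM lef_pV2 ?posrE ?mulr_gt0 ?normr_gt0 ?sqrtr_eq0 -?ltNge//; try lra.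
    rewrite ler_wpM2l// !ger0_norm ?sqrtr_ge0// ler_sqrt; lra.
  - rewrite !normfV !normrM lef_pV2 ?posrE ?mulr_gt0 ?normr_gt0 ?sqrtr_eq0 -?ltNge//; try lra.
    rewrite ler_wpM2l// !ger0_norm ?sqrtr_ge0// ler_sqrt; lra.
have fd (t' : K) x : `]t / 2, (1 + t) / 2[%classic t' -> [set: vec n] x -> derivable (f ^~ x) t' 1.
  by move=> h _; have [] := df t' x (I01 _ h).
have D1 := @derivable_under_integral K _ _ (gaussian K n) f _ measurableT t _ _ It
  (fun x _ => fI x) fd G G0 GI fub.
have D2 := @differentiation_under_integral K _ _ (gaussian K n) f _ measurableT t _ _ It
  (fun x _ => fI x) fd G G0 GI fub.
apply: DeriveDef; first exact: D1.
rewrite -derive1E [LHS]D2.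
under eq_Rintegral => x _ do rewrite partial1of2E (@derive_val _ _ _ _ _ _ _ (df t x t01)).
rewrite Rintegral_sumT; last first.
  move=> u; apply: (@integrable_bounded_mul _ _ _ _ _ _ (bprod alpha B (inc s u))).
  - exact: (measurable_sprod alpha dF).
  - by move=> x; exact: sprod_le.
  - exact: gint_lin.
rewrite mulr_sumr; apply: eq_bigr => u ua.
have := @stein_sprod K R alpha n F B dF FB (inc s u) (mixc t) (dmix t u).
rewrite /gaussE => ->; rewrite mulr_sumr; apply: eq_bigr => v va.
by rewrite mix_gram// mulrA.
Qed.

End interpolation.

(** * The normal distribution function and its derivatives *)

Section normal_cdf.
Context (K : realType).
Notation g1 := (normal_prob (0 : K) 1).
Notation mu := (@lebesgue_measure K).

Definition Phi (x : K) : K := fine (g1 `]-oo, x]).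

Lemma PhiE x : (Phi x)%:E = g1 `]-oo, x].
Proof. by rewrite /Phi fineK//; exact: fin_num_measure. Qed.

Lemma Phi_ge0 x : 0 <= Phi x.
Proof. by rewrite -lee_fin PhiE. Qed.

Lemma Phi_le1 x : Phi x <= 1.
Proof. by rewrite -lee_fin PhiE; exact: probability_le1. Qed.

Lemma is_derive_Phi (x : K) : is_derive x 1 Phi (gphi x).
Proof.
have i : mu.-integrable [set` `]-oo, (x + 1)]] (EFin \o @gphi K).
  by apply: integrableS (integrable_normal_pdf 0 1).
have [] := continuous_FTC1 (_ : x < x + 1) i _ (@continuous_gphi K x).
- by rewrite ltrDl.
- by rewrite ltNyr.
move=> d1 d2; apply: DeriveDef; first exact: d1.
by rewrite -derive1E; exact: d2.
Qed.

Let idRV : measurableTypeR K -> K := idfun.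

#[local] HB.instance Definition _ :=
  @isMeasurableFun.Build _ _ _ _ idRV (@measurable_id _ _ setT).

Lemma Phi_cvgy : Phi x @[x --> +oo] --> (1 : K).
Proof.
have := @cvg_cdfy1 _ _ K g1 (idRV : {RV g1 >-> K}).
by move=> /fine_cvg.
Qed.

Lemma Phi_cvgNy : Phi x @[x --> -oo] --> (0 : K).
Proof.
have := @cvg_cdfNy0 _ _ K g1 (idRV : {RV g1 >-> K}).
by move=> /fine_cvg.
Qed.

(** The derivatives of the density, through the recurrence of the Hermite
polynomials: phi^(s+2) = - x phi^(s+1) - (s+1) phi^(s). *)
Fixpoint gd (s : nat) (x : K) : K :=
  match s with
  | 0 => gphi x
  | s'.+1 => match s' with
            | 0 => - (x * gphi x)
            | s''.+1 => - (x * gd s' x) - s'%:R * gd s'' x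
            end
  end.

Lemma gdSS s x : gd s.+2 x = - (x * gd s.+1 x) - s.+1%:R * gd s x.
Proof. by []. Qed.

Lemma is_derive_gd s (x : K) : is_derive x 1 (gd s) (gd s.+1 x).
Proof.
suff: is_derive x 1 (gd s) (gd s.+1 x) /\ is_derive x 1 (gd s.+1) (gd s.+2 x) by case.
elim: s => [|s [IH1 IH2]].
  have d := is_derive_gphi x; split; first exact: d.
  by apply: is_derive_eq; rewrite /GRing.scale/=; ring.
split => //.
have -> : gd s.+2 = (fun x => - (x * gd s.+1 x) - s.+1%:R * gd s x) by apply/funext.
apply: is_derive_eq; rewrite [RHS]gdSS; set A := gd s.+2 x; set B := gd s.+1 x.
by rewrite /GRing.scale /= -(natr1 s.+1); ring.
Qed.

Lemma gd_derive1n s : derive1n s (normal_pdf (0 : K) 1) = gd s.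
Proof.
elim: s => [|s IH]; first by [].
rewrite derive1nS IH; apply/funext => x; rewrite derive1E.
by have [_ ->] := is_derive_gd s x.
Qed.

(** The factor |x|^m is what makes the induction work: the recurrence raises m
by one and lowers s by one. *)
Lemma gd_le s m x : `|x| ^+ m * `|gd s x| <= 2 * 2 ^+ s * (s + m)`!%:R.
Proof.
suff: (forall m, `|x| ^+ m * `|gd s x| <= 2 * 2 ^+ s * (s + m)`!%:R) /\
      (forall m, `|x| ^+ m * `|gd s.+1 x| <= 2 * 2 ^+ s.+1 * (s.+1 + m)`!%:R) by case.
elim: s {m} => [|s [IH1 IH2]].
  have h m : `|x| ^+ m * `|gd 0 x| <= 2 * 2 ^+ 0 * (0 + m)`!%:R.
    by rewrite expr0 mulr1 /= (ger0_norm (gphi_ge0 x)) expn_gphi_le.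
  split => // m; have := h m.+1.
  rewrite exprSr /= normrN normrM -mulrA => /le_trans; apply.
  rewrite expr0 expr1 mulr1 add0n add1n ler_wpM2r ?ler0n//; lra.
split => // m; rewrite gdSS (le_trans (ler_wpM2l _ (ler_normB _ _)))// ?exprn_ge0//.
rewrite normrN !normrM mulrDr mulrA -exprSr.
have h1 := IH2 m.+1; have h2 := IH1 m.
rewrite (mulrCA (`|x| ^+ m)).
have h3 := ler_wpM2l (normr_ge0 (s.+1%:R : K)) h2.
apply: (le_trans (lerD h1 h3)).
rewrite (ger0_norm (ler0n _ _)).
have e1 : (s.+1 + m.+1 = s.+2 + m)%N by rewrite addnS.
have e2 : (s.+1 * (s + m)`! <= (s.+2 + m)`!)%N.
  rewrite !addSn !factS mulnA leq_mul2r; apply/orP; right.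
  rewrite -[leqLHS]mul1n leq_mul// ltnS leq_addr//.
rewrite e1.
have {}e2 : s.+1%:R * (s + m)`!%:R <= (s.+2 + m)`!%:R :> K by rewrite -natrM ler_nat.
rewrite [X in _ + X](_ : _ = 2 * 2 ^+ s * (s.+1%:R * (s + m)`!%:R)); last by ring.
have := ler_wpM2l (_ : 0 <= 2 * 2 ^+ s :> K) e2.
move=> /(_ (mulr_ge0 (ler0n _ 2) (exprn_ge0 _ (ler0n _ 2)))) e3.
apply: (le_trans (lerD (lexx _) e3)).
have q0 : 0 <= 2 ^+ s * (s.+2 + m)`!%:R :> K by rewrite mulr_ge0// exprn_ge0.
rewrite !exprS; set A := (s.+2 + m)`!%:R in q0 *; set Q := 2 ^+ s in q0 *.
suff : 0 <= 2 * (Q * A) by lra.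
by rewrite mulr_ge0.
Qed.

Lemma gd_bound s x : `|gd s x| <= 2 * 2 ^+ s * s`!%:R.
Proof. by have := gd_le s 0 x; rewrite expr0 mul1r addn0. Qed.

(** The successive derivatives in x of Phi (c (m - x)) - p. This is the mean of
a centred indicator 1_(x + y <= m) - p over a centred Gaussian y of standard
deviation 1/c. *)
Definition Fs (c m p : K) (s : nat) (x : K) : K :=
  if s is s'.+1 then (- c) ^+ s * gd s' (c * (m - x)) else Phi (c * (m - x)) - p.

Lemma is_derive_Fs c m p s (x : K) : is_derive x 1 (Fs c m p s) (Fs c m p s.+1 x).
Proof.
have dl : is_derive x 1 (fun x => c * (m - x)) (- c).
  by apply: is_derive_eq; rewrite /GRing.scale/=; ring.
case: s => [|s].
  have d := is_derive_Phi (c * (m - x)).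
  have d1 := @is_derive1_comp K Phi (fun x => c * (m - x)) x _ _ d dl.
  rewrite /Fs -[fun x => _]/(fun x => (Phi \o (fun x => c * (m - x))) x - p).
  by apply: is_derive_eq; rewrite /= /GRing.scale/=; ring.
have d := is_derive_gd s (c * (m - x)).
have d1 := @is_derive1_comp K (gd s) (fun x => c * (m - x)) x _ _ d dl.
rewrite /Fs -[fun x => _]/(fun x => (- c) ^+ s.+1 * (gd s \o (fun x => c * (m - x))) x).
by apply: is_derive_eq; rewrite /GRing.scale/= -/(gd s.+1 _) ?exprS; ring.
Qed.

Lemma Fs_bound c m p s x : 0 <= p <= 1 ->
  `|Fs c m p s x| <= 2 * (2 * `|c|) ^+ s * s`!%:R.
Proof.
move=> /andP[p0 p1]; case: s => [|s].
  rewrite expr0 fact0 /Fs !mulr1 ler_norml.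
  by have := Phi_ge0 (c * (m - x)); have := Phi_le1 (c * (m - x)); lra.
rewrite /Fs normrM normrX normrN exprMn.
rewrite (le_trans (ler_wpM2l _ (gd_bound s _)))// ?exprn_ge0//.
rewrite [X in X <= _](_ : _ = 2 * `|c| ^+ s.+1 * (2 ^+ s * s`!%:R)); last by ring.
rewrite [X in _ <= X](_ : _ = 2 * `|c| ^+ s.+1 * (2 ^+ s.+1 * s.+1`!%:R)); last by ring.
rewrite ler_wpM2l ?mulr_ge0 ?exprn_ge0// ler_pM ?exprn_ge0//.
  by rewrite exprS ler_peMl ?exprn_ge0 ?ler1n.
by rewrite ler_nat factS leq_pmull.
Qed.

End normal_cdf.

(** * The law of linear forms depends on their Gram matrix only *)

Section gaussian_law.
Context (K : realType) (R : finType) (alpha : {set R}).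
Notation vec n := (n.-tuple (measurableTypeR K)).
Implicit Types (F : R -> nat -> K -> K) (B : R -> nat -> K).

(** Zero-padded copies of a family, in the first coordinates (for embr: in the
last ones) of a larger space: they make two families orthogonal and keep their
Gram matrices. *)
Definition embl m n (a : R -> 'I_m -> K) (u : R) (i : 'I_(m + n)) : K :=
  if fintype.split i is inl j then a u j else 0.
Definition embr m n (b : R -> 'I_n -> K) (u : R) (i : 'I_(m + n)) : K :=
  if fintype.split i is inr j then b u j else 0.

Lemma embl_lshift m n (a : R -> 'I_m -> K) u (i : 'I_m) : embl a u (lshift n i) = a u i.
Proof. by rewrite /embl; case: split_ordP => j // /eqP; rewrite ?eq_lshift ?eq_lrshift// => /eqP ->. Qed.

Lemma embl_rshift m n (a : R -> 'I_m -> K) u (i : 'I_n) : embl a u (rshift m i) = 0.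
Proof. by rewrite /embl; case: split_ordP => j // /eqP; rewrite ?eq_rlshift. Qed.

Lemma embr_lshift m n (b : R -> 'I_n -> K) u (i : 'I_m) : embr b u (lshift n i) = 0.
Proof. by rewrite /embr; case: split_ordP => j // /eqP; rewrite ?eq_lrshift. Qed.

Lemma embr_rshift m n (b : R -> 'I_n -> K) u (i : 'I_n) : embr b u (rshift m i) = b u i.
Proof. by rewrite /embr; case: split_ordP => j // /eqP; rewrite ?eq_rshift ?eq_rlshift// => /eqP ->. Qed.

Lemma lin_embl m n (a : R -> 'I_m -> K) u (x : vec m) (y : vec n) :
  lin (embl a u) [tuple of x ++ y] = lin (a u) x.
Proof.
rewrite /lin big_split_ord /= [X in _ + X]big1 ?addr0; last first.
  by move=> i _; rewrite embl_rshift mul0r.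
by apply: eq_bigr => i _; rewrite embl_lshift tnth_lshift.
Qed.

Lemma lin_embr m n (b : R -> 'I_n -> K) u (x : vec m) (y : vec n) :
  lin (embr b u) [tuple of x ++ y] = lin (b u) y.
Proof.
rewrite /lin big_split_ord /= [X in X + _]big1 ?add0r; last first.
  by move=> i _; rewrite embr_lshift mul0r.
by apply: eq_bigr => i _; rewrite embr_rshift tnth_rshift.
Qed.

Section smooth.
Context F B.
Hypothesis dF : forall u s (x : K), is_derive x 1 (F u s) (F u s.+1 x).
Hypothesis FB : forall u s x, `|F u s x| <= B u s.

Lemma Esprod_embl m n s (a : R -> 'I_m -> K) :
  Esprod alpha F s (@embl m n a) = Esprod alpha F s a.
Proof.
rewrite /Esprod (@gaussE_cat _ m n _ (bprod alpha B s)).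
- congr gaussE; apply/funext => x.
  rewrite -[RHS](@Rintegral_cstT _ _ _ (gaussian K n)); congr gaussE; apply/funext => y.
  by apply: eq_bigr => u _; rewrite lin_embl.
- exact: measurable_sprod.
- by move=> x; exact: sprod_le.
Qed.

Lemma Esprod_embr m n s (b : R -> 'I_n -> K) :
  Esprod alpha F s (@embr m n b) = Esprod alpha F s b.
Proof.
rewrite /Esprod (@gaussE_cat _ m n _ (bprod alpha B s)).
- rewrite -[RHS](@Rintegral_cstT _ _ _ (gaussian K m)); congr gaussE; apply/funext => x.
  congr gaussE; apply/funext => y.
  by apply: eq_bigr => u _; rewrite lin_embr.
- exact: measurable_sprod.
- by move=> x; exact: sprod_le.
Qed.

Lemma mixc1 n (a b : R -> 'I_n -> K) : mixc a b 1 = a.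
Proof.
by apply/funext => u; apply/funext => i;
  rewrite /mixc sqrtr1 mul1r subrr sqrtr0 mul0r addr0.
Qed.

Lemma mixc0 n (a b : R -> 'I_n -> K) : mixc a b 0 = b.
Proof.
by apply/funext => u; apply/funext => i;
  rewrite /mixc sqrtr0 mul0r subr0 sqrtr1 mul1r add0r.
Qed.

Lemma within01_continuous (f : K -> K) :
  (forall t : K, -1 < t < 2 -> {for t, continuous f}) -> {within `[0, 1], continuous f}.
Proof.
move=> fc; apply: continuous_in_subspaceT => t; rewrite inE/= in_itv/= => /andP[t0 t1].
by apply: fc; lra.
Qed.

(** Interpolate between orthogonal copies of the two families: the derivative
along the path is governed by the difference of the Gram matrices, which is
zero. *)
Lemma Esprod_law m n s (a : R -> 'I_m -> K) (b : R -> 'I_n -> K) :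
  (forall u v, u \in alpha -> v \in alpha ->
     \sum_i a u i * a v i = \sum_i b u i * b v i) ->
  Esprod alpha F s a = Esprod alpha F s b.
Proof.
move=> gram; rewrite -(Esprod_embl n) -(Esprod_embr m s b).
set a' := embl a; set b' := embr b.
have orth u v : u \in alpha -> v \in alpha -> \sum_i a' u i * b' v i = 0.
  move=> _ _; rewrite big_split_ord /= !big1 ?addr0// => i _.
    by rewrite /a' /b' embl_rshift mul0r.
  by rewrite /a' /b' embr_lshift mulr0.
have gaa u v : \sum_i a' u i * a' v i = \sum_i a u i * a v i.
  rewrite big_split_ord /= [X in _ + X]big1 ?addr0; last first.
    by move=> i _; rewrite /a' embl_rshift mul0r.
  by apply: eq_bigr => i _; rewrite /a' !embl_lshift.
have gbb u v : \sum_i b' u i * b' v i = \sum_i b u i * b v i.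
  rewrite big_split_ord /= [X in X + _]big1 ?add0r; last first.
    by move=> i _; rewrite /b' embr_lshift mul0r.
  by apply: eq_bigr => i _; rewrite /b' !embr_rshift.
have dP (t : K) : t \in `]0, 1[ -> is_derive t 1 (Psi alpha F a' b' s) 0.
  rewrite in_itv /= => t01.
  apply: is_derive_eq (@is_derive_Psi K R alpha _ F B dF FB a' b' orth s t t01) _.
  rewrite big1 ?mulr0// => u ua; rewrite big1// => v va.
  by rewrite gaa gbb gram// subrr mul0r.
have [t _] := MVT ltr01 dP
  (within01_continuous (@Psi_continuous K R alpha _ F B dF FB a' b' s)).
by rewrite mul0r => /eqP; rewrite subr_eq0 => /eqP; rewrite /Psi mixc1 mixc0.
Qed.

End smooth.

Definition ind (tau p x : K) : K := (x <= tau)%R%:R - p.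

Definition Eind n (tau : R -> K) (p : K) (a : R -> 'I_n -> K) : K :=
  gaussE (fun x => \prod_(u in alpha) ind (tau u) p (lin (a u) x)).

Lemma ind_le tau p x : 0 <= p <= 1 -> `|ind tau p x| <= 1.
Proof. by rewrite /ind ler_norml; case: (x <= tau) => /=; lra. Qed.

Lemma measurable_ind tau p : measurable_fun [set: K] (ind tau p).
Proof.
apply: measurable_funB => //.
have -> : (fun x => (x <= tau)%R%:R) = \1_(`]-oo, tau]%classic : set K) :> (K -> K).
  by apply/funext => x; rewrite indicE mem_setE in_itv.
exact: measurable_indic.
Qed.

Lemma measurable_prod_ind n tau p (a : R -> 'I_n -> K) :
  measurable_fun [set: vec n] (fun x => \prod_(u in alpha) ind (tau u) p (lin (a u) x)).
Proof.
under eq_fun do rewrite -big_enum.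
apply: measurable_prod => u _; apply: measurableT_comp (measurable_ind _ _) _.
exact: measurable_lin.
Qed.

Lemma prod_ind_le n tau p (a : R -> 'I_n -> K) x : 0 <= p <= 1 ->
  `|\prod_(u in alpha) ind (tau u) p (lin (a u) x)| <= 1.
Proof.
move=> p01; rewrite normr_prod.
suff /andP[] : 0 <= \prod_(u in alpha) `|ind (tau u) p (lin (a u) x)| <= 1 by [].
elim/big_rec: _ => [|u y _ /andP[y0 y1]]; first by rewrite ler01 lexx.
by rewrite mulr_ge0//= mulr_ile1// ind_le.
Qed.

Lemma gaussE_cvg n (f_ : nat -> vec n -> K) (f : vec n -> K) (M : K) :
  (forall k, measurable_fun [set: vec n] (f_ k)) ->
  measurable_fun [set: vec n] f ->
  (forall k x, `|f_ k x| <= M) ->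
  (forall x, f_ k x @[k --> \oo] --> f x) ->
  gaussE (f_ k) @[k --> \oo] --> gaussE f.
Proof.
move=> mf_ mf fM cf.
have h : (\int[gaussian K n]_x (f_ k x)%:E)%E @[k --> \oo] -->
    (\int[gaussian K n]_x (EFin \o f) x)%E.
  apply: (@dominated_cvg _ _ _ (gaussian K n) [set: vec n] measurableT
    (fun k x => (f_ k x)%:E) (EFin \o f) (fun=> M%:E)).
  - by move=> k; exact/measurable_EFinP.
  - move=> x _; apply: cvg_EFin; first exact: nearW.
    exact: cf.
  - by [].
  - by apply: (@gint_bounded _ n (cst M) `|M|).
  - by move=> k x _; rewrite lee_fin.
have gf : gint f.
  apply: (@gint_bounded _ _ _ M) => // x.
  rewrite leNgt; apply/negP => Mf.
  have [N _ /(_ N (leqnn N))/=] := cvgr_gt _ (cvg_norm (cf x)) _ Mf.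
  by rewrite ltNge fM.
move: h; rewrite -(@fineK _ (\int[gaussian K n]_x (EFin \o f) x)%E); last exact: integrable_fin_num.
by move=> /fine_cvg.
Qed.

(** The threshold is moved to the right by 1/k, which is k times the width 1/k^2
of the smoothing: the limit is then right at the point x = tau as well, where a
smoothing centred at tau would give 1/2. *)
Lemma smooth_ind_cvg tau p (x : K) :
  Fs (k.+1%:R ^+ 2) (tau + k.+1%:R^-1) p 0 x @[k --> \oo] --> ind tau p x.
Proof.
apply: cvgB; last exact: cvg_cst.
have kE k : k.+1%:R ^+ 2 * (tau + k.+1%:R^-1 - x) = k.+1%:R * (k.+1%:R * (tau - x) + 1) :> K.
  have : k.+1%:R != 0 :> K by rewrite pnatr_eq0.
  by move: (k.+1%:R) => c c0; field.
have [xt|tx] := leP x tau => /=; rewrite /Fs.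
  have h : (k.+1%:R ^+ 2 * (tau + k.+1%:R^-1 - x) : K) @[k --> \oo] --> +oo.
    apply/cvgryPge => A; near=> k; rewrite kE.
    apply: (@le_trans _ _ k%:R); first by near: k; exact: nbhs_infty_ger.
    rewrite (@le_trans _ _ k.+1%:R) ?ler_nat// ler_peMr// lerDr mulr_ge0//.
    by rewrite subr_ge0.
  exact: (cvg_comp _ _ h (@Phi_cvgy K)).
have xt0 : 0 < x - tau by rewrite subr_gt0.
have h : (k.+1%:R ^+ 2 * (tau + k.+1%:R^-1 - x) : K) @[k --> \oo] --> -oo.
  apply/cvgrNyPle => A; near=> k; rewrite kE.
  have h : k.+1%:R * (tau - x) + 1 <= -1.
    have : 2 / (x - tau) <= k.+1%:R :> K.
      apply: (@le_trans _ _ k%:R); last by rewrite ler_nat.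
      by near: k; exact: nbhs_infty_ger.
    by rewrite ler_pdivrMr// => h; rewrite -opprB mulrN; lra.
  have h2 : - A <= k.+1%:R :> K.
    apply: (@le_trans _ _ k%:R); last by rewrite ler_nat.
    by near: k; exact: nbhs_infty_ger.
  by have := ler_wpM2l (ler0n K k.+1) h; lra.
exact: (cvg_comp _ _ h (@Phi_cvgNy K)).
Unshelve. all: by end_near. Qed.

Lemma Eind_cvg n tau p (a : R -> 'I_n -> K) : 0 <= p <= 1 ->
  Esprod alpha (fun u => Fs (k.+1%:R ^+ 2) (tau u + k.+1%:R^-1) p) (fun=> 0%N) a @[k --> \oo]
    --> Eind tau p a.
Proof.
move=> p01; apply: (@gaussE_cvg _ _ _ (\prod_(u in alpha) 2)).
- by move=> k; apply: measurable_sprod => u s x; exact: is_derive_Fs.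
- exact: measurable_prod_ind.
- move=> k x; rewrite /sprod normr_prod; apply: ler_prod => u _; rewrite normr_ge0/=.
  by have := Fs_bound (k.+1%:R ^+ 2) (tau u + k.+1%:R^-1) 0 (lin (a u) x) p01;
    rewrite expr0 fact0 !mulr1.
- move=> x; apply: cvg_big => [|u _]; first exact: mul_continuous.
  exact: smooth_ind_cvg.
Qed.

(** Dominated convergence, from smooth functions to indicators. *)
Lemma Eind_law m n tau p (a : R -> 'I_m -> K) (b : R -> 'I_n -> K) : 0 <= p <= 1 ->
  (forall u v, u \in alpha -> v \in alpha ->
     \sum_i a u i * a v i = \sum_i b u i * b v i) ->
  Eind tau p a = Eind tau p b.
Proof.
move=> p01 gram.
have h1 := @Eind_cvg m tau p a p01; have h2 := @Eind_cvg n tau p b p01.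
have e k : Esprod alpha (fun u => Fs (k.+1%:R ^+ 2) (tau u + k.+1%:R^-1) p) (fun=> 0%N) a =
  Esprod alpha (fun u => Fs (k.+1%:R ^+ 2) (tau u + k.+1%:R^-1) p) (fun=> 0%N) b.
  apply: (@Esprod_law _ (fun u s => 2 * (2 * `|k.+1%:R ^+ 2|) ^+ s * s`!%:R)) => //.
  - by move=> u s x; exact: is_derive_Fs.
  - by move=> u s x; exact: Fs_bound.
rewrite (_ : (fun k => _) = (fun k => Esprod alpha (fun u => Fs (k.+1%:R ^+ 2) (tau u + k.+1%:R^-1) p) (fun=> 0%N) b)) in h1; last exact/funext.
exact: (cvg_unique _ h1 h2).
Qed.

End gaussian_law.

(** * Independent coordinates *)

Section gaussian_product.
Context (K : realType).
Notation vec n := (n.-tuple (measurableTypeR K)).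
Notation g1 := (normal_prob (0 : K) 1).

Lemma gaussE1 (f : vec 1 -> K) (M : K) : measurable_fun [set: vec 1] f ->
  (forall x, `|f x| <= M) ->
  gaussE f = \int[g1]_x f [tuple x].
Proof.
move=> mf fM; rewrite gaussE_cons; last exact: (gint_bounded mf fM).
apply: eq_Rintegral => x _; rewrite gaussE0.
  by congr f; apply: val_inj.
exact: measurableT_comp mf (measurable_cons_r _).
Qed.

Lemma lin1 (c : 'I_1 -> K) (x : K) : lin c [tuple x] = c ord0 * x.
Proof. by rewrite /lin big_ord1 tnth0. Qed.

Lemma integral_le_ind (tau : K) : \int[g1]_x ((x <= tau)%R%:R : K) = Phi tau.
Proof.
have I := @integral_indic _ _ _ g1 _ measurableT `]-oo, tau]%classic (measurable_itv _).
rewrite setIT in I; rewrite /Phi /Rintegral; congr fine; apply: (etrans _ I).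
apply: eq_integral => x _.
by rewrite indicE mem_setE in_itv.
Qed.

(** Compare the form with sigma x_1, which has the same Gram matrix. *)
Lemma prob_lin n (a : 'I_n -> K) (tau sigma : K) : 0 < sigma ->
  \sum_i a i ^+ 2 = sigma ^+ 2 ->
  gaussE (fun x => (lin a x <= tau)%R%:R) = Phi (tau / sigma).
Proof.
move=> s0 as2.
have gram (u v : unit) : u \in [set: unit]%SET -> v \in [set: unit]%SET ->
  \sum_i (fun _ : unit => a) u i * a i = \sum_(i < 1) (fun (_ : unit) (_ : 'I_1) => sigma) v i * sigma.
  by move=> _ _; rewrite big_ord1 -expr2 -as2; apply: eq_bigr => i _; rewrite expr2.
have := @Eind_law K unit [set: unit]%SET _ _ (fun _ : unit => tau) 0 (fun _ : unit => a)
  (fun (_ : unit) (_ : 'I_1) => sigma) _ gram.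
have p1 (q : unit -> K) : \prod_(u in [set: unit]%SET) q u = q tt.
  by rewrite (big_pred1 tt)// => -[]; rewrite inE.
rewrite /Eind /ind => h.
transitivity (gaussE (fun x : vec 1 => (lin (fun=> sigma) x <= tau)%R%:R)).
  have -> : (fun x : vec n => (lin a x <= tau)%R%:R) =
    (fun x : vec n => \prod_(u in [set: unit]%SET) ((lin a x <= tau)%R%:R - 0)) :> (vec n -> K).
    by apply/funext => x; rewrite p1 subr0.
  rewrite h ?lexx ?ler01//; congr gaussE.
  by apply/funext => x; rewrite p1 subr0.
rewrite (@gaussE1 _ 1).
- rewrite -integral_le_ind; apply: eq_Rintegral => x _; rewrite lin1.
  by rewrite ler_pdivlMr// mulrC.
- have -> : (fun x : vec 1 => (lin (fun=> sigma) x <= tau)%R%:R) =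
    ind tau 0 \o lin (fun=> sigma) :> (vec 1 -> K).
    by apply/funext => x; rewrite /ind /= subr0.
  exact: measurableT_comp (@measurable_ind K tau 0) (@measurable_lin K 1 _).
- by move=> x; case: (lin _ _ <= _)%R; rewrite ?normr1 ?normr0.
Qed.

Lemma gaussE_prod_ord n (h : 'I_n -> K -> K) (M : 'I_n -> K) :
  (forall i, measurable_fun [set: K] (h i)) -> (forall i x, `|h i x| <= M i) ->
  gaussE (fun x : vec n => \prod_(i < n) h i (tnth x i)) = \prod_(i < n) \int[g1]_x h i x.
Proof.
elim: n h M => [|n IH] h M mh hM.
  rewrite gaussE0; first by rewrite !big_ord0.
  by under eq_fun do rewrite big_ord0; exact: measurable_cst.
have mp (m : nat) (h' : 'I_m -> K -> K) : (forall i, measurable_fun [set: K] (h' i)) ->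
  measurable_fun [set: vec m] (fun x : vec m => \prod_(i < m) h' i (tnth x i)).
  move=> mh'; apply: measurable_prod => i _.
  exact: measurableT_comp (mh' i) (measurable_tnthK i).
have [] := @gint_cons_mul K n (h ord0) (fun y => \prod_(i < n) h (lift ord0 i) (tnth y i))
  (fun x : vec n.+1 => \prod_(i < n.+1) h i (tnth x i)) (mp _ _ mh).
- move=> x y; rewrite big_ord_recl tnth_cons0; congr (_ * _).
  by apply: eq_bigr => i _; rewrite tnth_consS.
- exact: mh.
- exact: (@integrable_g1_bounded K (h ord0) (M ord0)).
- apply: (@gint_bounded _ _ _ (\prod_(i < n) M (lift ord0 i))); first exact: (mp n (fun i => h (lift ord0 i)) (fun i => mh _)).
  by move=> x; rewrite normr_prod; apply: ler_prod => i _; rewrite normr_ge0 hM.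
- move=> _ ->; rewrite big_ord_recl; congr (_ * _).
  exact: (IH (fun i => h (lift ord0 i)) (fun i => M (lift ord0 i))).
Qed.

Lemma gaussE_prod (R : finType) (alpha : {set R}) (f : R -> K -> K) (M : R -> K) :
  (forall u, measurable_fun [set: K] (f u)) -> (forall u x, `|f u x| <= M u) ->
  gaussE (fun x : vec #|R| => \prod_(u in alpha) f u (tnth x (enum_rank u))) =
  \prod_(u in alpha) \int[g1]_x f u x.
Proof.
move=> mf fM.
pose h (i : 'I_#|R|) x := if enum_val i \in alpha then f (enum_val i) x else 1.
have := @gaussE_prod_ord _ h (fun i => if enum_val i \in alpha then M (enum_val i) else 1) _ _.
have -> : (fun x => \prod_(i < #|R|) h i (tnth x i)) =
  (fun x : vec #|R| => \prod_(u in alpha) f u (tnth x (enum_rank u))).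
  apply/funext => x; rewrite [RHS]big_mkcond (reindex (@enum_val R R))/=; last exact: (onW_bij _ (enum_val_bij _)).
  by apply: eq_bigr => i _; rewrite /h enum_valK.
move=> ->.
- rewrite [RHS]big_mkcond [RHS](reindex (@enum_val R R))/=; last exact: (onW_bij _ (enum_val_bij _)).
  apply: eq_bigr => i _; rewrite /h; case: ifP => // _.
  exact: Rintegral_cstT.
- by move=> i; rewrite /h; case: (enum_val i \in alpha).
- by move=> i x; rewrite /h; case: ifP => // _; rewrite normr1.
Qed.

End gaussian_product.

(** * Smoothing an indicator by noise of variance 1/2 *)

Section smoothing.
Context (K : realType).
Notation vec n := (n.-tuple (measurableTypeR K)).
Notation g1 := (normal_prob (0 : K) 1).

(** The standard deviation of the noise of variance 1/2. *)
Definition rthalf : K := Num.sqrt 2^-1.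

Lemma rthalf_gt0 : 0 < rthalf. Proof. by rewrite sqrtr_gt0 invr_gt0. Qed.
Lemma rthalf_sqr : rthalf ^+ 2 = 2^-1. Proof. by rewrite sqr_sqrtr// invr_ge0. Qed.

(** A centred indicator smoothed by noise of variance 1/2, with its derivatives.
*)
Definition half (tau p : K) : nat -> K -> K := Fs rthalf^-1 tau p.

Lemma is_derive_half tau p s (x : K) : is_derive x 1 (half tau p s) (half tau p s.+1 x).
Proof. exact: is_derive_Fs. Qed.

Lemma half_bound tau p s x : 0 <= p <= 1 -> `|half tau p s x| <= 2 * 4 ^+ s * s`!%:R.
Proof.
move=> p01; apply: (le_trans (Fs_bound _ _ _ _ p01)).
have h : rthalf^-1 <= 2.
  rewrite -[leRHS]invrK lef_pV2 ?posrE ?invr_gt0 ?rthalf_gt0//.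
  rewrite -(@ler_pXn2r _ 2)// ?nnegrE ?invr_ge0 ?(ltW rthalf_gt0)// rthalf_sqr.
  by rewrite exprVn; lra.
have h0 : 0 <= rthalf^-1 by rewrite invr_ge0 ltW// rthalf_gt0.
rewrite ler_wpM2r// ler_wpM2l// lerXn2r ?nnegrE ?mulr_ge0//.
by rewrite (ger0_norm h0); lra.
Qed.

Lemma measurable_half tau p s : measurable_fun [set: K] (half tau p s).
Proof.
apply: continuous_measurable_fun => x.
by apply/differentiable_continuous/derivable1_diffP; have [] := is_derive_half tau p s x.
Qed.

Lemma lin_cons n (c : 'I_n.+1 -> K) x (y : vec n) :
  lin c (Defs.cons_tuple (x, y)) = c ord0 * x + lin (fun i => c (lift ord0 i)) y.
Proof.
rewrite /lin big_ord_recl tnth_cons0; congr (_ + _).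
by apply: eq_bigr => i _; rewrite tnth_consS.
Qed.

(** Two independent noises of variance 1/2 have the sum of their variances: both
sides compute P(w + (x_1 + x_2)/sqrt 2 <= tau) - p. *)
Lemma half0_conv tau p w : 0 <= p <= 1 ->
  \int[g1]_x half tau p 0 (w + rthalf * x) = Fs 1 tau p 0 w.
Proof.
move=> p01.
have r0 := rthalf_gt0.
have mle n (c : 'I_n -> K) t : measurable_fun [set: vec n] (fun x => (lin c x <= t)%R%:R : K).
  have -> : (fun x => (lin c x <= t)%R%:R : K) = ind t 0 \o lin c :> (vec n -> K).
    by apply/funext => x; rewrite /ind /= subr0.
  exact: measurableT_comp (@measurable_ind K t 0) (@measurable_lin K n _).
have ble n (c : 'I_n -> K) t (x : vec n) : `|(lin c x <= t)%R%:R : K| <= 1.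
  by case: (lin c x <= t)%R; rewrite ?normr1 ?normr0.
have E2 : gaussE (fun x : vec 2 => (lin (fun=> rthalf) x <= tau - w)%R%:R) = Phi (tau - w).
  rewrite (@prob_lin K 2 _ _ 1)// ?divr1//.
  by rewrite big_ord_recl big_ord1 !rthalf_sqr expr1n; lra.
have E1 x : gaussE (fun y : vec 1 => (lin (fun=> rthalf) (Defs.cons_tuple (x, y)) <= tau - w)%R%:R) =
   Phi (rthalf^-1 * (tau - (w + rthalf * x))).
  have -> : (fun y : vec 1 => (lin (fun=> rthalf) (Defs.cons_tuple (x, y)) <= tau - w)%R%:R : K) =
     (fun y : vec 1 => (lin (fun=> rthalf) y <= tau - (w + rthalf * x))%R%:R).
    apply/funext => y; rewrite lin_cons; congr (_%:R); congr nat_of_bool.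
    by rewrite opprD addrA [RHS]lerBrDr (addrC (lin _ _)).
  by rewrite [rthalf^-1 * _]mulrC (@prob_lin K 1 _ _ rthalf)// big_ord1.
move: E2; rewrite gaussE_cons; last exact: (gint_bounded (mle _ _ _) (@ble _ _ _)).
under eq_Rintegral do rewrite E1.
rewrite /half /Fs mul1r => <-; rewrite RintegralB//.
- by rewrite Rintegral_cstT.
- apply: (@integrable_g1_bounded K _ (1 + `|p|)).
    have := @measurable_half tau 0 0; rewrite /half /Fs => m.
    have m2 : measurable_fun [set: K] (fun x : K => w + rthalf * x).
      by apply: measurable_funD => //; exact: measurable_funM.
    have := measurableT_comp m m2; rewrite /comp.
    by under eq_fun do rewrite subr0.
  by move=> x; rewrite ger0_norm ?Phi_ge0// (le_trans (Phi_le1 _))// lerDl.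
- by apply: (@integrable_g1_bounded K _ `|p|).
Qed.

(** Differentiate the case s = 0 under the integral. *)
Lemma half_conv tau p s w : 0 <= p <= 1 ->
  \int[g1]_x half tau p s (w + rthalf * x) = Fs 1 tau p s w.
Proof.
move=> p01; elim: s w => [|s IH] w; first exact: half0_conv.
pose f (t x : K) := half tau p s (t + rthalf * x).
have df (t x : K) : is_derive t 1 (f ^~ x) (half tau p s.+1 (t + rthalf * x)).
  have d1 : is_derive t 1 (fun t => t + rthalf * x) 1.
    by apply: is_derive_eq; rewrite ?addr0.
  have d2 := @is_derive1_comp K (half tau p s) (fun t => t + rthalf * x) t _ _ (is_derive_half tau p s _) d1.
  by apply: is_derive_eq; rewrite mulr1.
have m1 (t : K) s' : measurable_fun [set: measurableTypeR K] (fun x : K => half tau p s' (t + rthalf * x)).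
  have m2 : measurable_fun [set: K] (fun x : K => t + rthalf * x).
    by apply: measurable_funD => //; exact: measurable_funM.
  exact: measurableT_comp (@measurable_half tau p s') m2.
have fi (t : K) : g1.-integrable [set: _] (EFin \o f t).
  apply: (@integrable_g1_bounded K _ (2 * 4 ^+ s * s`!%:R)); first exact: m1.
  by move=> x; exact: half_bound.
have Gi : g1.-integrable [set: _] (EFin \o (fun _ : K => 2 * 4 ^+ s.+1 * s.+1`!%:R : K)).
  by apply: (@integrable_g1_bounded K _ `|2 * 4 ^+ s.+1 * s.+1`!%:R|).
have G0 (x : K) : 0 <= 2 * 4 ^+ s.+1 * s.+1`!%:R :> K by rewrite !mulr_ge0 ?exprn_ge0.
have Iw : `](w - 1), (w + 1)[%classic w by rewrite /= in_itv/= gtrBl ltrDl ltr01.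
have D2 := @differentiation_under_integral K _ _ g1 f _ measurableT w _ _ Iw
  (fun x _ => fi x) (fun x y _ _ => @ex_derive _ _ _ _ _ _ _ (df x y)) _ G0 Gi.
have {D2} := D2 _.
have -> : (fun x' : K => \int[g1]_y f x' y) = Fs 1 tau p s.
  by apply/funext => t; rewrite -IH.
rewrite derive1E; have [_ ->] := is_derive_Fs 1 tau p s w => ->.
- by apply: eq_Rintegral => x _; rewrite partial1of2E; have [_ ->] := df w x.
- by move=> t x _ _; rewrite partial1of2E; have [_ ->] := df t x; exact: half_bound.
Qed.

End smoothing.

(** * Taylor's formula with a bound on the last derivative *)

Section taylor.
Context (K : realType).

Lemma ge0_of_derive (h h' : K -> K) (t : K) : 0 <= t <= 1 ->
  {within `[0, 1], continuous h} ->
  (forall x : K, 0 < x < 1 -> is_derive x 1 h (h' x)) ->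
  (forall x : K, 0 < x < 1 -> 0 <= h' x) -> 0 <= h 0 -> 0 <= h t.
Proof.
move=> /andP[t0 t1] ch dh h'0 h0.
move: t0; rewrite le_eqVlt => /predU1P[<-//|t0].
have dh' (x : K) : x \in `]0, t[ -> is_derive x 1 h (h' x).
  by rewrite in_itv/= => /andP[? ?]; apply: dh; lra.
have sub : (`[0, t]%classic : set K) `<=` `[0, 1]%classic by apply: subset_itvl; rewrite bnd_simp.
have [c] := MVT t0 dh' (continuous_subspaceW sub ch).
rewrite in_itv/= subr0 => /andP[c0 ct] /eqP; rewrite subr_eq => /eqP ->.
by rewrite addr_ge0// mulr_ge0 ?(ltW t0)// h'0//; lra.
Qed.

(** Induction on N: the bound on the derivative of the remainder is integrated
by monotonicity (ge0_of_derive), which avoids integrals. *)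
Lemma taylor01 (N : nat) (f : nat -> K -> K) (M : K) :
  (forall m, {within `[0, 1], continuous (f m)}) ->
  (forall m (t : K), 0 < t < 1 -> is_derive t 1 (f m) (f m.+1 t)) ->
  (forall t : K, 0 <= t <= 1 -> `|f N t| <= M) ->
  forall t : K, 0 <= t <= 1 ->
  `|f 0%N t - \sum_(m < N) f m 0 * (t ^+ m / m`!%:R)| <= M * (t ^+ N / N`!%:R).
Proof.
elim: N f => [|N IH] f cf df fM t t01.
  by rewrite big_ord0 subr0 expr0 fact0 divr1 mulr1 fM.
have {IH} IH := IH (fun m => f m.+1) (fun m => cf m.+1) (fun m => df m.+1) fM.
pose S t := \sum_(m < N.+1) f m 0 * (t ^+ m / m`!%:R).
pose S' t := \sum_(m < N) f m.+1 0 * (t ^+ m / m`!%:R).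
have dm (c x : K) m : is_derive x 1 (fun t : K => c * (t ^+ m.+1 / m.+1`!%:R)) (c * (x ^+ m / m`!%:R)).
  have f1 : m`!%:R != 0 :> K by rewrite pnatr_eq0 -lt0n fact_gt0.
  have f2 : m.+1%:R != 0 :> K by rewrite pnatr_eq0.
  have d1 : is_derive x 1 (fun t : K => t ^+ m.+1) (m.+1%:R * x ^+ m).
    have := @is_deriveX K K id m.+1 x 1 1 (is_derive_id _ _).
    by rewrite exprfctE /= /GRing.scale /= mulr1.
  rewrite factS natrM.
  have -> : (fun t0 : K => c * (t0 ^+ m.+1 / (m.+1%:R * m`!%:R))) =
    (fun t0 : K => (c / (m.+1%:R * m`!%:R)) * t0 ^+ m.+1).
    by apply/funext => z; rewrite mulrCA mulrC.
  apply: is_derive_eq; rewrite /GRing.scale/=.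
  move: (m.+1%:R : K) f2 (m`!%:R : K) f1 => A A0 A' A'0.
  by field; rewrite A0 A'0.
have dS (x : K) : is_derive x 1 S (S' x).
  rewrite /S; under eq_fun do rewrite big_ord_recl.
  have -> : (fun t : K => f 0%N 0 * (t ^+ 0 / 0`!%:R) +
      \sum_(i < N) f (lift ord0 i) 0 * (t ^+ lift ord0 i / (lift ord0 i)`!%:R)) =
    cst (f 0%N 0 * (1 / 0`!%:R)) +
      \sum_(i < N) (fun t : K => f i.+1 0 * (t ^+ i.+1 / i.+1`!%:R)).
    by apply/funext => z; rewrite fctE /= fct_sumE.
  have ds := @is_derive_sum K K K N (fun (i : 'I_N) (t : K) => f i.+1 0 * (t ^+ i.+1 / i.+1`!%:R)) x 1 _ (fun i => dm (f i.+1 0) x i).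
  by apply: is_derive_eq; rewrite add0r /S'.
have cS : {within `[0, 1], continuous S}.
  apply: continuous_subspaceT => x; apply/differentiable_continuous/derivable1_diffP.
  by have [] := dS x.
pose q t := M * (t ^+ N.+1 / N.+1`!%:R).
have dq (x : K) : is_derive x 1 q (M * (x ^+ N / N`!%:R)) by exact: dm.
have cq : {within `[0, 1], continuous q}.
  apply: continuous_subspaceT => x; apply/differentiable_continuous/derivable1_diffP.
  by have [] := dq x.
have e0 : f 0%N 0 - S 0 = 0.
  rewrite /S big_ord_recl big1 ?addr0; first by rewrite expr0 fact0 divr1 mulr1 subrr.
  by move=> i _; rewrite expr0n /= mul0r mulr0.
have q0 : q 0 = 0 by rewrite /q expr0n/= mul0r mulr0.
have b x : 0 < x < 1 -> `|f 1%N x - S' x| <= M * (x ^+ N / N`!%:R).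
  by move=> x01; apply: IH; lra.
rewrite -/(S t) -/(q t) ler_norml; apply/andP; split.
- rewrite -subr_ge0 opprK.
  apply: (@ge0_of_derive (fun t => f 0%N t - S t + q t) (fun x => f 1%N x - S' x + M * (x ^+ N / N`!%:R)) t) => //.
  + move=> x; apply: cvgD; first by apply: cvgB; [exact: cf|exact: cS].
    exact: cq.
  + move=> x x01; have d1 := df 0%N x x01; have d2 := dS x; have d3 := dq x.
    by apply: is_derive_eq.
  + by move=> x x01; have := b x x01; rewrite ler_norml => /andP[+ _]; lra.
  + by rewrite e0 q0 addr0.
- rewrite -subr_ge0.
  apply: (@ge0_of_derive (fun t => q t - (f 0%N t - S t)) (fun x => M * (x ^+ N / N`!%:R) - (f 1%N x - S' x)) t) => //.
  + move=> x; apply: cvgB; first exact: cq.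
    by apply: cvgB; [exact: cf|exact: cS].
  + move=> x x01; have d1 := df 0%N x x01; have d2 := dS x; have d3 := dq x.
    by apply: is_derive_eq.
  + by move=> x x01; have := b x x01; rewrite ler_norml => /andP[_ +]; lra.
  + by rewrite e0 q0 subr0.
Qed.
End taylor.

(** * Diagonally dominant matrices are Gram matrices *)

Section diagonal_dominance.
Context (K : realType) (R : finType) (alpha : {set R}) (M : R -> R -> K).
Hypothesis Msym : forall u v, M u v = M v u.
Hypothesis Mdom : forall u, u \in alpha ->
  \sum_(v in alpha | v != u) `|M u v| <= M u u.

Let q v w := if (v \in alpha) && (w \in alpha) then Num.sqrt (`|M v w| / 2) else 0.
Let dg u := Num.sqrt (M u u - \sum_(v in alpha | v != u) `|M u v|).
Let beta u (p : R * R) : K :=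
  if p.1 == p.2 then (if u == p.1 then dg u else 0)
  else if u == p.1 then q p.1 p.2
  else if u == p.2 then Num.sg (M p.1 p.2) * q p.1 p.2 else 0.

Let q_sqr v w : v \in alpha -> w \in alpha -> q v w * q v w = `|M v w| / 2.
Proof. by move=> va wa; rewrite /q va wa -expr2 sqr_sqrtr// divr_ge0. Qed.

(** One vector per ordered pair: for v <> w it is sqrt (|M_vw|/2) (e_v +
sgn(M_vw) e_w), and the diagonal pairs (u, u) supply the excess of M_uu over the
sum of the |M_uv|. *)
Lemma diag_dominant_gram : exists b : R -> 'I_#|{: R * R}| -> K,
  forall u v, u \in alpha -> v \in alpha -> \sum_i b u i * b v i = M u v.
Proof.
exists (fun u (i : 'I_#|{: R * R}|) => beta u (@enum_val _ {: R * R} i)) => u v ua va.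
have -> : \sum_(i < #|{: R * R}|) beta u (@enum_val _ {: R * R} i) * beta v (@enum_val _ {: R * R} i) =
    \sum_p beta u p * beta v p.
  by rewrite [RHS](reindex (@enum_val _ {: R * R}))//=; exact: (onW_bij _ (enum_val_bij _)).
have [<-{v va}|uv] := eqVneq u v; last first.
  have neq : (v, u) != (u, v) by rewrite xpair_eqE negb_and eq_sym uv.
  rewrite (bigD1 (u, v))//= (bigD1 (v, u))//= big1 ?addr0; last first.
    move=> [x y] /andP[/= n1 n2]; rewrite /beta /=.
    have [xy|xy] := eqVneq x y.
      have [ux|] := eqVneq u x; last by rewrite mul0r.
      have [vx|] := eqVneq v x; last by rewrite mulr0.
      by rewrite ux vx eqxx in uv.
    have [ux|ux] := eqVneq u x.
      have [vx|vx] := eqVneq v x; first by rewrite ux vx eqxx in uv.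
      have [vy|vy] := eqVneq v y; last by rewrite mulr0.
      by rewrite -ux -vy eqxx in n1.
    have [uy|uy] := eqVneq u y; last by rewrite mul0r.
    have [vx|vx] := eqVneq v x; first by rewrite -uy -vx eqxx in n2.
    have [vy|vy] := eqVneq v y; last by rewrite mulr0.
    by rewrite uy vy eqxx in uv.
  rewrite /beta /= (negbTE uv) (eq_sym v u) (negbTE uv) !eqxx.
  rewrite (mulrCA (q u v)) -mulrA !q_sqr// (Msym v u) -mulrDr.
  by rewrite -splitr mulr_sg_norm.
transitivity (\sum_x \sum_y beta u (x, y) * beta u (x, y)).
  by rewrite pair_bigA.
rewrite (bigD1 u)//= (bigD1 u)//= {1 2}/beta /= eqxx.
have h1 : \sum_(y | y != u) beta u (u, y) * beta u (u, y) =
    \sum_(y in alpha | y != u) `|M u y| / 2.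
  rewrite [RHS]big_mkcondl; apply: eq_bigr => y yu.
  rewrite /beta /= eq_sym (negbTE yu) eqxx; case: ifP => ya; first by rewrite q_sqr.
  by rewrite /q ya andbF mul0r.
have h2 : \sum_(x | x != u) \sum_y beta u (x, y) * beta u (x, y) =
    \sum_(x in alpha | x != u) `|M u x| / 2.
  rewrite [RHS]big_mkcondl; apply: eq_bigr => x xu.
  rewrite (bigD1 u)//= big1 ?addr0; last first.
    move=> y yu; rewrite /beta /= (eq_sym u x) (negbTE xu) (eq_sym u y) (negbTE yu).
    by rewrite if_same mul0r.
  rewrite /beta /= (negbTE xu) (eq_sym u x) (negbTE xu) eqxx; case: ifP => xa; last first.
    by rewrite /q xa !mulr0.
  rewrite mulrACA q_sqr// (Msym x u) -expr2 sqr_sg.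
  have [->|] := eqVneq (M u x) 0; first by rewrite normr0 mul0r ?mulr0 ?mul0r.
  by rewrite mul1r.
rewrite h1 h2 -expr2 sqr_sqrtr ?subr_ge0 ?Mdom//.
rewrite -!mulr_suml; lra.
Qed.

End diagonal_dominance.

(** The diagonal of G - I/2 is at least 1/2 - eps, and the off-diagonal entries
of a row sum to at most eps (k - 1). *)
Lemma near_identity_dominant (K : realType) (R : finType) (alpha : {set R})
    (G : R -> R -> K) (eps : K) :
  (forall u v, G u v = G v u) ->
  (forall u v, u \in alpha -> v \in alpha -> `|G u v - (u == v)%:R| <= eps) ->
  eps * #|alpha|%:R <= 4^-1 ->
  exists b : R -> 'I_#|{: R * R}| -> K,
  forall u v, u \in alpha -> v \in alpha ->
    \sum_i b u i * b v i = G u v - 2^-1 * (u == v)%:R.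
Proof.
move=> Gs Ge ek; apply: (@diag_dominant_gram K R alpha (fun u v => G u v - 2^-1 * (u == v)%:R)).
  by move=> u v; rewrite Gs eq_sym.
move=> u ua.
have e0 : 0 <= eps by apply: le_trans (Ge u u ua ua).
apply: (@le_trans _ _ (\sum_(v in alpha) eps)).
  rewrite [leLHS]big_mkcondr; apply: ler_sum => v va; case: ifP => // vu.
  by have := Ge u v ua va; rewrite eq_sym (negbTE vu) mulr0.
rewrite sumr_const -mulr_natr.
have k1 : 1 <= #|alpha|%:R :> K by rewrite ler1n card_gt0; apply/set0Pn; exists u.
have := Ge u u ua ua; rewrite !eqxx /= ler_norml => /andP[+ _].
by have := ler_wpM2l e0 k1; rewrite !mulr1; lra.
Qed.

(** * Sums over sequences of pairs *)

Section insertion.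
Context (X : finType) (m : nat).

(** Sequences of m + 1 elements are obtained by inserting one element at a fixed
position j; choosing j freely is needed to remove a pair from any position. *)
Definition ins (j : 'I_m.+1) (x : X) (g : {ffun 'I_m -> X}) : {ffun 'I_m.+1 -> X} :=
  [ffun i => if unlift j i is Some i' then g i' else x].

Lemma ins_at j x g : ins j x g j = x.
Proof. by rewrite ffunE unlift_none. Qed.

Lemma ins_lift j x g i : ins j x g (lift j i) = g i.
Proof. by rewrite ffunE liftK. Qed.

Lemma sum_ins (V : nmodType) j (H : {ffun 'I_m.+1 -> X} -> V) :
  \sum_f H f = \sum_x \sum_g H (ins j x g).
Proof.
rewrite pair_bigA /= (reindex (fun p => ins j p.1 p.2)) //=.
exists (fun f => (f j, [ffun i => f (lift j i)])) => [[x g] _|f _] /=.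
  by rewrite ins_at; congr (_, _); apply/ffunP => i; rewrite ffunE ins_lift.
apply/ffunP => i; case: (unliftP j i) => [k|] ->; first by rewrite ins_lift ffunE.
by rewrite ins_at.
Qed.

Lemma big_ins (V : Type) (idx : V) (op : Monoid.com_law idx) j x g (h : X -> V) :
  \big[op/idx]_i h (ins j x g i) = op (h x) (\big[op/idx]_i h (g i)).
Proof.
rewrite (bigD1_ord j)//= ins_at; congr (op _ _).
by apply: eq_bigr => i _; rewrite ins_lift.
Qed.

End insertion.

Section pair_sums.
Context (R : finType) (alpha : {set R}).

Definition inA (p : R * R) := (p.1 \in alpha) && (p.2 \in alpha).

Lemma mult_sum l (r : {ffun 'I_l -> R * R}) e :
  mult r e = (\sum_j (((r j).1 == e) + ((r j).2 == e)))%N.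
Proof. by rewrite big_split /=; congr (_ + _)%N; rewrite -sum1dep_card big_mkcond; apply: eq_bigr => j _; case: eqP. Qed.

Lemma mult_ins m (j : 'I_m.+1) p (g : {ffun 'I_m -> R * R}) :
  mult (ins j p g) = inc (inc (mult g) p.1) p.2.
Proof.
apply/funext => e.
rewrite mult_sum (big_ins _ j p g (fun q : R * R => ((q.1 == e) + (q.2 == e))%N)) -mult_sum.
rewrite /inc (eq_sym e p.1) (eq_sym e p.2) /=; lia.
Qed.

Lemma mult0 (r : {ffun 'I_0 -> R * R}) : mult r = fun=> 0%N.
Proof. by apply/funext => e; rewrite mult_sum big_ord0. Qed.

Lemma forall_ins m (j : 'I_m.+1) p (g : {ffun 'I_m -> R * R}) (P : pred (R * R)) :
  [forall i, P (ins j p g i)] = P p && [forall i, P (g i)].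
Proof.
apply/forallP/andP => [h|[Pp /forallP Pg] i].
  by split; [rewrite -(ins_at j p g)|apply/forallP => i; rewrite -(ins_lift j p g)].
by case: (unliftP j i) => [k|] ->; rewrite ?ins_lift ?ins_at.
Qed.

Lemma big_inA (V : nmodType) (H : R * R -> V) :
  \sum_(p | inA p) H p = \sum_(u in alpha) \sum_(v in alpha) H (u, v).
Proof. by rewrite pair_big /=; apply: eq_big => [[u v]|[u v]]. Qed.

Lemma sum_inA_ins (V : nmodType) m (j : 'I_m.+1) (H : {ffun 'I_m.+1 -> R * R} -> V) :
  \sum_(r : {ffun 'I_m.+1 -> R * R} | [forall i, inA (r i)]) H r =
  \sum_(u in alpha) \sum_(v in alpha)
    \sum_(g : {ffun 'I_m -> R * R} | [forall i, inA (g i)]) H (ins j (u, v) g).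
Proof.
rewrite big_mkcond (sum_ins j) -(big_inA (fun p => \sum_(g : {ffun 'I_m -> R * R} | [forall i, inA (g i)]) H (ins j p g))).
rewrite [RHS]big_mkcond; apply: eq_bigr => p _.
case: ifP => pA; last by rewrite big1// => g _; rewrite forall_ins pA.
by rewrite [RHS]big_mkcond; apply: eq_bigr => g _; rewrite forall_ins pA.
Qed.

Lemma sum_inc (s : R -> nat) u : u \in alpha ->
  (\sum_(e in alpha) inc s u e = (\sum_(e in alpha) s e).+1)%N.
Proof.
move=> ua; rewrite big_split /= -addn1; congr (_ + _)%N.
by rewrite (bigD1 u)//= eqxx big1// => i /andP[_ /negbTE ->].
Qed.

Lemma sum_mult m (r : {ffun 'I_m -> R * R}) : [forall i, inA (r i)] ->
  (\sum_(e in alpha) mult r e = m.*2)%N.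
Proof.
move=> rA; under eq_bigr do rewrite mult_sum.
rewrite exchange_big /= (eq_bigr (fun=> 2%N)); first by rewrite sum_nat_const card_ord muln2.
move=> j _; move/forallP : rA => /(_ j) /andP[h1 h2].
have one x : x \in alpha -> (\sum_(e in alpha) (x == e) = 1)%N.
  move=> xa; rewrite (bigD1 x)//= eqxx big1// => i /andP[_].
  by rewrite eq_sym => /negbTE ->.
by rewrite big_split /= !one.
Qed.

Lemma prod_fact_inc (s : R -> nat) u : u \in alpha ->
  (\prod_(e in alpha) (inc s u e)`! = (s u).+1 * \prod_(e in alpha) (s e)`!)%N.
Proof.
move=> ua; rewrite (bigD1 u)//= [in RHS](bigD1 u)//= /inc eqxx addn1 factS -mulnA.
congr (_ * (_ * _))%N; apply: eq_bigr => e /andP[_ /negbTE ->].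
by rewrite addn0.
Qed.

(** The number of sequences of m pairs, weighted by the growth s_e! of the
derivatives that they call for. *)
Definition paircount (m : nat) : nat :=
  (\sum_(r : {ffun 'I_m -> R * R} | [forall i, inA (r i)]) \prod_(e in alpha) (mult r e)`!)%N.

(** Differentiating once more at u multiplies prod_e s_e! by s_u + 1, and the
sum of s_u + 1 over alpha is #|alpha| + sum_e s_e. *)
Lemma sum_fact_inc (s : R -> nat) :
  (\sum_(u in alpha) \prod_(e in alpha) (inc s u e)`! =
   (#|alpha| + \sum_(e in alpha) s e) * \prod_(e in alpha) (s e)`!)%N.
Proof.
rewrite (eq_bigr (fun u => (s u).+1 * \prod_(e in alpha) (s e)`!)%N); last by move=> u ua; exact: prod_fact_inc.
rewrite -big_distrl /=; congr (_ * _)%N.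
by under eq_bigr do rewrite -addn1; rewrite big_split /= sum1_card addnC.
Qed.

Lemma sum_ffun0 (V : nmodType) (H : {ffun 'I_0 -> R * R} -> V) :
  \sum_(r : {ffun 'I_0 -> R * R} | [forall i, inA (r i)]) H r = H (ffun0 (card_ord 0)).
Proof.
apply: big_pred1 => r; apply/forallP/eqP => [_|_ []//].
by apply/ffunP => -[].
Qed.

(** Each pair raises sum_e s_e by two; apply sum_fact_inc twice. *)
Lemma paircountE m : paircount m = (\prod_(i < m.*2) (#|alpha| + i))%N.
Proof.
elim: m => [|m IH].
  by rewrite big_ord0 /paircount sum_ffun0 big1// => e _; rewrite mult0.
rewrite doubleS !big_ord_recr /= -IH /paircount (sum_inA_ins ord0).
transitivity (\sum_(g : {ffun 'I_m -> R * R} | [forall i, inA (g i)])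
   (\sum_(u in alpha) \sum_(v in alpha) \prod_(e in alpha) (inc (inc (mult g) u) v e)`!))%N.
  under eq_bigr do rewrite exchange_big /=.
  rewrite exchange_big /=; apply: eq_bigr => g _; apply: eq_bigr => u _.
  by apply: eq_bigr => v _; rewrite mult_ins.
rewrite !big_distrl /=; apply: eq_bigr => g gA.
under eq_bigr do rewrite sum_fact_inc.
rewrite (eq_bigr (fun u => (#|alpha| + m.*2.+1) * \prod_(e in alpha) (inc (mult g) u e)`!)%N); last first.
  by move=> u ua; rewrite sum_inc// sum_mult.
by rewrite -big_distrr /= sum_fact_inc sum_mult//; lia.
Qed.

Lemma bin_le_exp n m : ('C(n, m) <= 2 ^ n)%N.
Proof.
elim: n m => [|n IH] [|m]//; first by rewrite bin0 expn_gt0.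
by rewrite binS expnS mul2n -addnn leq_add.
Qed.

Lemma prod_ffact k n : (\prod_(i < n) (k.+1 + i) = (k + n) ^_ n)%N.
Proof.
elim: n => [|n IH]; first by rewrite big_ord0 ffactn0.
by rewrite big_ord_recr /= IH addnS ffactnS mulnC addSn.
Qed.

Lemma fact_le_exp m n : (m <= n)%N -> (m`! <= n ^ m)%N.
Proof.
elim: m => // m IH mn; rewrite factS expnS leq_mul//.
by rewrite IH// ltnW.
Qed.

(** With k = #|alpha|, the rising factorial k (k+1) .. (k+2m-1) is at most (2m)!
2 ^ (k + 2m), and (2m)! is at most 4 ^ m m! ^ 2; the factor m! that is left
after division by 2 ^ m m! is at most (2k) ^ m. *)
Lemma paircount_le m : (0 < #|alpha|)%N -> (m <= 2 * #|alpha|)%N ->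
  (paircount m <= 2 ^ m * m`! * (2 ^ #|alpha| * (16 * #|alpha|) ^ m))%N.
Proof.
move=> k0 mk; rewrite paircountE -(prednK k0) prod_ffact prednK//.
set k := #|alpha| in k0 mk *.
rewrite -bin_ffact.
have h1 := bin_le_exp (k.-1 + m.*2) m.*2.
have h2 : (m.*2`! <= 4 ^ m * (m`! * m`!))%N.
  have := @bin_fact m.*2 m; rewrite -addnn leq_addr => /(_ isT).
  rewrite addnK => <-; rewrite leq_mul2r; apply/orP; right.
  by rewrite (leq_trans (bin_le_exp _ _))// addnn -mul2n expnM.
have h3 : (m`! <= (2 * k) ^ m)%N by exact: fact_le_exp.
apply: (leq_trans (leq_mul h1 h2)).
have h4 : (2 ^ (k.-1 + m.*2) <= 2 ^ k * 4 ^ m)%N.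
  by rewrite -[(4 ^ m)%N]/((2 ^ 2) ^ m)%N -expnM mul2n -expnD leq_exp2l// leq_add2r leq_pred.
apply: (leq_trans (leq_mul h4 (leqnn _))).
have -> : (2 ^ k * 4 ^ m * (4 ^ m * (m`! * m`!)) = (2 ^ k * 16 ^ m * m`!) * m`!)%N.
  by rewrite (_ : 16 = 4 * 4)%N// expnMn; lia.
apply: (leq_trans (leq_mul (leqnn _) h3)).
by rewrite !expnMn; apply: eq_leq; lia.
Qed.

End pair_sums.

(** * Expansion around the identity covariance *)

Section pair_sum.
Context (K : realType) (R : finType) (alpha : {set R}).

(** The m-th derivative of an expectation along a linear path of covariances
with slope D, without its factor 2 ^ -m; the weight w is a function of the order
of differentiation in each direction. *)
Definition Tsum (m : nat) (D : R -> R -> K) (w : (R -> nat) -> K) : K :=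
  \sum_(r : {ffun 'I_m -> R * R} | [forall i, inA alpha (r i)])
    (\prod_j D (r j).1 (r j).2) * w (mult r).

Lemma Tsum0 D w : Tsum 0 D w = w (fun=> 0%N).
Proof. by rewrite /Tsum sum_ffun0 big_ord0 mul1r mult0. Qed.

Lemma TsumS m D w : Tsum m.+1 D w =
  Tsum m D (fun s => \sum_(u in alpha) \sum_(v in alpha) D u v * w (inc (inc s u) v)).
Proof.
rewrite /Tsum (sum_inA_ins _ ord0).
under eq_bigr do rewrite exchange_big /=.
rewrite exchange_big /=; apply: eq_bigr => g _.
rewrite mulr_sumr; apply: eq_bigr => u _; rewrite mulr_sumr; apply: eq_bigr => v _.
rewrite (big_ins _ ord0 (u, v) g (fun q : R * R => D q.1 q.2)) mult_ins /=.
by rewrite mulrCA mulrA mulrC.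
Qed.

Lemma Tsum_le m (D : R -> R -> K) (w : (R -> nat) -> K) (eps c A B : K) :
  0 <= eps -> 0 <= c -> 0 <= A -> 0 <= B ->
  (forall u v, u \in alpha -> v \in alpha -> `|D u v| <= eps) ->
  (forall r : {ffun 'I_m -> R * R}, [forall i, inA alpha (r i)] ->
     `|w (mult r)| <= c * \prod_(e in alpha) (A * B ^+ mult r e * (mult r e)`!%:R)) ->
  `|Tsum m D w| <= c * A ^+ #|alpha| * B ^+ m.*2 * eps ^+ m * (paircount alpha m)%:R.
Proof.
move=> e0 c0 A0 B0 De wb; rewrite /Tsum /paircount natr_sum mulr_sumr.
rewrite (le_trans (ler_norm_sum _ _ _))//; apply: ler_sum => r rA.
have bE : \prod_(e in alpha) (A * B ^+ mult r e * (mult r e)`!%:R) =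
   A ^+ #|alpha| * B ^+ m.*2 * (\prod_(e in alpha) (mult r e)`!)%:R.
  by rewrite !big_split /= prodr_const natr_prod -(sum_mult rA) prodrXr.
rewrite [leRHS](_ : _ = eps ^+ m * (c * (A ^+ #|alpha| * B ^+ m.*2 * (\prod_(e in alpha) (mult r e)`!)%:R))); last by ring.
rewrite normrM normr_prod -bE ler_pM ?prodr_ge0 ?wb//.
rewrite -[m in leRHS]card_ord -prodr_const; apply: ler_prod => j _.
move/forallP : rA => /(_ j) /andP[h1 h2].
by rewrite normr_ge0 De.
Qed.

End pair_sum.

Lemma is_derive_bigsum (K : realType) (I : Type) (r : seq I) (Q : pred I)
    (h : I -> K -> K) (dh : I -> K) (t : K) :
  (forall i, Q i -> is_derive t 1 (h i) (dh i)) ->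
  is_derive t 1 (fun t => \sum_(i <- r | Q i) h i t) (\sum_(i <- r | Q i) dh i).
Proof.
move=> hd; elim: r => [|i r IH].
  under eq_fun do rewrite big_nil.
  by rewrite big_nil; apply: is_derive_cst.
under eq_fun do rewrite big_cons.
rewrite big_cons; case: ifP => // Qi.
have di := hd i Qi.
by apply: is_derive_eq.
Qed.

Lemma is_deriveM_cst (K : realType) (c : K) (h : K -> K) (dh t : K) :
  is_derive t 1 h dh -> is_derive t 1 (fun t => c * h t) (c * dh).
Proof. by move=> hd; apply: is_derive_eq; rewrite /GRing.scale/=; ring. Qed.

Section expansion.
Context (K : realType) (R : finType) (alpha : {set R}).
Notation vec n := (n.-tuple (measurableTypeR K)).
Notation g1 := (normal_prob (0 : K) 1).
Context (tau p : K).
Hypothesis p01 : 0 <= p <= 1.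

(** Orthogonal vectors of squared norm 1/2: the starting point I/2 of the path.
*)
Definition ey (u : R) (i : 'I_#|R|) : K := rthalf K * (i == enum_rank u)%:R.

Lemma lin_ey u (y : vec #|R|) : lin (ey u) y = rthalf K * tnth y (enum_rank u).
Proof.
rewrite /lin (bigD1 (enum_rank u))//= /ey eqxx mulr1 big1 ?addr0//.
by move=> i /negbTE ->; rewrite mulr0 mul0r.
Qed.

Lemma gram_ey u v : \sum_i ey u i * ey v i = 2^-1 * (u == v)%:R.
Proof.
rewrite (bigD1 (enum_rank u))//= /ey eqxx mulr1 big1 ?addr0.
  by rewrite mulrA -expr2 rthalf_sqr (inj_eq enum_rank_inj).
by move=> i /negbTE ->; rewrite mulr0 mul0r.
Qed.

Notation hF := (fun _ : R => half tau p).
Let hB (u : R) (s : nat) : K := 2 * 4 ^+ s * s`!%:R.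
Let dh (u : R) s (x : K) : is_derive x 1 (hF u s) (hF u s.+1 x).
Proof. exact: is_derive_half. Qed.
Let hb (u : R) s x : `|hF u s x| <= hB u s.
Proof. exact: half_bound. Qed.

(** The smooth functions at covariance I/2 have the same means as the indicators
at the covariance I, by half_conv. *)
Definition base_weight (s : R -> nat) : K := \prod_(u in alpha) Fs 1 tau p (s u) 0.

Lemma Esprod_ey s : Esprod alpha hF s ey = base_weight s.
Proof.
rewrite /Esprod.
have -> : (fun x => sprod alpha hF s (fun u => lin (ey u) x)) =
  (fun x : vec #|R| => \prod_(u in alpha) half tau p (s u) (0 + rthalf K * tnth x (enum_rank u))).
  by apply/funext => x; apply: eq_bigr => u _; rewrite lin_ey add0r.
rewrite (@gaussE_prod K R alpha (fun u x => half tau p (s u) (0 + rthalf K * x)) (fun u => hB u (s u))).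
- by apply: eq_bigr => u _; rewrite half_conv.
- move=> u; have m2 : measurable_fun [set: K] (fun x : K => 0 + rthalf K * x).
    by apply: measurable_funD => //; exact: measurable_funM.
  exact: measurableT_comp (@measurable_half K tau p (s u)) m2.
- by move=> u x; exact: half_bound.
Qed.

Lemma ind_conv z : \int[g1]_x ind tau p (z + rthalf K * x) = half tau p 0 z.
Proof.
rewrite /half /Fs -integral_le_ind /ind RintegralB//.
- rewrite Rintegral_cstT; congr (_ - _); apply: eq_Rintegral => x _.
  rewrite [_^-1 * _]mulrC ler_pdivlMr ?rthalf_gt0//.
  by rewrite lerBrDr [x * _]mulrC [in RHS]addrC.
- apply: (@integrable_g1_bounded K _ 1).
    have m2 : measurable_fun [set: K] (fun x : K => z + rthalf K * x).
      by apply: measurable_funD => //; exact: measurable_funM.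
    have -> : (fun x => (z + rthalf K * x <= tau)%R%:R) = ind tau 0 \o (fun x : K => z + rthalf K * x) :> (K -> K).
      by apply/funext => x; rewrite /ind /= subr0.
    exact: measurableT_comp (@measurable_ind K tau 0) m2.
  by move=> x; case: (_ <= tau)%R; rewrite ?normr1 ?normr0.
- by apply: (@integrable_g1_bounded K _ `|p|).
Qed.

(** If G = B + I/2, then N(0, G) is the law of the sum of independent Gaussian
vectors of covariances B and I/2; integrate the second one first. *)
Lemma smoothing m n (a : R -> 'I_m -> K) (b : R -> 'I_n -> K) :
  (forall u v, u \in alpha -> v \in alpha ->
     \sum_i b u i * b v i = \sum_i a u i * a v i - 2^-1 * (u == v)%:R) ->
  Eind alpha (fun=> tau) p a = Esprod alpha hF (fun=> 0%N) b.
Proof.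
move=> gram.
pose c u i : K := @embl K R n #|R| b u i + @embr K R n #|R| ey u i.
rewrite (@Eind_law K R alpha _ _ (fun=> tau) p a c p01); last first.
  move=> u v ua va; rewrite big_split_ord /=.
  rewrite (eq_bigr (fun i => b u i * b v i)); last first.
    by move=> i _; rewrite /c !embl_lshift !embr_lshift !addr0.
  rewrite [X in _ + X](eq_bigr (fun i => ey u i * ey v i)); last first.
    by move=> i _; rewrite /c !embl_rshift !embr_rshift !add0r.
  by rewrite gram// gram_ey subrK.
have lc u (x : vec n) (y : vec #|R|) : lin (c u) [tuple of x ++ y] =
    lin (b u) x + rthalf K * tnth y (enum_rank u).
  rewrite -(lin_embl b u x y) -(lin_ey u y) -(lin_embr ey u x y).
  by rewrite /lin -big_split; apply: eq_bigr => i _; rewrite mulrDl.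
rewrite /Eind (@gaussE_cat K n #|R| _ 1); first last.
- by move=> x; exact: prod_ind_le.
- exact: measurable_prod_ind.
congr gaussE; apply/funext => x.
have -> : (fun y : vec #|R| => \prod_(u in alpha) ind tau p (lin (c u) [tuple of x ++ y])) =
  (fun y : vec #|R| => \prod_(u in alpha) ind tau p (lin (b u) x + rthalf K * tnth y (enum_rank u))).
  by apply/funext => y; apply: eq_bigr => u _; rewrite lc.
rewrite (@gaussE_prod K R alpha (fun u z => ind tau p (lin (b u) x + rthalf K * z)) (fun=> 1)).
- by apply: eq_bigr => u _; rewrite ind_conv.
- move=> u; have m2 : measurable_fun [set: K] (fun z : K => lin (b u) x + rthalf K * z).
    by apply: measurable_funD => //; exact: measurable_funM.
  exact: measurableT_comp (@measurable_ind K tau p) m2.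
- by move=> u z; exact: ind_le.
Qed.

(** Taylor's formula of order N in t, along the path of covariances I/2 + t D
from I/2 to G - I/2, for the smoothed indicators. *)
Lemma star_expansion d (a : R -> 'I_d -> K) (eps : K) (N : nat) :
  let G u v := \sum_i a u i * a v i in
  let D u v := G u v - (u == v)%:R in
  0 <= eps ->
  (forall u v, u \in alpha -> v \in alpha -> `|D u v| <= eps) ->
  eps * #|alpha|%:R <= 4^-1 ->
  `|Eind alpha (fun=> tau) p a
    - \sum_(m < N) (2 ^+ m * m`!%:R)^-1 * Tsum alpha m D base_weight| <=
  2 ^+ #|alpha| * 16 ^+ N * eps ^+ N * (paircount alpha N)%:R / (2 ^+ N * N`!%:R).
Proof.
move=> G D e0 De ek.
have Gs u v : G u v = G v u by apply: eq_bigr => i _; rewrite mulrC.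
have [b bg] := near_identity_dominant Gs De ek.
set n := #|{: R * R}| in b bg *.
rewrite (smoothing bg).
pose A := @embl K R n #|R| b; pose B := @embr K R n #|R| ey.
have orth u v : u \in alpha -> v \in alpha -> \sum_i A u i * B v i = 0.
  move=> _ _; rewrite big_split_ord /= !big1 ?addr0// => i _.
    by rewrite /A embl_rshift mul0r.
  by rewrite /B embr_lshift mulr0.
have gA u v : \sum_i A u i * A v i = \sum_i b u i * b v i.
  rewrite big_split_ord /= [X in _ + X]big1 ?addr0; last first.
    by move=> i _; rewrite /A embl_rshift mul0r.
  by apply: eq_bigr => i _; rewrite /A !embl_lshift.
have gB u v : \sum_i B u i * B v i = 2^-1 * (u == v)%:R.
  rewrite big_split_ord /= [X in X + _]big1 ?add0r; last first.
    by move=> i _; rewrite /B embr_lshift mul0r.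
  by rewrite -gram_ey; apply: eq_bigr => i _; rewrite /B !embr_rshift.
pose P s t := Psi alpha hF A B s t.
have P1 s : P s 1 = Esprod alpha hF s b.
  by rewrite /P /Psi mixc1 (@Esprod_embl K R alpha hF hB dh hb).
have P0 s : P s 0 = base_weight s.
  by rewrite /P /Psi mixc0 (@Esprod_embr K R alpha hF hB dh hb) Esprod_ey.
have Pc s : {within `[0, 1], continuous (P s)}.
  by apply: within01_continuous => t; exact: (@Psi_continuous K R alpha _ hF hB dh hb A B s t).
have dP s (t : K) : 0 < t < 1 -> is_derive t 1 (P s)
    (2^-1 * \sum_(u in alpha) \sum_(v in alpha) D u v * P (inc (inc s u) v) t).
  move=> t01; apply: is_derive_eq (@is_derive_Psi K R alpha _ hF hB dh hb A B orth s t t01) _.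
  congr (_ * _); apply: eq_bigr => u ua; apply: eq_bigr => v va.
  congr (_ * _); rewrite gA gB bg//.
  by rewrite /D; lra.
pose f m (t : K) := (2 ^+ m)^-1 * Tsum alpha m D (fun s => P s t).
have cf m : {within `[0, 1], continuous (f m)}.
  move=> x; apply: cvgM; first exact: cvg_cst.
  apply: cvg_big => [|r _]; first exact: add_continuous.
  by apply: cvgM; [exact: cvg_cst|exact: Pc].
have df m (t : K) : 0 < t < 1 -> is_derive t 1 (f m) (f m.+1 t).
  move=> t01; rewrite /f TsumS.
  have d1 := @is_derive_bigsum K _ (index_enum {ffun 'I_m -> R * R}) (fun r => [forall i, inA alpha (r i)])
    (fun r t => (\prod_j D (r j).1 (r j).2) * P (mult r) t) _ t
    (fun r _ => is_deriveM_cst (\prod_j D (r j).1 (r j).2) (dP (mult r) t t01)).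
  have -> : (fun t => (2 ^+ m)^-1 * Tsum alpha m D (fun s => P s t)) = (fun t => (2 ^+ m)^-1 *
     \sum_(r : {ffun 'I_m -> R * R} | [forall i, inA alpha (r i)]) (\prod_j D (r j).1 (r j).2) * P (mult r) t) by [].
  apply: is_derive_eq (is_deriveM_cst _ d1) _.
  rewrite exprS invfM -mulrA mulrCA; congr (_ * _); rewrite mulr_sumr.
  by apply: eq_bigr => r _; rewrite mulrCA.
have fN (t : K) : 0 <= t <= 1 -> `|f N t| <= (2 ^+ N)^-1 * (2 ^+ #|alpha| * 16 ^+ N * eps ^+ N * (paircount alpha N)%:R).
  move=> _; rewrite normrM ger0_norm ?invr_ge0 ?exprn_ge0// ler_wpM2l ?invr_ge0 ?exprn_ge0//.
  have := @Tsum_le K R alpha N D (fun s => P s t) eps 1 2 4 e0 ler01 (ler0n _ _) (ler0n _ _) De.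
  have e16 : (4 : K) ^+ 2 = 16 by ring.
  rewrite -mul2n exprM e16 mul1r; apply => r _; rewrite mul1r.
  exact: (@Esprod_le K R alpha _ hF hB dh hb (mult r) (mixc A B t)).
have := taylor01 cf df fN (_ : 0 <= 1 <= 1).
rewrite lexx ler01 => /(_ isT).
rewrite /f expr0 invr1 mul1r Tsum0 P1.
rewrite (eq_bigr (fun m : 'I_N => (2 ^+ m * m`!%:R)^-1 * Tsum alpha m D base_weight)); last first.
  move=> m _; have -> : (fun s => P s 0) = base_weight by apply/funext/P0.
  by rewrite expr1n div1r invfM mulrAC.
move=> /le_trans; apply; rewrite expr1n div1r mulrC mulrA -invfM mulrC.
by rewrite (mulrC (N`!%:R)).
Qed.

End expansion.

(** * Symmetry and scaling of the normal distribution function *)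

Section primitives.
Context (K : realType).
Notation g1 := (normal_prob (0 : K) 1).
Notation mu := (@lebesgue_measure K).

Let idRV : measurableTypeR K -> K := idfun.

#[local] HB.instance Definition _ :=
  @isMeasurableFun.Build _ _ _ _ idRV (@measurable_id _ _ setT).

(** Two functions with the same derivative and the same limit are equal; this
identifies distribution functions without a change of variables. *)
Lemma eq_of_derive (f g h : K -> K) (l : K) :
  (forall x : K, is_derive x 1 f (h x)) -> (forall x : K, is_derive x 1 g (h x)) ->
  f x @[x --> +oo] --> l -> g x @[x --> +oo] --> l -> f =1 g.
Proof.
move=> df dg fl gl x.
have dd (y : K) : is_derive y 1 (fun x => f x - g x) 0.
  by have d1 := df y; have d2 := dg y; apply: is_derive_eq; rewrite subrr.
have cst y : f y - g y = f x - g x.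
  have cd (a b : K) : {within `[a, b], continuous (fun x => f x - g x)}.
    apply: continuous_subspaceT => z; apply/differentiable_continuous/derivable1_diffP.
    by have [] := dd z.
  have [xy|yx|->//] := ltgtP x y.
    have [c _] := MVT xy (fun z _ => dd z) (cd _ _).
    by rewrite mul0r => /eqP; rewrite subr_eq0 => /eqP.
  have [c _] := MVT yx (fun z _ => dd z) (cd _ _).
  by rewrite mul0r => /eqP; rewrite subr_eq0 => /eqP.
have h1 : (f y - g y) @[y --> +oo] --> l - l by exact: cvgB.
rewrite subrr in h1.
have h2 : (f y - g y) @[y --> +oo] --> f x - g x.
  by rewrite (_ : (fun y => f y - g y) = (fun=> f x - g x)); [exact: cvg_cst|apply/funext].
by apply/eqP; rewrite -subr_eq0; apply/eqP; exact: (cvg_unique _ h2 h1).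
Qed.

Lemma PhiN x : Phi (- x) = 1 - Phi x :> K.
Proof.
apply: (@eq_of_derive (fun x => Phi (- x)) (fun x => 1 - Phi x) (fun x => - gphi x) 0).
- move=> y; have d := is_derive_Phi (- y).
  have dn : is_derive y 1 (fun y : K => - y) (- 1) by apply: is_derive_eq.
  have := @is_derive1_comp K (@Phi K) (fun y => - y) y _ _ d dn.
  by rewrite mulrN1 gphiN.
- by move=> y; have d := is_derive_Phi y; apply: is_derive_eq; ring.
- have := @Phi_cvgNy K; rewrite cvgNy_compNP; exact.
- rewrite -[X in _ --> X](subrr 1); apply: cvgB; [exact: cvg_cst|exact: Phi_cvgy].
Qed.

Lemma Phi0 : Phi 0 = 2^-1 :> K.
Proof. by have := PhiN 0; rewrite oppr0; lra. Qed.

Lemma Phi_le : {homo @Phi K : x y / x <= y}.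
Proof.
move=> x y xy; rewrite -lee_fin !PhiE le_measure ?inE//.
by apply: subset_itvl; rewrite bnd_simp.
Qed.

Lemma Phi_MVT (x y : K) : x <= y ->
  exists2 c, x <= c <= y & Phi y - Phi x = gphi c * (y - x).
Proof.
move=> xy; have [|c] := MVT_segment xy (fun z _ => is_derive_Phi z).
  apply: continuous_subspaceT => z; apply/differentiable_continuous/derivable1_diffP.
  by have [] := is_derive_Phi z.
by rewrite in_itv/= => cI e; exists c.
Qed.

Lemma normal_prob_Phi (s t : K) : 0 < s ->
  normal_prob 0 s `]-oo, t] = (Phi (t / s))%:E.
Proof.
move=> s0; have sn : s != 0 by rewrite gt_eqF.
pose Q (t : K) := fine (normal_prob 0 s `]-oo, t]).
have QE : (Q t)%:E = normal_prob 0 s `]-oo, t] by rewrite /Q fineK//; exact: fin_num_measure.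
rewrite -QE; congr (_%:E).
apply: (@eq_of_derive Q (fun t => Phi (t / s)) (normal_pdf 0 s) 1).
- move=> x.
  have i : mu.-integrable [set` `]-oo, (x + 1)]] (EFin \o normal_pdf 0 s).
    by apply: integrableS (integrable_normal_pdf 0 s).
  have [] := continuous_FTC1 (_ : x < x + 1) i _ (@continuous_normal_pdf K 0 s sn x).
  + by rewrite ltrDl.
  + by rewrite ltNyr.
  move=> d1 d2; apply: DeriveDef; first exact: d1.
  by rewrite -derive1E; exact: d2.
- move=> x; have d := is_derive_Phi (x / s).
  have dn : is_derive x 1 (fun x : K => x / s) s^-1.
    by apply: is_derive_eq; rewrite /GRing.scale /= ?mulr1 ?mul1r ?mulr0 ?add0r ?addr0.
  have := @is_derive1_comp K (@Phi K) (fun y => y / s) x _ _ d dn.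
  have -> : gphi (x / s) * s^-1 = normal_pdf 0 s x; last by [].
  rewrite /gphi !normal_pdfE ?oner_neq0// /normal_fun !subr0 /normal_peak.
  rewrite expr1n mul1r -[s ^+ 2 * pi *+ 2]mulrnAr sqrtrM ?sqr_ge0// sqrtr_sqr (gtr0_norm s0) invfM.
  have -> : - (x / s) ^+ 2 / 2 = - x ^+ 2 / (s ^+ 2 *+ 2).
    by rewrite -mulr_natr; field.
  ring.
- by have := @cvg_cdfy1 _ _ K (normal_prob 0 s) (idRV : {RV (normal_prob 0 s) >-> K}) => /fine_cvg.
- have h : (x / s) @[x --> +oo] --> +oo.
    by apply: gt0_cvgMly; [rewrite invr_gt0|exact: cvg_id].
  exact: (cvg_comp _ _ h (@Phi_cvgy K)).
Qed.

End primitives.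

(** * The threshold as an average over the variance *)

Section threshold.
Context (K : realType).
Notation vec n := (n.-tuple (measurableTypeR K)).
Notation g1 := (normal_prob (0 : K) 1).

(** Given y, the variance of <x, y> / sqrt d. *)
Definition sqn d (x : vec d) : K := d%:R^-1 * \sum_i tnth x i ^+ 2.

(** The distribution function at tau of a centred Gaussian of variance s, which
is a unit step for s = 0. *)
Definition Hf (tau s : K) : K :=
  if s == 0 then (0 <= tau)%R%:R else Phi (tau / Num.sqrt s).

Lemma Hf_norm_le tau s : `|Hf tau s| <= 1.
Proof.
rewrite /Hf; case: ifP => _; first by case: (0 <= tau)%R; rewrite ?normr1 ?normr0.
by rewrite ger0_norm ?Phi_ge0 ?Phi_le1.
Qed.

Lemma sqn_ge0 d (x : vec d) : 0 <= sqn x.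
Proof. by rewrite mulr_ge0 ?invr_ge0// sumr_ge0// => i _; exact: sqr_ge0. Qed.

(** Integrate over one of the two vectors first: given x, the normalized inner
product is Gaussian of variance sqn x. *)
Lemma threshold_Hf d (p tau : K) : (0 < d)%N -> is_threshold d p tau ->
  p = gaussE (fun x : vec d => Hf tau (sqn x)) /\
  measurable_fun [set: vec d] (fun x : vec d => Hf tau (sqn x)).
Proof.
move=> d0; rewrite /is_threshold.
set A := [set z | _] => pA.
pose L (z : vec d * vec d) := (Num.sqrt d%:R)^-1 * inner z.1 z.2.
pose f z : K := (L z <= tau)%R%:R.
have mL : measurable_fun [set: vec d * vec d] L.
  apply: measurable_funM => //; apply: measurable_sum => i; apply: measurable_funM.
    by apply: (measurableT_comp (@measurable_tnthK K d i)); exact: measurable_fst.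
  by apply: (measurableT_comp (@measurable_tnthK K d i)); exact: measurable_snd.
have mA : measurable A.
  rewrite -[A]setTI (_ : A = L @^-1` `]-oo, tau]); last first.
    by apply/seteqP; split => z /=; rewrite in_itv.
  exact: mL.
have fE : f = \1_A.
  apply/funext => z; rewrite /f indicE; congr (_%:R).
  by congr nat_of_bool; apply/idP/idP; rewrite inE.
have mf : measurable_fun [set: vec d * vec d] f by rewrite fE; exact: measurable_indic.
have fb z : `|f z| <= 1 by rewrite /f; case: (_ <= tau)%R; rewrite ?normr1 ?normr0.
have sd : 0 < Num.sqrt d%:R :> K by rewrite sqrtr_gt0 ltr0n.
have inE x : gaussE (fun y => f (x, y)) = Hf tau (sqn x).
  have fl y : f (x, y) = (lin (fun i => (Num.sqrt d%:R)^-1 * tnth x i) y <= tau)%R%:R.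
    rewrite /f /L /lin /inner /= mulr_sumr; congr (_%:R); congr (nat_of_bool (_ <= _)).
    by apply: eq_bigr => i _; rewrite mulrA.
  have sq : \sum_i ((Num.sqrt d%:R)^-1 * tnth x i : K) ^+ 2 = sqn x.
    rewrite /sqn mulr_sumr; apply: eq_bigr => i _.
    by rewrite exprMn exprVn sqr_sqrtr.
  rewrite /Hf; case: eqP => [s0|/eqP s0].
    have x0 i : (Num.sqrt d%:R)^-1 * tnth x i = 0 :> K.
      apply/eqP; rewrite -sqrf_eq0.
      have := sq; rewrite s0 => /eqP; rewrite psumr_eq0; last by move=> j _; exact: sqr_ge0.
      by move=> /allP/(_ i); rewrite mem_index_enum => /(_ isT).
    rewrite -[RHS](@Rintegral_cstT _ _ _ (gaussian K d)); congr gaussE; apply/funext => y.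
    rewrite fl /lin big1// => i _; by rewrite x0 mul0r.
  have -> : (fun y => f (x, y)) = (fun y => (lin (fun i => (Num.sqrt d%:R)^-1 * tnth x i) y <= tau)%R%:R).
    by apply/funext.
  have sp : 0 < sqn x by rewrite lt_def s0 sqn_ge0.
  rewrite (@prob_lin K d _ _ (Num.sqrt (sqn x)))// ?sqrtr_gt0//.
  by rewrite sq sqr_sqrtr// sqn_ge0.
split; last first.
  have := @gaussE_partial_meas K _ (vec d) d f 1 mf fb.
  by under eq_fun do rewrite inE.
have fi := @bounded_integrable _ _ K (gaussian K d \x gaussian K d)%E f 1 mf fb.
have := @Rfubini1 _ _ _ _ K (gaussian K d) (gaussian K d) f fi.
under [in RHS]eq_Rintegral => x _ do rewrite -/(gaussE (fun y => f (x, y))) inE.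
rewrite /gaussE => <-; rewrite /Rintegral.
have I := @integral_indic _ _ _ (gaussian K d \x gaussian K d)%E _ measurableT A mA.
rewrite setIT in I.
have -> : (fun x => (f x)%:E) = (fun x => (\1_A x)%:E) by rewrite fE.
exact: (etrans (congr1 fine (esym pA)) (congr1 fine (esym I))).
Qed.

End threshold.

Section square_moments.
Context (K : realType).
Notation vec n := (n.-tuple (measurableTypeR K)).
Notation g1 := (normal_prob (0 : K) 1).

Definition cent (j : nat) (x : K) : K := (x ^+ 2 - 1) ^+ j.
Definition cmom (j : nat) : K := \int[g1]_x cent j x.

Lemma measurable_cent j : measurable_fun [set: K] (cent j).
Proof.
apply: measurable_funX; apply: measurable_funB => //; exact: measurable_exprn.
Qed.

Lemma integrable_cent j : g1.-integrable [set: _] (EFin \o cent j).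
Proof.
pose P : {poly K} := ('X^2 - 1) ^+ j.
have h := @integrable_sum _ _ _ g1 _ measurableT 'I_(size P) (index_enum _) predT
  (fun i x => (P`_i * x ^+ i)%:E).
apply: eq_integrable (h _) => //.
  move=> x _ /=; rewrite sumEFin; congr (_%:E).
  by rewrite -horner_coef /P horner_exp !hornerE.
move=> i _; have := integrableZl measurableT P`_i (@integrable_g1_exp K i).
by apply: eq_integrable => // x _ /=; rewrite EFinM.
Qed.

Lemma cmom0 : cmom 0 = 1.
Proof. by rewrite /cmom; under eq_Rintegral do rewrite /cent expr0; exact: Rintegral_cstT. Qed.

Lemma cmom1 : cmom 1 = 0.
Proof.
rewrite /cmom; under eq_Rintegral do rewrite /cent expr1.
rewrite RintegralB//; first by rewrite g1_var Rintegral_cstT subrr.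
  exact: integrable_g1_exp.
by apply: (@integrable_g1_bounded K _ 1) => // x; rewrite normr1.
Qed.

(** The centred sum d (sqn x - 1). *)
Definition centsum d (x : vec d) : K := \sum_i (tnth x i ^+ 2 - 1).

Lemma measurable_centsum d : measurable_fun [set: vec d] (@centsum d).
Proof.
apply: measurable_sum => i; apply: measurable_funB => //; apply: measurable_funX.
exact: measurable_tnthK.
Qed.

Lemma centsum_cons d x (y : vec d) : centsum (Defs.cons_tuple (x, y)) = (x ^+ 2 - 1) + centsum y.
Proof.
rewrite /centsum big_ord_recl tnth_cons0; congr (_ + _).
by apply: eq_bigr => i _; rewrite tnth_consS.
Qed.

(** The central moments of a chi-square variable. *)
Definition Mom d j : K := gaussE (fun x : vec d => centsum x ^+ j).

(** The binomial formula for the sum of the head and of the tail of a vector,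
which are independent. *)
Lemma Mom_rec d j : (forall i, gint (fun x : vec d => centsum x ^+ i)) ->
  gint (fun x : vec d.+1 => centsum x ^+ j) /\
  Mom d.+1 j = \sum_(i < j.+1) (cmom (j - i) * Mom d i) *+ 'C(j, i).
Proof.
move=> IH.
pose hd (x : vec d.+1) : K := tnth x ord0.
pose tl (x : vec d.+1) : vec d := [tuple of behead x].
have mtl : measurable_fun [set: vec d.+1] tl by exact: measurable_behead.
have tlc x (y : vec d) : tl (Defs.cons_tuple (x, y)) = y by apply: val_inj.
pose F (i : 'I_j.+1) (x : vec d.+1) : K := cent (j - i) (hd x) * centsum (tl x) ^+ i.
have FP i : gint (F i) /\ gaussE (F i) = cmom (j - i) * Mom d i.
  apply: gint_cons_mul.
  - apply: measurable_funM.
      exact: measurableT_comp (measurable_cent _) (@measurable_tnthK K d.+1 ord0).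
    apply: measurable_funX; exact: measurableT_comp (@measurable_centsum d) mtl.
  - by move=> x y; rewrite /F /hd tnth_cons0 tlc.
  - exact: measurable_cent.
  - exact: integrable_cent.
  - exact: IH.
have FE : (fun x : vec d.+1 => centsum x ^+ j) = (fun x => \sum_(i < j.+1) 'C(j, i)%:R * F i x).
  apply/funext => x; have -> : x = Defs.cons_tuple (hd x, tl x).
    by rewrite [LHS](tuple_eta x).
  rewrite centsum_cons exprDn; apply: eq_bigr => i _.
  by rewrite /F /hd tnth_cons0 tlc -mulr_natl.
have FZ (i : 'I_j.+1) : gint (fun x => 'C(j, i)%:R * F i x).
  have := integrableZl measurableT ('C(j, i)%:R) (FP i).1.
  exact: eq_integrable.
split.
  rewrite FE; have h := @integrable_sum _ _ _ (gaussian K d.+1) _ measurableT 'I_j.+1 (index_enum _) predT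
    (fun i x => ('C(j, i)%:R * F i x)%:E) (fun i _ => FZ i).
  by apply: eq_integrable h => // x _ /=; rewrite sumEFin.
rewrite /Mom FE {1}/gaussE Rintegral_sumT//; apply: eq_bigr => i _.
by rewrite RintegralZl ?mulr_natl; [rewrite -/(gaussE (F i)) (FP i).2|..|exact: (FP i).1].
Qed.

Lemma gint_centsum d j : gint (fun x : vec d => centsum x ^+ j).
Proof.
elim: d j => [|d IH] j; last by have [] := Mom_rec j (IH).
apply: (@gint_bounded _ _ _ 1).
  by apply: measurable_funX; exact: measurable_centsum.
move=> x; rewrite /centsum big_ord0 normrX normr0.
by case: j => [|j]; rewrite ?expr0// expr0n ler01.
Qed.

Lemma MomS d j : Mom d.+1 j = \sum_(i < j.+1) (cmom (j - i) * Mom d i) *+ 'C(j, i).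
Proof. by have [] := Mom_rec j (fun i => gint_centsum d i). Qed.

Lemma Mom_dim0 j : Mom 0 j = (j == 0%N)%:R.
Proof.
rewrite /Mom gaussE0; first by rewrite /centsum big_ord0 expr0n.
by apply: measurable_funX; exact: measurable_centsum.
Qed.

Lemma Mom_0 d : Mom d 0 = 1.
Proof.
by elim: d => [|d IH]; rewrite ?Mom_dim0// MomS big_ord1 IH cmom0 mulr1.
Qed.

Lemma Mom_1 d : Mom d 1 = 0.
Proof.
elim: d => [|d IH]; first by rewrite Mom_dim0.
by rewrite MomS !big_ord_recr big_ord0 /= IH Mom_0 cmom0 cmom1 !mulr0 !mul0r !mul0rn !addr0.
Qed.

Lemma Mom_2 d : Mom d 2 = d%:R * cmom 2.
Proof.
elim: d => [|d IH]; first by rewrite Mom_dim0 mul0r.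
rewrite MomS !big_ord_recr big_ord0 /= !subn0 subnn IH Mom_0 Mom_1 cmom0 cmom1.
rewrite bin0 bin1 binn.
by rewrite -natr1; ring.
Qed.

Lemma Mom_3 d : Mom d 3 = d%:R * cmom 3.
Proof.
elim: d => [|d IH]; first by rewrite Mom_dim0 mul0r.
rewrite MomS !big_ord_recr big_ord0 /= !subn0 subnn IH Mom_0 Mom_1 cmom0.
rewrite bin0 bin1 binn.
by rewrite (_ : 3 - 2 = 1)%N// cmom1 -natr1; ring.
Qed.

(** The recurrence gives m4 d + 3 m2^2 d (d - 1); a bound by a multiple of d^2
is what induction preserves most easily. *)
Lemma Mom_4 d : Mom d 4 <= d%:R ^+ 2 * (6 * cmom 2 ^+ 2 + `|cmom 4|).
Proof.
elim: d => [|d IH]; first by rewrite Mom_dim0 expr0n/= mul0r.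
rewrite MomS !big_ord_recr big_ord0 /= !subn0 subnn Mom_0 Mom_1 Mom_2 Mom_3 cmom0.
rewrite (_ : 4 - 3 = 1)%N// (_ : 4 - 2 = 2)%N// cmom1.
have b : 'C(4, 2) = 6%N by [].
rewrite b bin0 bin1 binn -natr1.
have h1 := ler_norm (cmom 4); have h2 := sqr_ge0 (cmom 2); have h3 := normr_ge0 (cmom 4).
have h4 : 0 <= d%:R * `|cmom 4| by rewrite mulr_ge0.
have h5 : 0 <= d%:R * cmom 2 ^+ 2 by rewrite mulr_ge0.
rewrite [leLHS](_ : _ = cmom 4 + 6 * (d%:R * cmom 2 ^+ 2) + Mom d 4); last by ring.
apply: (le_trans (lerD (lexx _) IH)).
rewrite [leRHS](_ : _ = d%:R ^+ 2 * (6 * cmom 2 ^+ 2 + `|cmom 4|) + 12 * (d%:R * cmom 2 ^+ 2)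
   + 2 * (d%:R * `|cmom 4|) + 6 * cmom 2 ^+ 2 + `|cmom 4|); last by ring.
lra.
Qed.

End square_moments.

(** * Expansion in the variance *)

Section variance_expansion.
Context (K : realType).
Notation vec n := (n.-tuple (measurableTypeR K)).
Notation g1 := (normal_prob (0 : K) 1).

Lemma poly_gphi_bounded (P : {poly K}) :
  exists2 c : K, 0 <= c & forall x, `|P.[x] * gphi x| <= c.
Proof.
exists (\sum_(i < size P) `|P`_i| * (2 * i`!%:R)).
  by apply: sumr_ge0 => i _; rewrite !mulr_ge0.
move=> x; rewrite horner_coef mulr_suml (le_trans (ler_norm_sum _ _ _))//.
apply: ler_sum => i _; rewrite -mulrA normrM ler_wpM2l//.
by rewrite normrM normrX (ger0_norm (gphi_ge0 x)) expn_gphi_le.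
Qed.

(** Chebyshev's inequality, plus the trivial bound. *)
Lemma Phi_tail (tau : K) : 0 <= tau -> (1 - Phi tau) * (1 + tau ^+ 2) <= 2.
Proof.
move=> t0.
have h1 : (1 - Phi tau) * tau ^+ 2 <= 1.
  have mi : measurable_fun [set: K] (fun x : K => (x <= tau)%R%:R : K).
    have -> : (fun x : K => (x <= tau)%R%:R : K) = ind tau 0.
      by apply/funext => x; rewrite /ind subr0.
    exact: measurable_ind.
  have bi (x : K) : `|(x <= tau)%R%:R : K| <= 1.
    by case: (x <= tau)%R; rewrite ?normr1 ?normr0.
  have ii := integrable_g1_bounded mi bi.
  have i1 : g1.-integrable [set: _] (EFin \o (fun _ : K => 1 : K)).
    by apply: (@integrable_g1_bounded K _ 1) => // x; rewrite normr1.
  have i2 : g1.-integrable [set: _] (EFin \o (fun x : K => 1 - (x <= tau)%R%:R : K)).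
    have := integrableB measurableT i1 ii.
    by apply: eq_integrable => // x _ /=; rewrite EFinB.
  have e1 : \int[g1]_x ((1 - (x <= tau)%R%:R) * tau ^+ 2 : K) = (1 - Phi tau) * tau ^+ 2.
    rewrite (RintegralZr _ measurableT i2); congr (_ * _).
    by rewrite (RintegralB measurableT i1 ii) Rintegral_cstT integral_le_ind.
  rewrite -e1 -[leRHS](g1_var K).
  apply: le_Rintegral => //.
  - apply: (@integrable_g1_bounded K _ (tau ^+ 2)).
      by apply: measurable_funM => //; exact: measurable_funB.
    move=> x; case: (x <= tau)%R; first by rewrite subrr mul0r normr0 sqr_ge0.
    by rewrite subr0 mul1r ger0_norm ?sqr_ge0.
  - exact: integrable_g1_exp.
  - move=> x _; have [xt|xt] := leP x tau; first by rewrite subrr mul0r sqr_ge0.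
    rewrite subr0 mul1r lerXn2r ?nnegrE ?(ltW xt)//.
    exact: le_trans t0 (ltW xt).
by have := Phi_ge0 tau; lra.
Qed.

(** The polynomials in x = tau / sqrt s that multiply phi(x) in the derivatives
of s |-> Phi(tau / sqrt s); the recurrence uses ds x = - x / (2 s). *)
Fixpoint hq_poly (j : nat) : {poly K} :=
  if j is j'.+1 then
    - (j'.+1%:R *: hq_poly j') - 2^-1 *: ('X * (hq_poly j')^`()) + 2^-1 *: ('X^2 * hq_poly j')
  else - (2^-1 *: 'X).

(** The j-th derivative of s |-> Phi(tau / sqrt s). *)
Definition hq (tau : K) (j : nat) (s : K) : K :=
  if j is j'.+1 then (s ^+ j)^-1 * ((hq_poly j').[tau / Num.sqrt s] * gphi (tau / Num.sqrt s))
  else Phi (tau / Num.sqrt s).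

Lemma is_derive_root (tau s : K) : 0 < s ->
  is_derive s 1 (fun s => tau / Num.sqrt s) (- (tau / Num.sqrt s) / (2 * s)).
Proof.
move=> s0; have d := is_derive1_sqrt s0.
have r0 : Num.sqrt s != 0 by rewrite sqrtr_eq0 -ltNge.
have d2 := @is_deriveV K Num.sqrt s _ 1 r0 d.
have -> : (fun s => tau / Num.sqrt s) = (fun s => tau * (Num.sqrt s)^-1) by [].
apply: is_derive_eq; rewrite /GRing.scale/=.
have e := sqr_sqrtr (ltW s0); move: (Num.sqrt s) r0 e => r r0 e.
by rewrite -e; field.
Qed.

Lemma is_derive_hq (tau : K) j (s : K) : 0 < s ->
  is_derive s 1 (hq tau j) (hq tau j.+1 s).
Proof.
move=> s0; have sn : s != 0 by rewrite gt_eqF.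
have dr := is_derive_root tau s0.
case: j => [|j].
  have := @is_derive1_comp K (@Phi K) (fun s => tau / Num.sqrt s) s _ _ (is_derive_Phi _) dr.
  move=> h; apply: is_derive_eq h _; rewrite /hq /=.
  rewrite expr1 hornerN hornerZ hornerX; move: (tau / Num.sqrt s) (gphi _) => x g.
  by field.
have dg := @is_derive1_comp K (@gphi K) (fun s => tau / Num.sqrt s) s _ _ (is_derive_gphi _) dr.
have dp := @is_derive1_comp K (horner (hq_poly j)) (fun s => tau / Num.sqrt s) s _ _ (is_derive_poly _ _) dr.
have dX : is_derive s 1 (fun s : K => s ^+ j.+1) (j.+1%:R * s ^+ j).
  have := @is_deriveX K K id j.+1 s 1 1 (is_derive_id _ _).
  by rewrite exprfctE /= /GRing.scale /= mulr1.
have sj : s ^+ j.+1 != 0 by rewrite expf_neq0.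
have dV := @is_deriveV K (fun s : K => s ^+ j.+1) s _ 1 sj dX.
rewrite /hq -[fun s => _]/(fun s => (s ^+ j.+1)^-1 *
  ((horner (hq_poly j) \o (fun s => tau / Num.sqrt s)) s * (@gphi K \o (fun s => tau / Num.sqrt s)) s)).
apply: is_derive_eq; rewrite /GRing.scale /= -/hq_poly.
rewrite hornerD hornerD !hornerN !hornerZ !hornerM !hornerX.
move: (tau / Num.sqrt s) => x; move: (gphi x) (hq_poly j).[x] ((hq_poly j)^`()).[x] => g P P'.
rewrite !exprS; have : s ^+ j != 0 by rewrite expf_neq0.
move: (s ^+ j) (j.+1%:R : K) => S J S0.
by field; rewrite sn S0.
Qed.

Arguments hq : simpl never.

Lemma hq_taylor N (tau s B : K) : 0 < s ->
  (forall t, 0 <= t <= 1 -> `|hq tau N (1 + t * (s - 1))| <= B) ->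
  `|hq tau 0 s - \sum_(m < N) (s - 1) ^+ m * hq tau m 1 / m`!%:R|
    <= B * `|s - 1| ^+ N / N`!%:R.
Proof.
move=> s0 hB; pose f m (t : K) := (s - 1) ^+ m * hq tau m (1 + t * (s - 1)).
have pos (t : K) : 0 <= t <= 1 -> 0 < 1 + t * (s - 1).
  move=> /andP[a b]; have [s1|s1] := leP 1 s.
    by rewrite (lt_le_trans ltr01)// lerDl mulr_ge0// subr_ge0.
  have : t * (1 - s) <= 1 - s by rewrite ler_piMl// subr_ge0 ltW.
  lra.
have dl (t : K) : is_derive t 1 (fun t => 1 + t * (s - 1)) (s - 1).
  by apply: is_derive_eq; rewrite /GRing.scale/=; ring.
have df' m (t : K) : 0 <= t <= 1 -> is_derive t 1 (f m) (f m.+1 t).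
  move=> t01; have p0 := pos t t01.
  have d := @is_derive1_comp K (hq tau m) (fun t => 1 + t * (s - 1)) t _ _ (is_derive_hq tau m p0) (dl t).
  rewrite /f -[fun t => _]/(fun t => (s - 1) ^+ m * (hq tau m \o (fun t => 1 + t * (s - 1))) t).
  by apply: is_derive_eq; move: (hq tau m.+1 _) => h; rewrite /GRing.scale /= exprS; ring.
have cf m : {within `[0, 1], continuous (f m)}.
  apply: continuous_in_subspaceT => t; rewrite inE/= in_itv/= => t01.
  by apply/differentiable_continuous/derivable1_diffP; have [] := df' m t t01.
have df m (t : K) : 0 < t < 1 -> is_derive t 1 (f m) (f m.+1 t).
  by move=> t01; apply: df'; lra.
have fN (t : K) : 0 <= t <= 1 -> `|f N t| <= `|s - 1| ^+ N * B.
  by move=> t01; rewrite /f normrM normrX ler_wpM2l// hB.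
have := taylor01 cf df fN (_ : 0 <= 1 <= 1); rewrite lexx ler01 => /(_ isT).
have f1 : f 0%N 1 = hq tau 0 s by rewrite /f !mul1r subrKC.
rewrite f1 expr1n mulrA mulr1 (mulrC _ B).
apply: le_trans; rewrite le_eqVlt; apply/orP; left; apply/eqP; congr (`|_ - _|).
by apply: eq_bigr => m _; rewrite /f mul0r addr0 expr1n mulrA mulr1.
Qed.

(** For s >= 1/2 one has tau^2 = s x^2 with x = tau / sqrt s, and a polynomial
in x times phi(x) is bounded; the powers of s are absorbed as (1/s)^n <= 2^n. *)
Lemma hq_weight j : exists2 c : K, 0 <= c & forall tau s : K, 2^-1 <= s ->
  `|hq tau j.+1 s| <= c / (1 + tau ^+ 2).
Proof.
have [c c0 hc] := poly_gphi_bounded ((2%:P ^+ j.+1 + 2%:P ^+ j * 'X^2) * hq_poly j).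
exists c => // tau s s2; have s0 : 0 < s by lra.
have t1 : 0 < 1 + tau ^+ 2 by have := sqr_ge0 tau; lra.
rewrite ler_pdivlMr//; set x := tau / Num.sqrt s.
have tx : tau ^+ 2 = s * x ^+ 2.
  rewrite /x exprMn exprVn (sqr_sqrtr (ltW s0)) mulrCA divff ?gt_eqF//.
  by rewrite mulr1.
have := hc x; apply: le_trans.
rewrite /hq -/x hornerM hornerD hornerM -!polyC_exp !hornerC hornerXn.
rewrite [leLHS](_ : _ = `|(s ^+ j.+1)^-1| * (1 + tau ^+ 2) * `|(hq_poly j).[x] * gphi x|); last first.
  by rewrite !normrM; ring.
rewrite [leRHS](_ : _ = `|2 ^+ j.+1 + 2 ^+ j * x ^+ 2| * `|(hq_poly j).[x] * gphi x|); last first.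
  by rewrite !normrM; ring.
rewrite ler_wpM2r//.
have p1 : 0 <= 2 ^+ j.+1 + 2 ^+ j * x ^+ 2.
  by apply: addr_ge0; [exact: exprn_ge0|apply: mulr_ge0; [exact: exprn_ge0|exact: sqr_ge0]].
have p2 : 0 <= (s ^+ j.+1)^-1 by rewrite invr_ge0 exprn_ge0// ltW.
rewrite (ger0_norm p1) (ger0_norm p2).
have b n : (s ^+ n)^-1 <= 2 ^+ n.
  by rewrite -exprVn lerXn2r ?nnegrE ?invr_ge0 ?(ltW s0)// -[leRHS]invrK lef_pV2 ?posrE ?invr_gt0.
rewrite mulrDr mulr1 lerD// tx exprS invfM mulrACA mulVf ?gt_eqF// mul1r.
by rewrite ler_wpM2r ?sqr_ge0.
Qed.

(** Both values lie between Phi(tau) and 1. *)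
Lemma hq0_weight (tau s : K) : 0 <= tau -> 0 <= s -> s <= 1 ->
  `|Hf tau s - Phi tau| <= 2 / (1 + tau ^+ 2).
Proof.
move=> t0 s0 s1; have t1 : 0 < 1 + tau ^+ 2 by have := sqr_ge0 tau; lra.
rewrite ler_pdivlMr//; apply: le_trans (Phi_tail t0).
rewrite ler_wpM2r ?(ltW t1)//.
have h : Phi tau <= Hf tau s <= 1.
  rewrite /Hf; case: eqP => [_|/eqP sn]; first by rewrite t0 Phi_le1 lexx.
  rewrite Phi_le1 andbT; apply: Phi_le.
  have sp : 0 < Num.sqrt s by rewrite sqrtr_gt0 lt_def sn.
  rewrite ler_pdivlMr// ler_piMr// -[leRHS]sqrtr1 ler_sqrt//.
rewrite ger0_norm; lra.
Qed.

(** For s >= 1/2 this is Taylor's formula. For s < 1/2 the factor (s - 1)^4 is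
at least 1/16, so that it is enough to bound each term separately. *)
Lemma Hf_taylor : exists2 c : K, 0 <= c & forall tau s : K, 0 <= tau -> 0 <= s ->
  `|Hf tau s - Phi tau - hq tau 1 1 * (s - 1) - hq tau 2 1 / 2 * (s - 1) ^+ 2
    - hq tau 3 1 / 6 * (s - 1) ^+ 3| <= c / (1 + tau ^+ 2) * (s - 1) ^+ 4.
Proof.
have [c1 c10 h1] := hq_weight 0; have [c2 c20 h2] := hq_weight 1.
have [c3 c30 h3] := hq_weight 2; have [c4 c40 h4] := hq_weight 3.
have half1 : 2^-1 <= 1 :> K by lra.
exists (c4 + 16 * (2 + c1 + c2 + c3)); first by rewrite !(addr_ge0, mulr_ge0).
move=> tau s t0 s0.
have t1 : 0 < 1 + tau ^+ 2 by have := sqr_ge0 tau; lra.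
have q4 : 0 <= (s - 1) ^+ 4 by rewrite -[4%N]/(2 * 2)%N exprM sqr_ge0.
pose J := (1 + tau ^+ 2)^-1; have J0 : 0 <= J by rewrite invr_ge0 ltW.
have [s2|s2] := leP 2^-1 s.
  have pos (t : K) : 0 <= t <= 1 -> 2^-1 <= 1 + t * (s - 1).
    move=> /andP[a b]; have [s1|s1] := leP 1 s.
      by rewrite (le_trans half1)// lerDl mulr_ge0// subr_ge0.
    have : t * (1 - s) <= 1 - s by rewrite ler_piMl// subr_ge0 ltW.
    lra.
  have sp : 0 < s by lra.
  have := hq_taylor sp (fun t t01 => h4 tau _ (pos t t01)).
  rewrite -/J -normrX (ger0_norm q4).
  have q01 : hq tau 0 1 = Phi tau by rewrite /hq sqrtr1 divr1.
  have q0s : hq tau 0 s = Hf tau s by rewrite /hq /Hf gt_eqF.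
  rewrite q0s !big_ord_recr big_ord0 /= q01.
  move: (hq tau 1 1) (hq tau 2 1) (hq tau 3 1) => a1 a2 a3.
  rewrite (_ : 0`! = 1%N)// (_ : 1`! = 1%N)// (_ : 2`! = 2%N)// (_ : 3`! = 6%N)// (_ : 4`! = 24%N)//.
  move=> h; rewrite [X in `|X|](_ : _ = Hf tau s - (0 + (s - 1) ^+ 0 * Phi tau / 1%:R +
     (s - 1) ^+ 1 * a1 / 1%:R + (s - 1) ^+ 2 * a2 / 2%:R +
     (s - 1) ^+ 3 * a3 / 6%:R)); last by field.
  apply: (le_trans h); rewrite -/J.
  have x1 : 0 <= J * (s - 1) ^+ 4 * c4 by apply: mulr_ge0 => //; exact: mulr_ge0.
  have C0 : 0 <= 2 + c1 + c2 + c3 by rewrite !addr_ge0.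
  have x2 : 0 <= J * (s - 1) ^+ 4 * (2 + c1 + c2 + c3).
    by apply: mulr_ge0 => //; exact: mulr_ge0.
  move: x1 x2; move: ((s - 1) ^+ 4) (2 + c1 + c2 + c3) => Q C x1 x2; lra.
have s1 : s <= 1 by lra.
have a1 : `|s - 1| <= 1 by rewrite ler_norml; lra.
have b0 := hq0_weight t0 s0 s1.
have b1 := h1 tau 1 half1; have b2 := h2 tau 1 half1; have b3 := h3 tau 1 half1.
rewrite -/J in b0 b1 b2 b3 *.
have e m (h c : K) : 0 <= c -> `|h| <= c * J -> `|h * (s - 1) ^+ m| <= c * J.
  move=> c0 hh; rewrite normrM normrX (le_trans _ hh)// ler_piMr//.
  by rewrite exprn_ile1.
have q16 : 16^-1 <= (s - 1) ^+ 4.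
  have -> : (s - 1) ^+ 4 = ((1 - s) ^+ 2) ^+ 2 by ring.
  have : 4^-1 <= (1 - s) ^+ 2.
    have -> : 4^-1 = (2^-1) ^+ 2 :> K by field.
    by rewrite lerXn2r ?nnegrE; lra.
  move=> h; have -> : 16^-1 = (4^-1) ^+ 2 :> K by field.
  by rewrite lerXn2r ?nnegrE ?sqr_ge0; lra.
have B1 := e 1%N _ _ c10 b1; rewrite expr1 in B1.
have B2 := e 2%N (hq tau 2 1 / 2) c2 c20; have B3 := e 3%N (hq tau 3 1 / 6) c3 c30.
have {}B2 : `|hq tau 2 1 / 2 * (s - 1) ^+ 2| <= c2 * J.
  apply: B2; rewrite normrM (ger0_norm (_ : 0 <= 2^-1)) ?invr_ge0//.
  by have := normr_ge0 (hq tau 2 1); lra.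
have {}B3 : `|hq tau 3 1 / 6 * (s - 1) ^+ 3| <= c3 * J.
  apply: B3; rewrite normrM (ger0_norm (_ : 0 <= 6^-1)) ?invr_ge0//.
  by have := normr_ge0 (hq tau 3 1); lra.
apply: (le_trans (ler_normB _ _)); apply: (le_trans (lerD (ler_normB _ _) (lexx _))).
apply: (le_trans (lerD (lerD (ler_normB _ _) (lexx _)) (lexx _))).
apply: (@le_trans _ _ ((2 + c1 + c2 + c3) * J)); first by lra.
have : 0 <= J * (2 + c1 + c2 + c3) by rewrite mulr_ge0// !addr_ge0.
move: ((2 + c1 + c2 + c3)) => C; move=> CJ.
have x1 : 0 <= c4 * J * (s - 1) ^+ 4 by apply: mulr_ge0 => //; exact: mulr_ge0.
have x2 := ler_wpM2l CJ q16.
move: x1 x2; move: ((s - 1) ^+ 4) => Q x1 x2; lra.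
Qed.

End variance_expansion.
Arguments hq : simpl never.

(** * The effective variance *)

Section scalar.
Context (K : realType).
Notation vec n := (n.-tuple (measurableTypeR K)).

Lemma hq1_at1 (tau : K) : hq tau 1 1 = - (tau * gphi tau) / 2.
Proof.
rewrite /hq sqrtr1 divr1 /= hornerN hornerZ hornerX expr1 invr1; ring.
Qed.

Lemma hq2_at (tau s : K) (x := tau / Num.sqrt s) :
  hq tau 2 s = (s ^+ 2)^-1 * (x * (3 - x ^+ 2) / 4 * gphi x).
Proof.
rewrite /hq -/x /= !(hornerD, hornerN, hornerZ, hornerM, hornerX, hornerC, derivN, derivZ, derivX).
by congr (_ * (_ * _)); field.
Qed.

Lemma sqn_cent d (x : vec d) : (0 < d)%N -> sqn x - 1 = d%:R^-1 * centsum x.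
Proof.
move=> d0; rewrite /sqn /centsum sumrB big_const_ord iter_addr_0 mulrBr.
by rewrite mulVf ?pnatr_eq0 -?lt0n.
Qed.

Lemma gint_sqn d j : (0 < d)%N -> gint (fun x : vec d => (sqn x - 1) ^+ j) /\
  gaussE (fun x : vec d => (sqn x - 1) ^+ j) = d%:R^-1 ^+ j * Mom K d j.
Proof.
move=> d0.
have e : (fun x : vec d => (sqn x - 1) ^+ j) = (fun x => d%:R^-1 ^+ j * centsum x ^+ j).
  by apply/funext => x; rewrite sqn_cent// exprMn.
split; last by rewrite e /gaussE RintegralZl//; exact: gint_centsum.
rewrite e; have := integrableZl measurableT (d%:R^-1 ^+ j) (@gint_centsum K d j).
by apply: eq_integrable => // x _ /=; rewrite EFinM.
Qed.

(** Take the mean of the Taylor expansion: the linear term has mean zero, the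
quadratic one gives the term in 1/d, and the others are O(1/d^2) by the moments
of a chi-square variable. *)
Lemma mean_expansion : exists2 c : K, 0 <= c & forall d (tau p : K),
  (0 < d)%N -> 0 <= tau -> p = gaussE (fun x : vec d => Hf tau (sqn x)) ->
  measurable_fun [set: vec d] (fun x : vec d => Hf tau (sqn x)) ->
  `|p - Phi tau - hq tau 2 1 / 2 * cmom K 2 / d%:R| <= c / (1 + tau ^+ 2) / d%:R ^+ 2.
Proof.
have [c c0 hc] := Hf_taylor K; have [c3 c30 h3] := @hq_weight K 2.
pose Q := 6 * cmom K 2 ^+ 2 + `|cmom K 4|.
have Q0 : 0 <= Q by apply: addr_ge0 => //; apply: mulr_ge0 => //; exact: sqr_ge0.
exists (c * Q + c3 * `|cmom K 3|); first by apply: addr_ge0; apply: mulr_ge0.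
move=> d tau p d0 t0 pE mH.
have J0 : 0 < (1 + tau ^+ 2)^-1 by rewrite invr_gt0; have := sqr_ge0 tau; lra.
have dp : 0 < d%:R :> K by rewrite ltr0n.
have gH : gint (fun x : vec d => Hf tau (sqn x)) := gint_bounded mH (fun x => Hf_norm_le _ _).
have g1 := gint_sqn 1 d0; have g2 := gint_sqn 2 d0.
have g3 := gint_sqn 3 d0; have g4 := gint_sqn 4 d0.
rewrite Mom_1 mulr0 in g1; rewrite Mom_2 in g2; rewrite Mom_3 in g3.
have gc (k : K) : gint (fun _ : vec d => k) by apply: (@gint_bounded _ _ _ `|k|).
have gZ (k : K) (f : vec d -> K) : gint f -> gint (fun x => k * f x).
  move=> gf; have := integrableZl measurableT k gf.
  by apply: eq_integrable => // x _ /=; rewrite EFinM.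
have gB (f g : vec d -> K) : gint f -> gint g -> gint (fun x => f x - g x).
  move=> gf gg; have := integrableB measurableT gf gg.
  by apply: eq_integrable => // x _ /=; rewrite EFinB.
pose a1 := hq tau 1 1; pose a2 := hq tau 2 1 / 2; pose a3 := hq tau 3 1 / 6.
have gg1 := gB _ _ gH (gc (Phi tau)).
have gg2 := gB _ _ gg1 (gZ a1 _ g1.1).
have gg3 := gB _ _ gg2 (gZ a2 _ g2.1).
have gg4 := gB _ _ gg3 (gZ a3 _ g3.1).
have E4 : gaussE (fun x : vec d => Hf tau (sqn x) - Phi tau - a1 * (sqn x - 1) ^+ 1
    - a2 * (sqn x - 1) ^+ 2 - a3 * (sqn x - 1) ^+ 3)
   = p - Phi tau - a2 * (d%:R^-1 * cmom K 2) - a3 * (d%:R^-1 ^+ 2 * cmom K 3).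
  have eB (f g : vec d -> K) : gint f -> gint g -> gaussE (fun x => f x - g x) = gaussE f - gaussE g.
    by move=> gf gg; rewrite /gaussE RintegralB.
  have eZ (k : K) (f : vec d -> K) : gint f -> gaussE (fun x => k * f x) = k * gaussE f.
    by move=> gf; rewrite /gaussE RintegralZl.
  rewrite (eB _ _ gg3 (gZ a3 _ g3.1)) (eB _ _ gg2 (gZ a2 _ g2.1)).
  rewrite (eB _ _ gg1 (gZ a1 _ g1.1)) (eB _ _ gH (gc _)).
  rewrite (eZ _ _ g1.1) (eZ _ _ g2.1) (eZ _ _ g3.1) g1.2 g2.2 g3.2 -pE.
  rewrite /gaussE Rintegral_cstT.
  by field; rewrite gt_eqF.
have B4 := le_normr_Rintegral measurableT gg4.
rewrite -/(gaussE _) E4 in B4.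
have B5 : \int[gaussian K d]_x `|Hf tau (sqn x) - Phi tau - a1 * (sqn x - 1) ^+ 1
    - a2 * (sqn x - 1) ^+ 2 - a3 * (sqn x - 1) ^+ 3| <=
   gaussE (fun x : vec d => c / (1 + tau ^+ 2) * (sqn x - 1) ^+ 4).
  apply: le_Rintegral => //.
  - by have := integrable_abse gg4; apply: eq_integrable => // x _ /=.
  - exact: (gZ _ _ g4.1).
  - by move=> x _; rewrite expr1; apply: hc => //; exact: sqn_ge0.
have B6 : gaussE (fun x : vec d => c / (1 + tau ^+ 2) * (sqn x - 1) ^+ 4) <=
    c / (1 + tau ^+ 2) * (d%:R^-1 ^+ 2 * Q).
  rewrite /gaussE RintegralZl//; last exact: g4.1.
  rewrite ler_wpM2l ?mulr_ge0 ?(ltW J0)// -/(gaussE _) g4.2.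
  apply: le_trans (ler_wpM2l _ (Mom_4 K d)) _; first by rewrite exprn_ge0// invr_ge0 ltW.
  rewrite -/Q le_eqVlt; apply/orP; left; apply/eqP.
  by field; rewrite gt_eqF.
have B7 : `|a3| <= c3 / (1 + tau ^+ 2).
  have -> : `|a3| = `|hq tau 3 1| / 6 by rewrite [LHS]normrM (ger0_norm (_ : 0 <= 6^-1)) ?invr_ge0.
  have h : 2^-1 <= 1 :> K by lra.
  have := normr_ge0 (hq tau 3 1); have := h3 tau 1 h; lra.
have B8 : `|a3 * (d%:R^-1 ^+ 2 * cmom K 3)| <= c3 / (1 + tau ^+ 2) * (d%:R^-1 ^+ 2 * `|cmom K 3|).
  have d2 : 0 <= d%:R^-1 ^+ 2 :> K by rewrite exprn_ge0// invr_ge0 ltW.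
  by rewrite normrM ler_pM// normrM (ger0_norm d2).
have -> : p - Phi tau - hq tau 2 1 / 2 * cmom K 2 / d%:R =
  (p - Phi tau - a2 * (d%:R^-1 * cmom K 2) - a3 * (d%:R^-1 ^+ 2 * cmom K 3))
   + a3 * (d%:R^-1 ^+ 2 * cmom K 3).
  by rewrite subrK -/a2; congr (_ - _); rewrite -mulrA (mulrC d%:R^-1).
apply: (le_trans (ler_normD _ _)).
apply: (le_trans (lerD (le_trans B4 (le_trans B5 B6)) B8)).
by rewrite -exprVn le_eqVlt; apply/orP; left; apply/eqP; ring.
Qed.

End scalar.

Section scalar2.
Context (K : realType).
Notation vec n := (n.-tuple (measurableTypeR K)).

Lemma gphi_anti (x y : K) : x ^+ 2 <= y ^+ 2 -> gphi y <= gphi x.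
Proof.
move=> h; rewrite (gphiE y) (gphiE x) ler_wpM2l ?gphi_ge0// ler_expR; lra.
Qed.

(** As p = E H(S) with H decreasing and H >= 1/2, and as E S = 1, one has p -
1/2 >= (H(2) - 1/2)/2. So tau/sigma >= Phi(tau/sigma) - 1/2 = p - 1/2 is at
least a multiple of min(tau, 1), hence of tau / sqrt (1 + tau^2). *)
Lemma sigma2_le : exists2 c : K, 0 < c & forall d (tau p s : K),
  (0 < d)%N -> 0 < tau -> 0 < s -> p = gaussE (fun x : vec d => Hf tau (sqn x)) ->
  measurable_fun [set: vec d] (fun x : vec d => Hf tau (sqn x)) ->
  Phi (tau / s) = p -> s ^+ 2 <= c * (1 + tau ^+ 2).
Proof.
have g1 := gphi_gt0 (1 : K).
exists (8 / gphi 1 ^+ 2); first by rewrite divr_gt0// exprn_gt0.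
move=> d tau p s d0 t0 s0 pE mH ps.
have r2 : 0 < Num.sqrt 2 :> K by rewrite sqrtr_gt0.
pose B : K := Phi (tau / Num.sqrt 2) - 2^-1.
have tr : 0 <= tau / Num.sqrt 2 by rewrite divr_ge0 ?ltW.
have B0 : 0 <= B by rewrite /B -Phi0 subr_ge0 Phi_le.
(* H - 1/2 lies above the affine function that is B at 0 and 0 at 2. *)
have hpt (x : vec d) : B / 2 - B / 2 * (sqn x - 1) ^+ 1 <= Hf tau (sqn x) - 2^-1.
  have S0 := sqn_ge0 x; move: (sqn x) S0 => S S0; rewrite expr1.
  have H12 : 2^-1 <= Hf tau S.
    rewrite /Hf; case: eqP => [_|/eqP Sn]; first by rewrite (ltW t0) invf_le1 ?ler1n.
    by rewrite -Phi0 Phi_le// divr_ge0 ?(ltW t0)// sqrtr_ge0.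
  have [S2|S2] := leP S 2; last first.
    have : B * 2 <= B * S by rewrite ler_wpM2l// ltW.
    by move: (Hf tau S) (B) H12 => h b; lra.
  have : B <= Hf tau S - 2^-1.
    rewrite lerD2r /Hf; case: eqP => [_|/eqP Sn]; first by rewrite (ltW t0) Phi_le1.
    apply: Phi_le; rewrite ler_wpM2l ?(ltW t0)//.
    have Sp : 0 < Num.sqrt S by rewrite sqrtr_gt0 lt_def Sn.
    by rewrite lef_pV2 ?posrE// ler_sqrt.
  have : 0 <= B * S by rewrite mulr_ge0.
  by move: (Hf tau S) (B) => h b; lra.
have gc (k : K) : gint (fun _ : vec d => k) by apply: (@gint_bounded _ _ _ `|k|).
have gZ (k : K) (f : vec d -> K) : gint f -> gint (fun x => k * f x).
  move=> gf; have := integrableZl measurableT k gf.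
  by apply: eq_integrable => // x _ /=; rewrite EFinM.
have gB (f g : vec d -> K) : gint f -> gint g -> gint (fun x => f x - g x).
  move=> gf gg; have := integrableB measurableT gf gg.
  by apply: eq_integrable => // x _ /=; rewrite EFinB.
have gH : gint (fun x : vec d => Hf tau (sqn x)) := gint_bounded mH (fun x => Hf_norm_le _ _).
have g1' := gint_sqn K 1 d0; rewrite Mom_1 mulr0 in g1'.
have le1 : B / 2 <= p - 2^-1.
  have := le_Rintegral measurableT (gB _ _ (gc (B / 2)) (gZ (B / 2) _ g1'.1))
    (gB _ _ gH (gc 2^-1)) (fun x _ => hpt x).
  rewrite (RintegralB measurableT (gc _) (gZ (B / 2) _ g1'.1)) (RintegralB measurableT gH (gc _)).
  rewrite !Rintegral_cstT (RintegralZl _ measurableT g1'.1) -!/(gaussE _) g1'.2 -pE.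
  by rewrite mulr0 subr0.
have J0 : 0 < 1 + tau ^+ 2 by have := sqr_ge0 tau; lra.
pose rJ := Num.sqrt (1 + tau ^+ 2); have rJ0 : 0 < rJ by rewrite sqrtr_gt0.
have rJ2 : rJ ^+ 2 = 1 + tau ^+ 2 by rewrite sqr_sqrtr// ltW.
have rJ1 : 1 <= rJ by rewrite -sqrtr1; apply: ler_wsqrtr; rewrite lerDl sqr_ge0.
have tJ : tau <= rJ.
  by rewrite -(ger0_norm (ltW t0)) -sqrtr_sqr; apply: ler_wsqrtr; rewrite lerDr.
have r21 : 1 <= Num.sqrt 2 :> K by rewrite -[leLHS]sqrtr1; apply: ler_wsqrtr; lra.
have le2 : gphi 1 * (tau / rJ / Num.sqrt 2) <= B.
  have y0 : 0 <= tau / rJ / Num.sqrt 2 by rewrite !divr_ge0 ?ltW.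
  have y1 : tau / rJ / Num.sqrt 2 <= 1.
    by rewrite ler_pdivrMr// mul1r (le_trans _ r21)// ler_pdivrMr// mul1r.
  have yt : tau / rJ / Num.sqrt 2 <= tau / Num.sqrt 2.
    by rewrite ler_pM2r ?invr_gt0// ler_pdivrMr// ler_peMr// ltW.
  apply: (@le_trans _ _ (Phi (tau / rJ / Num.sqrt 2) - Phi 0)); last first.
    by rewrite /B Phi0 lerD2r Phi_le.
  have [c /andP[c0 cy] ->] := Phi_MVT y0.
  rewrite subr0 ler_wpM2r// gphi_anti// lerXn2r ?nnegrE//.
  exact: le_trans cy y1.
have le3 : p - 2^-1 <= tau / s.
  have ts : 0 <= tau / s by rewrite divr_ge0 ?ltW.
  rewrite -ps -Phi0; have [c _ ->] := Phi_MVT ts.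
  by rewrite subr0 ler_piMl// (le_trans (gphi_le0 _))// gphi0_le1.
have le4 : gphi 1 * s <= 2 * Num.sqrt 2 * rJ.
  have : gphi 1 * (tau / rJ / Num.sqrt 2) / 2 <= tau / s.
    by apply: le_trans _ (le_trans le1 le3); rewrite ler_wpM2r ?invr_ge0.
  rewrite ler_pdivlMr// => h.
  have e : gphi 1 * (tau / rJ / Num.sqrt 2) / 2 * s =
    tau * (gphi 1 * s) / (2 * Num.sqrt 2 * rJ).
    by field; rewrite !gt_eqF.
  move: h; rewrite e ler_pdivrMr ?mulr_gt0// ler_pM2l//.
have : (gphi 1 * s) ^+ 2 <= (2 * Num.sqrt 2 * rJ) ^+ 2.
  have a1 : 0 <= gphi 1 * s by apply: mulr_ge0; exact: ltW.
  have a2 : 0 <= 2 * Num.sqrt 2 * rJ by apply: mulr_ge0; [exact: mulr_ge0 _ (ltW r2)|exact: ltW].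
  by rewrite lerXn2r ?nnegrE.
rewrite !exprMn rJ2 sqr_sqrtr// => h.
by rewrite mulrAC ler_pdivlMr ?exprn_gt0// mulrC; lra.
Qed.

End scalar2.

Section inverse.
Context (K : realType).

(** The exponents differ by tau^2 (s - 1)/(2 s). *)
Lemma gphi_near (tau s : K) : 2^-1 <= s -> (s - 1) * tau ^+ 2 <= 1 ->
  gphi (tau / Num.sqrt s) <= 4 * gphi tau.
Proof.
move=> s2 h; have s0 : 0 < s by lra.
have x2 : (tau / Num.sqrt s) ^+ 2 = tau ^+ 2 / s.
  by rewrite exprMn exprVn (sqr_sqrtr (ltW s0)).
rewrite (gphiE (_ / _)) (gphiE tau) x2.
have -> : - (tau ^+ 2 / s / 2) = - (tau ^+ 2 / 2) + (s - 1) * tau ^+ 2 / (2 * s).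
  by field; rewrite gt_eqF.
rewrite expRD mulrA [leRHS]mulrC ler_wpM2l//.
  by rewrite mulr_ge0 ?gphi_ge0 ?expR_ge0.
have : expR ((s - 1) * tau ^+ 2 / (2 * s)) <= expR (1 : K).
  by rewrite ler_expR ler_pdivrMr ?mulr_gt0//; lra.
move=> /le_trans; apply.
have := expR_ge1Dx (- 2^-1 : K); rewrite expRN => h2.
have e2 : expR (1 : K) = expR 2^-1 * expR 2^-1 by rewrite -expRD; congr expR; field.
have ep := expR_gt0 (2^-1 : K); rewrite e2; move: (expR 2^-1) ep h2 => E E0 h2.
have E2 : E <= 2.
  have : 2^-1 <= E^-1 by lra.
  by rewrite lef_pV2 ?posrE.
have -> : 4 = 2 * 2 :> K by ring.
by rewrite ler_pM// ltW.
Qed.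

Lemma hq2_near (tau s : K) : 0 <= tau -> 2^-1 <= s -> (s - 1) * tau ^+ 2 <= 1 ->
  `|hq tau 2 s| <= 24 * (1 + tau ^+ 2) * (tau * gphi tau).
Proof.
move=> t0 s2 h; rewrite hq2_at; set x := tau / Num.sqrt s.
have s0 : 0 < s by lra.
have g := gphi_near s2 h; rewrite -/x in g.
have x0 : 0 <= x by rewrite /x mulr_ge0// invr_ge0 sqrtr_ge0.
have si : s^-1 <= 2 by rewrite -[leRHS]invrK lef_pV2 ?posrE ?invr_gt0.
have x2 : x ^+ 2 <= 2 * tau ^+ 2.
  by rewrite /x exprMn exprVn (sqr_sqrtr (ltW s0)) mulrC ler_wpM2r ?sqr_ge0.
have xt : x <= 2 * tau.
  rewrite -(@ler_pXn2r _ 2)// ?nnegrE ?mulr_ge0//.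
  by apply: (le_trans x2); rewrite exprMn; have := sqr_ge0 tau; lra.
have s4 : (s ^+ 2)^-1 <= 4.
  have -> : 4 = 2 ^+ 2 :> K by ring.
  by rewrite -exprVn lerXn2r ?nnegrE// invr_ge0 ltW.
have si0 : 0 <= (s ^+ 2)^-1 by rewrite invr_ge0 exprn_ge0// ltW.
rewrite normrM (ger0_norm si0) normrM (ger0_norm (gphi_ge0 x)).
have p1 : `|x * (3 - x ^+ 2) / 4| <= 2 * tau * (3 * (1 + tau ^+ 2)) / 4.
  rewrite normrM [`|4^-1|]ger0_norm ?invr_ge0// ler_wpM2r ?invr_ge0//.
  rewrite normrM (ger0_norm x0) ler_pM//.
  by have := sqr_ge0 x; have := sqr_ge0 tau; move: (x ^+ 2) (tau ^+ 2) x2 => a b x2 b0 a0; rewrite ler_norml; lra.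
have := ler_pM si0 (mulr_ge0 (normr_ge0 _) (gphi_ge0 x)) s4 (ler_pM (normr_ge0 _) (gphi_ge0 x) p1 g).
move=> /le_trans; apply; rewrite le_eqVlt; apply/orP; left; apply/eqP; by field.
Qed.

(** The width 1 / (1 + tau^2) is the scale in s on which Phi(tau / sqrt s) is
essentially linear near s = 1. *)
Definition jap (tau : K) : K := 1 + tau ^+ 2.
(** Twice the absolute value of the derivative of s |-> Phi(tau / sqrt s) at 1.
*)
Definition slope (tau : K) : K := tau * gphi tau.
Definition gap (tau v : K) : K := `|hq tau 0 v - Phi tau|.
Definition gap2 (tau v : K) : K := `|hq tau 0 v - Phi tau + slope tau * (v - 1) / 2|.

Lemma J_ge1 tau : 1 <= jap tau. Proof. by rewrite lerDl sqr_ge0. Qed.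

Lemma hq01 (tau : K) : hq tau 0 1 = Phi tau.
Proof. by rewrite /hq sqrtr1 divr1. Qed.

Lemma near_quadratic tau v : 0 <= tau -> `|v - 1| * (96 * jap tau) <= 1 ->
  gap2 tau v <= 12 * jap tau * slope tau * (v - 1) ^+ 2.
Proof.
move=> t0 h; have J1 := J_ge1 tau.
have v1 : `|v - 1| <= 96^-1.
  rewrite -[leRHS]mul1r ler_pdivlMr//; apply: le_trans h.
  by rewrite ler_wpM2l// ler_peMr.
have vt : `|v - 1| * tau ^+ 2 <= 1.
  apply: le_trans h; rewrite ler_wpM2l// /jap; have := sqr_ge0 tau; lra.
have v0 : 0 < v by move: v1; rewrite ler_norml; lra.
have H2 (t : K) : 0 <= t <= 1 -> `|hq tau 2 (1 + t * (v - 1))| <= 24 * jap tau * slope tau.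
  move=> /andP[ta tb].
  have tv : `|t * (v - 1)| <= `|v - 1| by rewrite normrM (ger0_norm ta) ler_piMl.
  apply: hq2_near => //.
    by have := le_trans tv v1; rewrite ler_norml; lra.
  rewrite (addrC 1) addrK; apply: le_trans vt; rewrite ler_wpM2r ?sqr_ge0//.
  exact: le_trans (ler_norm _) tv.
have := hq_taylor v0 H2; rewrite !big_ord_recr big_ord0 /= hq01 hq1_at1 -/(slope tau).
rewrite -normrX (ger0_norm (sqr_ge0 _)) /gap2.
rewrite (_ : 0`! = 1%N)// (_ : 1`! = 1%N)// (_ : 2`! = 2%N)//.
have -> : hq tau 0 v - (0 + (v - 1) ^+ 0 * Phi tau / 1%:R +
  (v - 1) ^+ 1 * (- slope tau / 2) / 1%:R) = hq tau 0 v - Phi tau + slope tau * (v - 1) / 2.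
  by field.
move: (hq tau 0 v) => H; rewrite (_ : 24 * jap tau * slope tau * (v - 1) ^+ 2 / 2%:R = 12 * jap tau * slope tau * (v - 1) ^+ 2)//.
by field.
Qed.

(** At distance at most 1/(96 (1 + tau^2)) from 1 the quadratic error is at most
a quarter of the linear term slope tau * |v - 1| / 2. *)
Lemma near_bounds tau v : 0 < tau -> `|v - 1| * (96 * jap tau) <= 1 ->
  slope tau * `|v - 1| <= 4 * gap tau v /\ gap2 tau v <= gap tau v.
Proof.
move=> t0 h; have nq := near_quadratic (ltW t0) h.
have m0 : 0 <= slope tau by rewrite mulr_ge0 ?gphi_ge0 ?ltW.
have q : gap2 tau v <= slope tau * `|v - 1| / 8.
  apply: (le_trans nq); rewrite -(ger0_norm (sqr_ge0 (v - 1))) normrX.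
  have := ler_wpM2l (mulr_ge0 m0 (normr_ge0 (v - 1))) h.
  move: (slope tau) (`|v - 1|) (jap tau) => a b j; lra.
have t : slope tau * `|v - 1| / 2 <= gap2 tau v + gap tau v.
  have -> : slope tau * `|v - 1| / 2 = `|slope tau * (v - 1) / 2|.
    by rewrite normrM [`|slope tau * _|]normrM (ger0_norm m0) (ger0_norm (_ : 0 <= 2^-1)) ?invr_ge0.
  rewrite /gap2 /gap.
  have e : slope tau * (v - 1) / 2 = (hq tau 0 v - Phi tau + slope tau * (v - 1) / 2) - (hq tau 0 v - Phi tau).
    by rewrite addrAC subrr add0r.
  rewrite {1}e; exact: ler_normB.
have M0 : 0 <= gap tau v by exact: normr_ge0.
by move: (gap2 tau v) (gap tau v) (slope tau * `|v - 1|) M0 q t => n mm b; split; lra.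
Qed.

(** Near 1, use near_bounds. Far from 1, the function being monotone, the gap is
at least its value at the end of the interval where near_bounds applies, so that
slope tau = O(jap tau * gap); moreover slope tau * (v - 1) <= 2 v gap for v >= 1
by the mean value theorem. *)
Lemma inverse_bounds (c : K) : 0 <= c -> exists2 C : K, 0 <= C & forall tau v : K,
  0 < tau -> 0 < v -> v <= c * jap tau ->
  gap2 tau v <= C * jap tau * gap tau v /\ gap2 tau v * slope tau <= C * jap tau ^+ 2 * gap tau v ^+ 2.
Proof.
move=> c0; exists (400 * (200 + c)); first by lra.
move=> tau v t0 v0 vc; have J1 := J_ge1 tau.
have m0 : 0 <= slope tau by rewrite mulr_ge0 ?gphi_ge0 ?ltW.
have M0 : 0 <= gap tau v by exact: normr_ge0.
have N0 : 0 <= gap2 tau v by exact: normr_ge0.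
have JM : gap tau v <= jap tau * gap tau v by rewrite ler_peMl.
have J2 : jap tau <= jap tau ^+ 2 by rewrite expr2 ler_peMl// (le_trans ler01).
have [h|h] := leP (`|v - 1| * (96 * jap tau)) 1.
  have [n1 n2] := near_bounds t0 h; split.
    have : 0 <= c * (jap tau * gap tau v) by rewrite mulr_ge0// (le_trans M0).
    by move: (gap2 tau v) (gap tau v) (jap tau) n1 n2 JM M0 => n mm j; lra.
  have := ler_wpM2r m0 (near_quadratic (ltW t0) h).
  move=> /le_trans; apply.
  have s : (slope tau * `|v - 1|) ^+ 2 <= (4 * gap tau v) ^+ 2.
    by rewrite lerXn2r ?nnegrE//; apply: mulr_ge0.
  have {}s : slope tau ^+ 2 * (v - 1) ^+ 2 <= 4 ^+ 2 * gap tau v ^+ 2.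
    by move: s; move: (slope tau) => a; rewrite !exprMn -normrX (ger0_norm (sqr_ge0 _)).
  have J0 : 0 <= jap tau by exact: le_trans J1.
  have := ler_wpM2l J0 s.
  have JJ := ler_wpM2r (sqr_ge0 (gap tau v)) J2.
  have : 0 <= c * (jap tau ^+ 2 * gap tau v ^+ 2) by rewrite mulr_ge0// mulr_ge0 ?sqr_ge0.
  have : 0 <= jap tau ^+ 2 * gap tau v ^+ 2 by rewrite mulr_ge0 ?sqr_ge0.
  move: JJ; rewrite !expr2; move: (v - 1) (slope tau) (gap tau v) (jap tau) => w a b j; lra.
have Jp : 0 < 96 * jap tau by rewrite mulr_gt0// (lt_le_trans ltr01).
pose dl := (96 * jap tau)^-1; have dl0 : 0 < dl by rewrite invr_gt0.
have dle : `|dl| * (96 * jap tau) <= 1 by rewrite gtr0_norm// mulVf// gt_eqF.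
have dlt : dl < `|v - 1| by rewrite -[dl]mul1r ltr_pdivrMr.
have dl1 : dl < 1 by rewrite invf_lt1//; lra.
have Hle (a b : K) : 0 < a -> a <= b -> hq tau 0 b <= hq tau 0 a.
  move=> a0 ab; apply: Phi_le; rewrite ler_wpM2l ?(ltW t0)//.
  by rewrite lef_pV2 ?posrE ?sqrtr_gt0 ?(lt_le_trans a0)//; apply: ler_wsqrtr.
(* At the radius 1/(96 J) of the linear regime the gap is already of order m/J. *)
have mM : slope tau <= 384 * (jap tau * gap tau v).
  suff : slope tau * dl <= 4 * gap tau v.
    by rewrite /dl ler_pdivrMr//; lra.
  have [v1|v1] := leP 1 v.
    have d1 : `|(1 + dl) - 1| * (96 * jap tau) <= 1 by rewrite (addrC 1) addrK.
    have [+ _] := near_bounds t0 d1; rewrite [1 + dl - 1]addrAC subrr add0r (gtr0_norm dl0).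
    move=> /le_trans; apply; rewrite ler_wpM2l//.
    have vd : 1 + dl <= v by move: dlt; rewrite ger0_norm ?subr_ge0//; lra.
    have p1 : 0 < 1 + dl by rewrite addr_gt0.
    have p2 : 1 <= 1 + dl by rewrite lerDl ltW.
    have a1 := Hle 1 (1 + dl) ltr01 p2; have a2 := Hle (1 + dl) v p1 vd; rewrite hq01 in a1.
    have a3 := le_trans a2 a1; rewrite -subr_le0 in a1; rewrite -subr_le0 in a3.
    by rewrite /gap (ler0_norm a1) (ler0_norm a3) lerN2 lerD2r.
  have d1 : `|(1 - dl) - 1| * (96 * jap tau) <= 1 by rewrite addrAC subrr add0r normrN.
  have [+ _] := near_bounds t0 d1; rewrite [1 - dl - 1]addrAC subrr add0r normrN (gtr0_norm dl0).
  move=> /le_trans; apply; rewrite ler_wpM2l//.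
  have vd : v <= 1 - dl by move: dlt; rewrite ltr0_norm ?subr_lt0//; lra.
  have p2 : 1 - dl <= 1 by rewrite gerBl ltW.
  have p1 : 0 < 1 - dl by rewrite subr_gt0.
  have a1 := Hle (1 - dl) 1 p1 p2; have a2 := Hle v (1 - dl) v0 vd; rewrite hq01 in a1.
  have a3 := le_trans a1 a2; rewrite -subr_ge0 in a1; rewrite -subr_ge0 in a3.
  by rewrite /gap (ger0_norm a1) (ger0_norm a3) lerD2r.
have mv : slope tau * `|v - 1| <= (384 + 2 * c) * (jap tau * gap tau v).
  have cJM : 0 <= c * (jap tau * gap tau v) by rewrite mulr_ge0// (le_trans M0).
  have [v1|v1] := leP 1 v; last first.
    have : slope tau * `|v - 1| <= slope tau by rewrite ler_piMr// ltr0_norm ?subr_lt0//; lra.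
    by move: (slope tau * `|v - 1|) (jap tau * gap tau v) mM cJM => a b; lra.
  have r1 : 1 <= Num.sqrt v by rewrite -[leLHS]sqrtr1; apply: ler_wsqrtr.
  have rv := sqr_sqrtr (ltW v0).
  have tle : tau / Num.sqrt v <= tau by rewrite ler_pdivrMr ?(lt_le_trans ltr01)// ler_peMr// ltW.
  have key : slope tau * (1 - (Num.sqrt v)^-1) <= gap tau v.
    have [e /andP[e1 e2] eE] := Phi_MVT tle.
    rewrite /gap distrC (le_trans _ (ler_norm _))// /hq eE.
    have -> : slope tau * (1 - (Num.sqrt v)^-1) = gphi tau * (tau - tau / Num.sqrt v) by rewrite /slope; ring.
    rewrite ler_wpM2r ?subr_ge0// gphi_anti// lerXn2r ?nnegrE// ?(ltW t0)//.
    by apply: le_trans e1; rewrite mulr_ge0 ?invr_ge0 ?sqrtr_ge0// ltW.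
  have : slope tau * (v - 1) <= 2 * v * gap tau v.
    have := ler_wpM2l (_ : 0 <= 2 * v) key => /(_ (mulr_ge0 (ler0n _ _) (ltW v0))).
    apply: le_trans; move: (Num.sqrt v) r1 rv => r r1 <-.
    have -> : 2 * r ^+ 2 * (slope tau * (1 - r^-1)) = slope tau * (2 * r * (r - 1)).
      by field; rewrite gt_eqF// (lt_le_trans ltr01).
    rewrite ler_wpM2l// -subr_ge0.
    have -> : 2 * r * (r - 1) - (r ^+ 2 - 1) = (r - 1) ^+ 2 by ring.
    exact: sqr_ge0.
  rewrite ger0_norm ?subr_ge0//; move=> /le_trans; apply.
  have := ler_wpM2r M0 vc; move: (jap tau) (gap tau v) JM M0 => a b; lra.
have NM : gap2 tau v <= (200 + c) * (jap tau * gap tau v).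
  have : gap2 tau v <= gap tau v + slope tau * `|v - 1| / 2.
    apply: (le_trans (ler_normD _ _)); rewrite lerD2l normrM [`|slope tau * _|]normrM (ger0_norm m0).
    by rewrite (ger0_norm (_ : 0 <= 2^-1)) ?invr_ge0.
  have a0 := le_trans M0 JM.
  by move: (jap tau * gap tau v) (gap2 tau v) (gap tau v) (slope tau * `|v - 1|) mv JM a0 => a b e f; lra.
split.
  rewrite -[_ * jap tau * _]mulrA; apply: (le_trans NM).
  have : 0 <= (200 + c) * (jap tau * gap tau v) by exact: le_trans NM.
  by move: (jap tau * gap tau v) (200 + c) => a b; lra.
have := ler_pM N0 m0 NM mM => /le_trans; apply.
have : 0 <= (200 + c) * (jap tau ^+ 2 * gap tau v ^+ 2).
  by apply: mulr_ge0; [exact: addr_ge0 (ler0n _ _) c0|apply: mulr_ge0; exact: sqr_ge0].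
rewrite !expr2; move: (jap tau) (gap tau v) => a b; lra.
Qed.

End inverse.

Section threshold_bounds.
Context (K : realType).
Notation vec n := (n.-tuple (measurableTypeR K)).

(** With J = 1 + tau^2 and m = tau phi(tau), the gap |p - Phi(tau)| is at most
|A|/d + c/(J d^2), where |A| = O(m J). If the second term dominates, use gap2 =
O(J gap); otherwise use gap2 = O(J^2 gap^2/m) = O(J^4 m/d^2), and J^4 m is
bounded. *)
Lemma threshold_bounds_pos : exists2 C : K, 0 <= C & forall d (tau p s : K),
  (0 < d)%N -> 0 < tau -> 0 < s -> p = gaussE (fun x : vec d => Hf tau (sqn x)) ->
  measurable_fun [set: vec d] (fun x : vec d => Hf tau (sqn x)) ->
  Phi (tau / s) = p ->
  gap tau (s ^+ 2) <= C / d%:R /\ gap2 tau (s ^+ 2) <= C / d%:R ^+ 2.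
Proof.
have [c1 c10 hE] := mean_expansion K; have [c2 c20 hs] := sigma2_le K.
have [c3 c30 hi] := inverse_bounds (ltW c20).
have [b1 b10 hb1] := poly_gphi_bounded ('X * (1 + 'X^2) : {poly K}).
have [b2 b20 hb2] := poly_gphi_bounded ('X * (1 + 'X^2) ^+ 4 : {poly K}).
pose a := `|cmom K 2|; have a0 : 0 <= a by exact: normr_ge0.
exists (a * b1 + c1 + 2 * c1 * c3 + 4 * c3 * a ^+ 2 * b2).
  by rewrite !addr_ge0// ?mulr_ge0// exprn_ge0.
move=> d tau p s d0 t0 s0 pE mH ps.
have J1 := J_ge1 tau; have J0 : 0 < jap tau by apply: lt_le_trans J1.
have dp : 0 < d%:R :> K by rewrite ltr0n.
have d1 : 1 <= d%:R :> K by rewrite ler1n.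
have s2 : 0 < s ^+ 2 by rewrite exprn_gt0.
have [i1 i1'] := hi tau (s ^+ 2) t0 s2 (hs d tau p s d0 t0 s0 pE mH ps).
have hp : hq tau 0 (s ^+ 2) = p by rewrite /hq sqrtr_sqr gtr0_norm.
have m0 : 0 < slope tau by rewrite mulr_gt0// gphi_gt0.
pose A := hq tau 2 1 / 2 * cmom K 2.
have AE : `|A| <= a * (jap tau * slope tau).
  rewrite /A normrM mulrC -/a ler_wpM2l// normrM (ger0_norm (_ : 0 <= 2^-1)) ?invr_ge0//.
  rewrite hq2_at sqrtr1 divr1 expr1n invr1 mul1r normrM (ger0_norm (gphi_ge0 _)).
  rewrite normrM (ger0_norm (_ : 0 <= 4^-1)) ?invr_ge0// normrM (ger0_norm (ltW t0)).
  have : `|3 - tau ^+ 2| <= 3 * jap tau.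
    by rewrite ler_norml /jap; have := sqr_ge0 tau; lra.
  move=> /(ler_wpM2l (ltW m0)); rewrite /slope.
  have : 0 <= jap tau * (tau * gphi tau) by rewrite mulr_ge0// ltW.
  move: (jap tau) (gphi tau) (`|_|) => j g n; lra.
have gE : gap tau (s ^+ 2) <= `|A| / d%:R + c1 / jap tau / d%:R ^+ 2.
  rewrite /gap hp; have := hE d tau p d0 (ltW t0) pE mH; rewrite -/A -/(jap tau) => h.
  have -> : p - Phi tau = A / d%:R + (p - Phi tau - A / d%:R) by rewrite [RHS]addrC subrK.
  have di : 0 <= d%:R^-1 :> K by rewrite invr_ge0 ltW.
  by apply: le_trans (ler_normD _ _) _; rewrite lerD// normrM (ger0_norm di).
have B1 : jap tau * slope tau <= b1.
  have e : ('X * (1 + 'X^2) : {poly K}).[tau] = tau * jap tau by rewrite !hornerE.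
  have := le_trans (ler_norm _) (hb1 tau); rewrite e.
  by apply: le_trans; rewrite le_eqVlt; apply/orP; left; apply/eqP; rewrite /slope; ring.
have B2 : slope tau * jap tau ^+ 4 <= b2.
  have e : ('X * (1 + 'X^2) ^+ 4 : {poly K}).[tau] = tau * jap tau ^+ 4.
    by rewrite hornerM horner_exp !hornerE.
  have := le_trans (ler_norm _) (hb2 tau); rewrite e.
  by apply: le_trans; rewrite le_eqVlt; apply/orP; left; apply/eqP; rewrite /slope; ring.
have cJ : c1 / jap tau <= c1 by rewrite ler_pdivrMr// ler_peMr.
have cJ0 : 0 <= c1 / jap tau by rewrite divr_ge0// ltW.
have q1 : 0 <= 2 * c1 * c3 by rewrite !mulr_ge0.
have q2 : 0 <= 4 * c3 * a ^+ 2 * b2 by rewrite !mulr_ge0// exprn_ge0.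
have q3 : 0 <= a * b1 by rewrite mulr_ge0.
have dd : d%:R <= d%:R ^+ 2 :> K by rewrite expr2 ler_peMl// ltW.
split.
  apply: (le_trans gE).
  apply: (@le_trans _ _ (a * b1 / d%:R + c1 / d%:R)).
    apply: lerD.
      rewrite ler_pM2r ?invr_gt0//; apply: le_trans AE _; rewrite ler_wpM2l//.
    have i2 : (d%:R ^+ 2)^-1 <= d%:R^-1 :> K by rewrite lef_pV2 ?posrE ?exprn_gt0.
    have i3 : 0 <= (d%:R ^+ 2)^-1 :> K by rewrite invr_ge0 exprn_ge0// ltW.
    exact: ler_pM cJ0 i3 cJ i2.
  rewrite -mulrDl ler_pM2r ?invr_gt0//; lra.
have g0 : 0 <= gap tau (s ^+ 2) by exact: normr_ge0.
have [A1|A1] := leP (`|A| / d%:R) (c1 / jap tau / d%:R ^+ 2).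
  have g1 : jap tau * gap tau (s ^+ 2) <= 2 * c1 / d%:R ^+ 2.
    have := ler_wpM2l (ltW J0) (le_trans gE (lerD A1 (lexx _))) => /le_trans; apply.
    rewrite le_eqVlt; apply/orP; left; apply/eqP; field.
    by rewrite !gt_eqF.
  apply: (le_trans i1); rewrite -mulrA; apply: le_trans (ler_wpM2l c30 g1) _.
  rewrite mulrA ler_pM2r ?invr_gt0 ?exprn_gt0//; lra.
have g1 : gap tau (s ^+ 2) <= 2 * (`|A| / d%:R).
  by move: (gap _ _) (`|A| / d%:R) (c1 / jap tau / d%:R ^+ 2) A1 gE => g x y; lra.
have {}g1 : gap tau (s ^+ 2) <= 2 * a * (jap tau * slope tau) / d%:R.
  apply: (le_trans g1); rewrite mulrA ler_pM2r ?invr_gt0// -mulrA ler_wpM2l//.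
have g2 : gap tau (s ^+ 2) ^+ 2 <= (2 * a * (jap tau * slope tau) / d%:R) ^+ 2.
  by rewrite lerXn2r ?nnegrE// (le_trans g0).
have J2 : 0 <= c3 * jap tau ^+ 2 by rewrite mulr_ge0// exprn_ge0// ltW.
have := le_trans i1' (ler_wpM2l J2 g2).
have -> : c3 * jap tau ^+ 2 * (2 * a * (jap tau * slope tau) / d%:R) ^+ 2 =
   (4 * c3 * a ^+ 2 * (slope tau * jap tau ^+ 4) / d%:R ^+ 2) * slope tau.
  by field; rewrite gt_eqF.
rewrite ler_pM2r// => /le_trans; apply.
rewrite ler_pM2r ?invr_gt0 ?exprn_gt0//.
apply: (@le_trans _ _ (4 * c3 * a ^+ 2 * b2)); last by lra.
by rewrite ler_wpM2l// !mulr_ge0// exprn_ge0.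
Qed.

(** This reduces negative thresholds to positive ones, p becoming 1 - p. *)
Lemma Hf_neg (tau s : K) : tau < 0 -> Hf (- tau) s = 1 - Hf tau s.
Proof.
move=> t0; rewrite /Hf; case: eqP => _; last by rewrite mulNr PhiN.
by rewrite oppr_ge0 (ltW t0) leNgt t0 subr0.
Qed.

Lemma sigma_hat_half (tau s : K) : is_sigma_hat 2^-1 tau s -> tau = 0.
Proof.
move=> [s0 h _]; move: h; rewrite normal_prob_Phi// => -[].
rewrite -(Phi0 K) => h; apply/eqP; apply: contraT => tn.
have := lt_total tn => /orP[t0|t0].
  have ts : tau / s <= 0 by rewrite pmulr_lle0 ?invr_gt0// ltW.
  have [c _] := Phi_MVT ts; rewrite h subrr sub0r => /esym/eqP.
  by rewrite mulf_eq0 gt_eqF ?gphi_gt0//= oppr_eq0 mulf_eq0 invr_eq0 (gt_eqF s0) orbF (negbTE tn).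
have ts : 0 <= tau / s by rewrite divr_ge0 ?ltW.
have [c _] := Phi_MVT ts; rewrite h subrr subr0 => /esym/eqP.
by rewrite mulf_eq0 gt_eqF ?gphi_gt0//= mulf_eq0 invr_eq0 (gt_eqF s0) orbF (negbTE tn).
Qed.

(** By symmetry it is enough to treat tau > 0; for tau = 0 both left-hand sides
vanish, since then p = Phi(0). *)
Lemma threshold_bounds : exists2 C : K, 0 <= C & forall d (p tau s : K),
  (0 < d)%N -> is_threshold d p tau -> is_sigma_hat p tau s ->
  `|Phi tau - p| <= C / d%:R /\
  `|Phi tau - p - (1 - s ^+ 2) / 2 * gd 1 tau| <= C / d%:R ^+ 2.
Proof.
have [C C0 hC] := threshold_bounds_pos; exists C => // d p tau s d0 ht hs.
have [s0 hP _] := hs; rewrite normal_prob_Phi// in hP; case: hP => hP.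
have [pE mH] := threshold_Hf d0 ht.
have hp t : Phi (t / s) = hq t 0 (s ^+ 2) by rewrite /hq sqrtr_sqr gtr0_norm.
have [t0|t0|t0] := ltgtP tau 0; last first.
- move: hP; rewrite t0 mul0r => <-; rewrite subrr normr0 /= mul0r oppr0 mulr0 subr0 normr0.
  by rewrite !divr_ge0// exprn_ge0.
- have [h1 h2] := hC d tau p s d0 t0 s0 pE mH hP; split.
    by move: h1; rewrite /gap -hp hP distrC.
  move: h2; rewrite /gap2 -hp hP -normrN; congr (`|_| <= _).
  by rewrite /slope /=; ring.
have t0' : 0 < - tau by rewrite oppr_gt0.
have HE : (fun x : vec d => Hf (- tau) (sqn x)) = (fun x => 1 - Hf tau (sqn x)).
  by apply/funext => x; rewrite Hf_neg.
have mH' : measurable_fun [set: vec d] (fun x : vec d => Hf (- tau) (sqn x)).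
  by rewrite HE; apply: measurable_funB.
have gH : gint (fun x : vec d => Hf tau (sqn x)) := gint_bounded mH (fun x => Hf_norm_le _ _).
have gc : gint (fun _ : vec d => 1 : K) by apply: (@gint_bounded _ _ _ 1) => // x; rewrite normr1.
have pE' : 1 - p = gaussE (fun x : vec d => Hf (- tau) (sqn x)).
  by rewrite HE [RHS](RintegralB measurableT gc gH) Rintegral_cstT pE.
have hP' : Phi (- tau / s) = 1 - p by rewrite mulNr PhiN hP.
have [h1 h2] := hC d (- tau) (1 - p) s d0 t0' s0 pE' mH' hP'; split.
  move: h1; rewrite /gap -hp hP' PhiN; congr (`|_| <= _); ring.
move: h2; rewrite /gap2 -hp hP' PhiN; congr (`|_| <= _).
by rewrite /slope gphiN /=; ring.
Qed.

End threshold_bounds.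

(** * The main term as a weighted sum over pairs *)

Section star_weights.
Context (K : realType) (R : finType) (alpha : {set R}) (tau p : K).

(** The number of elements of alpha left uncovered. *)
Definition zeros (s : R -> nat) : nat := #|[set e in alpha | s e == 0%N]|%SET.

(** The weight of a sequence of pairs in the expansion, with the value x at the
uncovered elements: x = Phi tau - p is the expansion itself (base_weight_wt) and
x = 0 selects the sequences whose support is alpha. *)
Definition wt (x : K) (s : R -> nat) : K :=
  \prod_(e in alpha) (if s e == 0%N then x else Fs 1 tau p (s e) 0).

Lemma base_weight_wt : base_weight alpha tau p = wt (Phi tau - p).
Proof.
apply/funext => s; apply: eq_bigr => e _; case: eqP => // ->.
by rewrite /Fs mul1r subr0.
Qed.

Lemma wt_split x s : wt x s = x ^+ zeros s *
  \prod_(e in alpha | s e != 0%N) Fs 1 tau p (s e) 0.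
Proof.
rewrite /wt (bigID (fun e => s e == 0%N)) /=; congr (_ * _).
  rewrite (eq_bigr (fun=> x)); last by move=> e /andP[_ ->].
  rewrite /zeros -prodr_const; apply: eq_bigl => e.
  by rewrite inE.
by apply: eq_bigr => e /andP[_ /negbTE ->].
Qed.

Lemma zeros_ge s : (#|alpha| <= zeros s + \sum_(e in alpha) s e)%N.
Proof.
rewrite /zeros -sum1_card -sum1_card [X in (_ <= X + _)%N]big_mkcond.
rewrite [X in (_ <= _ + X)%N]big_mkcond [leqLHS]big_mkcond -big_split /=.
by apply: leq_sum => e _; rewrite !inE; case: (e \in alpha) => //=; case: (s e).
Qed.

Lemma wt_le (x C eps : K) s : 0 <= p <= 1 -> 1 <= C -> 0 <= eps -> `|x| <= C * eps ->
  `|wt x s| <= eps ^+ zeros s * \prod_(e in alpha) (2 * C * 2 ^+ s e * (s e)`!%:R).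
Proof.
move=> p01 C1 e0 xC; have C0 : 0 <= C by exact: le_trans ler01 C1.
rewrite /wt normr_prod.
have -> : eps ^+ zeros s = \prod_(e in alpha) (if s e == 0%N then eps else 1).
  rewrite /zeros -prodr_const -big_mkcondr /=; apply: eq_bigl => e; by rewrite inE.
rewrite -big_split /=; apply: ler_prod => e _; rewrite normr_ge0 /=.
case: eqP => [->|_].
  rewrite expr0 fact0 !mulr1; apply: (le_trans xC).
  have : 0 <= C * eps by rewrite mulr_ge0.
  lra.
have h := @Fs_bound K 1 tau p (s e) 0 p01; rewrite normr1 mulr1 in h.
apply: (le_trans h); rewrite mul1r -!mulrA ler_wpM2l//.
by rewrite ler_peMl// mulr_ge0// exprn_ge0.
Qed.

(** Only one uncovered element is allowed; this is the shape of the correction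
due to the diagonal pairs. *)
Definition wt1 (x : K) (s : R -> nat) : K := if zeros s == 1%N then wt x s else 0.

Lemma wt1_sub_le (x y C eps : K) s : 0 <= p <= 1 -> 1 <= C -> 0 <= eps -> eps <= 1 ->
  `|x| <= C * eps -> `|x - y| <= C * eps ^+ 2 -> (0 < zeros s)%N ->
  `|wt x s - wt1 y s| <= eps ^+ 2 * \prod_(e in alpha) (2 * C * 2 ^+ s e * (s e)`!%:R).
Proof.
move=> p01 C1 e0 e1 xC xy z0; rewrite /wt1.
have C0 : 0 <= C by exact: le_trans ler01 C1.
have P0 : 0 <= \prod_(e in alpha) (2 * C * 2 ^+ s e * (s e)`!%:R).
  by apply: prodr_ge0 => e _; rewrite !mulr_ge0// exprn_ge0.
case: eqP => [z1|/eqP z1].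
  rewrite !wt_split -mulrBl z1 !expr1.
  have := @wt_le (x - y) C (eps ^+ 2) s p01 C1 (exprn_ge0 _ e0) xy.
  by rewrite wt_split z1 !expr1.
rewrite subr0; apply: (le_trans (wt_le s p01 C1 e0 xC)); rewrite ler_wpM2r//.
by apply: ler_wiXn2l => //; lia.
Qed.

(** A diagonal pair (u, u) completes the support only if u is the one uncovered
element, and it then contributes phi'(tau) there. *)
Lemma wt_diag_insert (c : K) (s : R -> nat) : (\sum_(e in alpha) s e < #|alpha|)%N ->
  \sum_(u in alpha) c * wt 0 (inc (inc s u) u) = wt1 (c * gd 1 tau) s.
Proof.
move=> sk; have z0 : (0 < zeros s)%N by have := zeros_ge s; lia.
rewrite /wt1; case: eqP => [z1|z1]; last first.
  rewrite big1// => u ua.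
  have /card_gt1P [e1 [e2 []]] : (1 < zeros s)%N by lia.
  rewrite !inE => /andP[a1 s1] /andP[a2 s2] e12.
  have [e [ea se eu]] : exists e, [/\ e \in alpha, s e == 0%N & e != u].
    by have [eu|eu] := eqVneq e1 u; [exists e2|exists e1]; split => //; rewrite -eu eq_sym.
  rewrite /wt (bigD1 e)//= /inc (negbTE eu) !addn0 se mul0r mulr0//.
have /eqP/cards1P [u0 u0E] := z1.
have : u0 \in [set e in alpha | s e == 0%N]%SET by rewrite u0E set11.
rewrite inE => /andP[ua /eqP su].
have nz e : e \in alpha -> e != u0 -> s e != 0%N.
  move=> ea eu; apply: contraNN eu => se.
  have : e \in [set e in alpha | s e == 0%N]%SET by rewrite inE ea.
  by rewrite u0E inE.
rewrite (bigD1 u0)//= big1 ?addr0; last first.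
  move=> u /andP[_ uu0]; have uu : (u0 == u) = false by rewrite eq_sym (negbTE uu0).
  rewrite /wt (bigD1 u0)//= /inc uu !addn0 su eqxx.
  by rewrite mul0r mulr0.
rewrite /wt (bigD1 u0)//= [in RHS](bigD1 u0)//= su eqxx {1 2}/inc eqxx su /= mulrA.
congr (_ * _); first by congr (_ * _); rewrite /inc su eqxx /= subr0 mul1r; ring.
apply: eq_bigr => e /andP[ea eu]; rewrite (negbTE (nz e ea eu)).
by rewrite /inc (negbTE eu) !addn0 (negbTE (nz e ea eu)).
Qed.

End star_weights.

(** All the terms of the expanded product with two factors b vanish. *)
Lemma prod_add_sparse (K : comRingType) (I : finType) (a b : I -> K) :
  (forall i j, i != j -> b i = 0 \/ b j = 0) ->
  \prod_i (a i + b i) = \prod_i a i + \sum_j \prod_i (if i == j then b i else a i).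
Proof.
move=> ab; have [[j bj]|nb] := pselect (exists j, b j <> 0); last first.
  have b0 i : b i = 0 by apply: contrapT => bi; apply: nb; exists i.
  rewrite [X in _ + X]big1 ?addr0; last by move=> j _; rewrite (bigD1 j)//= eqxx b0 mul0r.
  by apply: eq_bigr => i _; rewrite b0 addr0.
have b0 i : i != j -> b i = 0 by move=> /ab [].
rewrite (bigD1 j)//= [X in _ = _ + X](bigD1 j)//= [X in _ = _ + (_ + X)]big1 ?addr0; last first.
  by move=> i ij; rewrite (bigD1 i)//= eqxx b0// mul0r.
rewrite [X in _ = X + _](bigD1 j)//= [X in _ = _ + X](bigD1 j)//= eqxx.
have e1 : \prod_(i | i != j) (a i + b i) = \prod_(i | i != j) a i.
  by apply: eq_bigr => i ij; rewrite b0// addr0.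
rewrite e1 mulrDl; congr (_ + _ * _).
by apply: eq_bigr => i /negbTE ->.
Qed.

Section lambda.
Context (K : realType) (R : finType) (alpha : {set R}) (tau p : K).

Lemma wt0_neq0 s : wt alpha tau p 0 s != 0 -> forall e, e \in alpha -> s e != 0%N.
Proof.
move=> w e ea; apply: contraNN w => /eqP se.
by rewrite /wt (bigD1 e)//= se eqxx mul0r.
Qed.

Lemma mult_neq0 l (r : {ffun 'I_l -> R * R}) e :
  (mult r e != 0%N) = [exists j, ((r j).1 == e) || ((r j).2 == e)].
Proof.
rewrite mult_sum; apply/idP/existsP => [h|[j h]].
  apply: contrapT => n; move: h; rewrite big1// => j _.
  by case: eqP => [a|_]; [case: n; exists j; rewrite a eqxx|case: eqP => // a; case: n; exists j; rewrite a eqxx orbT].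
rewrite (bigD1 j)//= addn_eq0 negb_and; apply/orP; left.
by case/orP: h => -> //; rewrite addn1.
Qed.

(** The signs (-1)^(s_e) of the weights multiply to (-1)^(2 l) = 1. *)
Lemma Lambda_Tsum d (sigmah : K) (X : R -> d.-tuple (measurableTypeR K)) :
  let l := uphalf #|alpha| in
  Lambda tau sigmah alpha X = (2 ^+ l * l`!%:R)^-1 *
    Tsum alpha l (fun u v => d%:R^-1 * inner (X u) (X v) - sigmah ^+ 2 * (u == v)%:R) (wt alpha tau p 0).
Proof.
rewrite /Lambda /Tsum; set l := uphalf #|alpha|; congr (_ * _).
rewrite [RHS](bigID (fun r => Supp r == alpha)) /= [X in _ = _ + X]big1 ?addr0; last first.
  move=> r /andP[rA nS]; case: (eqVneq (wt alpha tau p 0 (mult r)) 0) => [->|w]; first by rewrite mulr0.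
  case/negP: nS; apply/eqP/setP => e; rewrite inE -mult_neq0.
  apply/idP/idP => [|ea]; last exact: (wt0_neq0 w).
  rewrite mult_neq0 => /existsP[j]; move/forallP : rA => /(_ j) /andP[h1 h2].
  by case/orP => /eqP <-.
apply: eq_bigr => r /andP[rA /eqP S]; congr (_ * _).
have nz e : e \in alpha -> mult r e != 0%N by rewrite mult_neq0 -S inE.
rewrite /wt [in RHS](eq_bigr (fun e => (-1) ^+ mult r e * derive1n (mult r e - 1) (normal_pdf (0 : K) 1) tau)); last first.
  move=> e ea; rewrite (negbTE (nz e ea)) gd_derive1n; have := nz e ea.
  by case: (mult r e) => // s _; rewrite /Fs mul1r subr0 subSS subn0.
rewrite big_split /= prodrXr (sum_mult rA) -mul2n exprM sqrrN expr1n expr1n.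
by rewrite mul1r.
Qed.

(** A sequence of m + 1 pairs with two diagonal ones covers at most 2 (m + 1) -
2 = 2 m elements. *)
Lemma diag_pairs_le1 m (r : {ffun 'I_m.+1 -> R * R}) i j :
  (m.*2 < #|alpha|)%N -> (forall e, e \in alpha -> mult r e != 0%N) ->
  i != j -> (r i).1 = (r i).2 -> (r j).1 = (r j).2 -> False.
Proof.
move=> mk cov ij ri rj.
set A1 := [set (r x).1 | x in [set: 'I_m.+1]]%SET.
set A2 := [set (r x).2 | x in ~: [set i; j]]%SET.
have sub : alpha \subset (A1 :|: A2)%SET.
  apply/fintype.subsetP => e /cov; rewrite mult_neq0 => /existsP[x] /orP[/eqP <-|/eqP <-].
    by apply/setUP; left; apply: imset_f.
  have [xij|xij] := boolP (x \in [set i; j]%SET).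
    apply/setUP; left; move: xij; rewrite !inE => /orP[] /eqP ->.
      by rewrite -ri; apply: imset_f.
    by rewrite -rj; apply: imset_f.
  by apply/setUP; right; apply: imset_f; rewrite inE.
have b1 : (#|A1| <= m.+1)%N.
  by rewrite (leq_trans (leq_imset_card _ _))// cardsT card_ord.
have b2 : (#|A2| <= #|(~: [set i; j])%SET|)%N by exact: leq_imset_card.
have b3 := cardsC [set i; j]; rewrite cards2 ij card_ord in b3.
have b4 := subset_leq_card sub.
have b5 : (#|(A1 :|: A2)%SET| <= #|A1| + #|A2|)%N by exact: leq_card_setU.
lia.
Qed.

(** Expand the product over the positions of the diagonal pairs, of which there
is at most one, and remove that pair; the m + 1 positions contribute equally. *)
Lemma Tsum_diag_split m (D : R -> R -> K) (c : K) : (m.*2 < #|alpha|)%N ->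
  Tsum alpha m.+1 (fun u v => D u v + c * (u == v)%:R) (wt alpha tau p 0) =
  Tsum alpha m.+1 D (wt alpha tau p 0) + m.+1%:R * Tsum alpha m D (wt1 alpha tau p (c * gd 1 tau)).
Proof.
move=> mk; pose Q j (r : {ffun 'I_m.+1 -> R * R}) : K :=
  \prod_i (if i == j then c * ((r i).1 == (r i).2)%:R else D (r i).1 (r i).2).
transitivity (\sum_(r : {ffun 'I_m.+1 -> R * R} | [forall i, inA alpha (r i)])
    ((\prod_j D (r j).1 (r j).2) * wt alpha tau p 0 (mult r) + \sum_j Q j r * wt alpha tau p 0 (mult r))).
  apply: eq_bigr => r rA; case: (eqVneq (wt alpha tau p 0 (mult r)) 0) => [->|w].
    by rewrite !mulr0 add0r big1// => j _; rewrite mulr0.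
  rewrite -mulr_suml -mulrDl; congr (_ * _); apply: prod_add_sparse => i j ij.
  case: eqP => [ri|_]; last by left; rewrite mulr0.
  case: eqP => [rj|_]; last by right; rewrite mulr0.
  by case: (@diag_pairs_le1 m r i j mk (wt0_neq0 w) ij ri rj).
rewrite big_split /= exchange_big /=; congr (_ + _).
rewrite -[m.+1 in RHS]card_ord mulr_natl -sumr_const; apply: eq_bigr => j _.
rewrite (sum_inA_ins _ j) /Tsum.
under eq_bigr do rewrite exchange_big /=.
rewrite exchange_big /=; apply: eq_bigr => g gA.
rewrite -wt_diag_insert; last by rewrite (sum_mult gA).
rewrite mulr_sumr; apply: eq_bigr => u ua.
rewrite (bigD1 u)//= [X in _ + X]big1 ?addr0.
  rewrite /Q (bigD1_ord j)//= eqxx ins_at eqxx mulr1 mult_ins /=.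
  rewrite (eq_bigr (fun i => D (g i).1 (g i).2)); last first.
    by move=> i _; rewrite eq_sym (negbTE (neq_lift j i)) ins_lift.
  ring.
move=> v /andP[va vu]; rewrite /Q (bigD1_ord j)//= eqxx ins_at /= eq_sym (negbTE vu).
by rewrite mulr0 !mul0r.
Qed.

End lambda.

(** * Bounds on the main term and on the remainder *)

Lemma uphalf_double_bounds n : (n <= (uphalf n).*2 <= n.+1)%N.
Proof. by rewrite uphalf_half; have := odd_double_half n; case: (odd n); lia. Qed.

Lemma add_exp_le (K : realDomainType) (y z : K) n : 0 <= y -> 0 <= z ->
  z ^+ n.+1 + y ^+ n.+1 <= (y + z) ^+ n.+1.
Proof.
move=> y0 z0; rewrite addrC !exprS mulrDl lerD// ler_wpM2l// lerXn2r ?nnegrE ?addr_ge0//.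
  by rewrite lerDl.
by rewrite lerDr.
Qed.

Section bounds.
Context (K : realType) (R : finType) (alpha : {set R}).
Let k := #|alpha|.
Let l := uphalf k.

(** The powers A^k of the constants are absorbed in A^(2 l), as k <= 2 l. *)
Lemma coef_Tsum_le m (D : R -> R -> K) (w : (R -> nat) -> K) (eps c C : K) :
  (0 < k)%N -> (m <= l)%N -> 0 <= eps -> 0 <= c -> 1 <= C ->
  (forall u v, u \in alpha -> v \in alpha -> `|D u v| <= eps) ->
  (forall r : {ffun 'I_m -> R * R}, [forall i, inA alpha (r i)] ->
     `|w (mult r)| <= c * \prod_(e in alpha) (2 * C * 2 ^+ mult r e * (mult r e)`!%:R)) ->
  `|(2 ^+ m * m`!%:R)^-1 * Tsum alpha m D w| <= c * eps ^+ m * (1024 * C ^+ 2 * k%:R) ^+ l.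
Proof.
move=> k0 ml e0 c0 C1 De wb; have C0 : 0 <= C by exact: le_trans ler01 C1.
have kr : 1 <= k%:R :> K by rewrite ler1n.
have C20 : 0 <= 2 * C by rewrite mulr_ge0.
have hT := Tsum_le e0 c0 C20 (ler0n K 2) De wb.
have /andP[kl lk'] := uphalf_double_bounds k; rewrite -/l in kl lk'.
have lk : (l <= k)%N by move: k0 kl lk'; move: (l) (k); clear; lia.
have mk : (m <= 2 * k)%N by move: ml lk; move: (l) (k); clear; lia.
have hp := paircount_le k0 mk; rewrite -(ler_nat K) in hp.
have f0 : 0 < 2 ^+ m * m`!%:R :> K by rewrite mulr_gt0 ?exprn_gt0// ltr0n fact_gt0.
rewrite normrM normfV (gtr0_norm f0) mulrC ler_pdivrMr//; apply: (le_trans hT).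
have X0 : 0 <= c * (2 * C) ^+ k * 2 ^+ m.*2 * eps ^+ m.
  by apply: mulr_ge0; [apply: mulr_ge0; [apply: mulr_ge0|]|]; rewrite ?exprn_ge0.
apply: (le_trans (ler_wpM2l X0 hp)).
rewrite !natrM !natrX natrM.
have e4 : (2 ^+ m.*2 : K) * (16%:R * k%:R) ^+ m = (64 * k%:R) ^+ m.
  rewrite -mul2n exprM -exprMn; congr (_ ^+ _); ring.
rewrite [leLHS](_ : _ = c * eps ^+ m * ((4 * C) ^+ k * (64 * k%:R) ^+ m) * (2 ^+ m * m`!%:R)); last first.
  have e5 : (4 : K) * C = (2 * C) * 2 by ring.
  rewrite -e4 e5.
  by rewrite [(2 * C * 2) ^+ k]exprMn; ring.
have q0 : 0 <= c * eps ^+ m by rewrite mulr_ge0 ?exprn_ge0.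
rewrite ler_wpM2r ?(ltW f0)// ler_wpM2l//.
have h1 : (4 * C) ^+ k <= (16 * C ^+ 2) ^+ l.
  have -> : 16 * C ^+ 2 = (4 * C) ^+ 2 by ring.
  by rewrite -exprM mul2n ler_weXn2l//; lra.
have h2 : (64 * k%:R) ^+ m <= (64 * k%:R) ^+ l :> K by rewrite ler_weXn2l//; lra.
have -> : (1024 * C ^+ 2 * k%:R) ^+ l = (16 * C ^+ 2) ^+ l * (64 * k%:R) ^+ l :> K.
  by rewrite -exprMn; congr (_ ^+ _); ring.
by apply: ler_pM => //; apply: exprn_ge0; lra.
Qed.

(** The number l + 1 of terms is at most 2^l. *)
Lemma coef_sum_le (q : nat) (D : R -> R -> K) (W : nat -> (R -> nat) -> K) (eps C : K) :
  (0 < k)%N -> (l <= q)%N -> 0 <= eps -> 1 <= C ->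
  (forall u v, u \in alpha -> v \in alpha -> `|D u v| <= eps) ->
  (forall m (r : {ffun 'I_m -> R * R}), (m <= l)%N -> [forall i, inA alpha (r i)] ->
     `|W m (mult r)| <= eps ^+ (q - m) * \prod_(e in alpha) (2 * C * 2 ^+ mult r e * (mult r e)`!%:R)) ->
  `|\sum_(m < l.+1) (2 ^+ m * m`!%:R)^-1 * Tsum alpha m D (W m)| <=
    eps ^+ q * (2048 * C ^+ 2 * k%:R) ^+ l.
Proof.
move=> k0 lq e0 C1 De Wb; apply: (le_trans (ler_norm_sum _ _ _)).
apply: (@le_trans _ _ (\sum_(m < l.+1) eps ^+ q * (1024 * C ^+ 2 * k%:R) ^+ l)).
  apply: ler_sum => m _; have ml : (m <= l)%N by rewrite -ltnS.
  have := coef_Tsum_le k0 ml e0 (exprn_ge0 (q - m) e0) C1 De (fun r => Wb m r ml).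
  by rewrite -exprD subnK// (leq_trans ml).
rewrite sumr_const card_ord -[leLHS]mulr_natl.
rewrite [leLHS]mulrCA ler_wpM2l ?exprn_ge0//.
have -> : 2048 * C ^+ 2 * k%:R = 2 * (1024 * C ^+ 2 * k%:R) by ring.
have Y0 : 0 <= 1024 * C ^+ 2 * k%:R.
  apply: mulr_ge0; last exact: ler0n.
  by apply: mulr_ge0; [exact: ler0n|exact: sqr_ge0].
move: (1024 * C ^+ 2 * k%:R) Y0 => Y Y0.
rewrite exprMn ler_wpM2r ?exprn_ge0//.
by rewrite -natrX ler_nat ltn_expl.
Qed.

End bounds.

Section star_estimate.
Context (K : realType) (R : finType) (alpha : {set R}) (tau p s : K).
Hypothesis p01 : 0 <= p <= 1.
Let k := #|alpha|.
Let l := uphalf k.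
Hypothesis k0 : (0 < k)%N.
Let eta := Phi tau - p.
Let kappa := (1 - s ^+ 2) / 2 * gd 1 tau.

(** The main term regrouped by the number of pairs taken from D; the weights of
order less than l - 1 vanish. *)
Definition main_weight (m : nat) (f : R -> nat) : K :=
  if m == l then wt alpha tau p 0 f
  else if m.+1 == l then wt1 alpha tau p kappa f else 0.

Lemma TsumZ m (D : R -> R -> K) (c : K) w :
  Tsum alpha m D (fun f => c * w f) = c * Tsum alpha m D w.
Proof. by rewrite /Tsum mulr_sumr; apply: eq_bigr => r _; rewrite mulrCA. Qed.

Lemma TsumB m (D : R -> R -> K) w w' :
  Tsum alpha m D (fun f => w f - w' f) = Tsum alpha m D w - Tsum alpha m D w'.
Proof. by rewrite /Tsum -sumrB; apply: eq_bigr => r _; rewrite mulrBr. Qed.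

Lemma wt1Z (c x : K) f : wt1 alpha tau p (c * x) f = c * wt1 alpha tau p x f.
Proof.
rewrite /wt1; case: eqP => [z|_]; last by rewrite mulr0.
by rewrite !wt_split z !expr1 mulrA.
Qed.

(** Write the entries G - sigmah^2 I as D + (1 - sigmah^2) I and split off the
diagonal pair; the factor 1/2 in kappa comes from the ratio l / (2^l l!) = (1/2)
/ (2^(l-1) (l-1)!). *)
Lemma Lambda_sum d (X : R -> d.-tuple (measurableTypeR K)) :
  Lambda tau s alpha X = \sum_(m < l.+1) (2 ^+ m * m`!%:R)^-1 *
    Tsum alpha m (fun u v => d%:R^-1 * inner (X u) (X v) - (u == v)%:R) (main_weight m).
Proof.
rewrite (Lambda_Tsum _ _ p) -/k -/l.
have [m lm] : exists m, l = m.+1.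
  have l0 : (0 < l)%N by rewrite uphalf_gt0.
  by exists l.-1; rewrite prednK.
have mk : (m.*2 < #|alpha|)%N.
  by have /andP[_] := uphalf_double_bounds k; rewrite -/l lm -/k; lia.
set D := fun u v => d%:R^-1 * inner (X u) (X v) - (u == v)%:R.
have -> : (fun u v => d%:R^-1 * inner (X u) (X v) - s ^+ 2 * (u == v)%:R) =
   (fun u v => D u v + (1 - s ^+ 2) * (u == v)%:R).
  by apply/funext => u; apply/funext => v; rewrite /D; ring.
have W0 : main_weight m.+1 = wt alpha tau p 0 by apply/funext => f; rewrite /main_weight lm eqxx.
have W1 : main_weight m = wt1 alpha tau p kappa.
  by apply/funext => f; rewrite /main_weight lm eqxx ltn_eqF.
rewrite !lm (@Tsum_diag_split K R alpha tau p m D (1 - s ^+ 2) mk) !big_ord_recr /= big1 ?add0r; last first.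
  move=> i _; rewrite /Tsum big1 ?mulr0// => r _.
  by rewrite /main_weight lm eqSS !ltn_eqF ?mulr0// (leq_trans (ltn_ord i)).
rewrite W0 W1 mulrDr addrC; congr (_ + _).
have -> : wt1 alpha tau p kappa = (fun f => 2^-1 * wt1 alpha tau p ((1 - s ^+ 2) * gd 1 tau) f).
  by apply/funext => f; rewrite -wt1Z /kappa; congr wt1; ring.
rewrite TsumZ factS natrM exprS !mulrA; congr (_ * _).
have f0 : m`!%:R != 0 :> K by rewrite pnatr_eq0 -lt0n fact_gt0.
have t0 : 2 ^+ m != 0 :> K by rewrite expf_neq0.
have m0 : m.+1%:R != 0 :> K by rewrite pnatr_eq0.
move: (m.+1%:R) m0 (2 ^+ m) t0 (m`!%:R) f0 => x x0 y y0 z z0.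
by field; rewrite x0 y0 z0.
Qed.

Context (C eps : K).
Hypotheses (C1 : 1 <= C) (e0 : 0 <= eps).
Hypothesis eta_le : `|eta| <= C * eps.
Hypothesis kappa_le : `|kappa| <= C * eps.

Lemma main_weight_le m (r : {ffun 'I_m -> R * R}) : (m <= l)%N ->
  [forall i, inA alpha (r i)] ->
  `|main_weight m (mult r)| <= eps ^+ (l - m) *
     \prod_(e in alpha) (2 * C * 2 ^+ mult r e * (mult r e)`!%:R).
Proof.
move=> ml rA; have C0 : 0 <= C by exact: le_trans ler01 C1.
have P0 : 0 <= \prod_(e in alpha) (2 * C * 2 ^+ mult r e * (mult r e)`!%:R).
  by apply: prodr_ge0 => e _; rewrite !mulr_ge0// exprn_ge0.
rewrite /main_weight; case: eqP => [ml1|_].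
  have -> : (l - m = 0)%N by rewrite ml1 subnn.
  rewrite expr0.
  have := @wt_le K R alpha tau p 0 C 0 (mult r) p01 C1 (lexx _).
  rewrite normr0 mulr0 => /(_ (lexx _)) /le_trans; apply; rewrite ler_wpM2r//.
  by rewrite exprn_ile1.
case: eqP => [ml1|_]; last by rewrite normr0 mulr_ge0// exprn_ge0.
have -> : (l - m = 1)%N by rewrite -ml1 subSnn.
rewrite /wt1; case: eqP => [z|_]; last by rewrite normr0 mulr_ge0.
by have := @wt_le K R alpha tau p _ C eps (mult r) p01 C1 e0 kappa_le; rewrite z.
Qed.

Lemma Lambda_le d (X : R -> d.-tuple (measurableTypeR K)) :
  (forall u v, u \in alpha -> v \in alpha -> `|d%:R^-1 * inner (X u) (X v) - (u == v)%:R| <= eps) ->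
  `|Lambda tau s alpha X| <= (2048 * C ^+ 2 * (eps * k%:R)) ^+ l.
Proof.
move=> De; rewrite Lambda_sum mulrCA exprMn.
exact: (coef_sum_le k0 (leqnn _) e0 C1 De main_weight_le).
Qed.

Hypothesis eta_kappa_le : `|eta - kappa| <= C * eps ^+ 2.

(** A sequence of m pairs leaves at least k - 2 m >= 2 l - 1 - 2 m elements
uncovered, each of them worth eps: this is l + 1 - m or more for m <= l - 2. For
m = l the two weights agree unless some element is uncovered, and for m = l - 1
with exactly one uncovered element they differ by eta - kappa = O(eps^2). *)
Lemma rest_weight_le m (r : {ffun 'I_m -> R * R}) : eps <= 1 -> (m <= l)%N ->
  [forall i, inA alpha (r i)] ->
  `|base_weight alpha tau p (mult r) - main_weight m (mult r)| <= eps ^+ (l.+1 - m) *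
     \prod_(e in alpha) (2 * C * 2 ^+ mult r e * (mult r e)`!%:R).
Proof.
move=> e1 ml rA; have C0 : 0 <= C by exact: le_trans ler01 C1.
have P0 : 0 <= \prod_(e in alpha) (2 * C * 2 ^+ mult r e * (mult r e)`!%:R).
  by apply: prodr_ge0 => e _; rewrite !mulr_ge0// exprn_ge0.
have zk := zeros_ge alpha (mult r); rewrite (sum_mult rA) -/k in zk.
have /andP[_ lk] := uphalf_double_bounds k; rewrite -/l in lk.
have w1 := @wt_le K R alpha tau p _ C eps (mult r) p01 C1 e0 eta_le.
rewrite base_weight_wt -/eta /main_weight; case: eqP => [ml1|ml1].
  have -> : (l.+1 - m = 1)%N by rewrite ml1 subSnn.
  rewrite expr1; have [z|z] := posnP (zeros alpha (mult r)).
    by rewrite !wt_split z !expr0 subrr normr0 mulr_ge0.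
  rewrite [wt _ _ _ 0 _]wt_split expr0n gtn_eqF// mul0r subr0.
  apply: (le_trans w1); rewrite ler_wpM2r//.
  by rewrite -[leRHS]expr1 ler_wiXn2l.
case: eqP => [ml2|ml2].
  have -> : (l.+1 - m = 2)%N by rewrite -ml2 subSn ?leqW// subSnn.
  have z0 : (0 < zeros alpha (mult r))%N by move: zk lk ml2; clear; lia.
  exact: (@wt1_sub_le K R alpha tau p eta kappa C eps (mult r) p01 C1 e0 e1 eta_le eta_kappa_le z0).
have zl : (l.+1 - m <= zeros alpha (mult r))%N by move: zk lk ml ml1 ml2; clear; lia.
rewrite subr0; apply: (le_trans w1); rewrite ler_wpM2r//.
exact: ler_wiXn2l.
Qed.

(** The Taylor remainder of order l + 1 plus the terms of order at most l that
are not in the main term. *)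
Lemma star_estimate d (a : R -> 'I_d -> K) (X : R -> d.-tuple (measurableTypeR K)) :
  (forall u v, \sum_i a u i * a v i = d%:R^-1 * inner (X u) (X v)) ->
  (forall u v, u \in alpha -> v \in alpha -> `|d%:R^-1 * inner (X u) (X v) - (u == v)%:R| <= eps) ->
  eps * k%:R <= 4^-1 ->
  `|Eind alpha (fun=> tau) p a - Lambda tau s alpha X| <=
     ((2048 * C ^+ 2 + 4096) * (eps * k%:R)) ^+ l.+1.
Proof.
move=> aX De ek; have kr : 1 <= k%:R :> K by rewrite ler1n.
have C0 : 0 <= C by exact: le_trans ler01 C1.
have e1 : eps <= 1.
  have : eps <= eps * k%:R by rewrite ler_peMr.
  lra.
pose D u v := d%:R^-1 * inner (X u) (X v) - (u == v)%:R.
have De' u v : u \in alpha -> v \in alpha -> `|\sum_i a u i * a v i - (u == v)%:R| <= eps.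
  by move=> ua va; rewrite aX De.
have := @star_expansion K R alpha tau p p01 d a eps l.+1 e0 De' ek.
have -> : (fun u v => \sum_i a u i * a v i - (u == v)%:R) = D.
  by apply/funext => u; apply/funext => v; rewrite aX.
set E := Eind _ _ _ _; set T := \sum_(m < l.+1) _ => hE.
have hW := @coef_sum_le K R alpha l.+1 D (fun m f => base_weight alpha tau p f - main_weight m f) eps C
  k0 (leqnSn l) e0 C1 De (fun m r ml rA => rest_weight_le e1 ml rA).
have TE : \sum_(m < l.+1) (2 ^+ m * m`!%:R)^-1 * Tsum alpha m D
    (fun f => base_weight alpha tau p f - main_weight m f) = T - Lambda tau s alpha X.
  rewrite Lambda_sum -sumrB; apply: eq_bigr => m _; rewrite TsumB mulrBr//.
rewrite -/k -/l -/D TE in hW.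
have -> : E - Lambda tau s alpha X = (E - T) + (T - Lambda tau s alpha X) by rewrite addrA subrK.
have x0 : 0 <= eps * k%:R by rewrite mulr_ge0.
have b2 : `|T - Lambda tau s alpha X| <= (2048 * C ^+ 2 * (eps * k%:R)) ^+ l.+1.
  apply: (le_trans hW).
  have -> : 2048 * C ^+ 2 * (eps * k%:R) = eps * (2048 * C ^+ 2 * k%:R) by ring.
  have : 1 <= 2048 * C ^+ 2 * k%:R.
    have c2 : 1 <= C ^+ 2 by rewrite exprn_ege1.
    by have := ler_pM ler01 ler01 c2 kr; move: (C ^+ 2) (k%:R : K) => c kk h; lra.
  move: (2048 * C ^+ 2 * k%:R) => Y Y1.
  by rewrite [leRHS]exprMn ler_wpM2l ?exprn_ge0// ler_weXn2l.
have b1 : `|E - T| <= (4096 * (eps * k%:R)) ^+ l.+1.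
  apply: (le_trans hE); rewrite -/k.
  have /andP[kl' lk'] := uphalf_double_bounds k; rewrite -/l in kl' lk'.
  have lk : (l.+1 <= 2 * k)%N by move: k0 kl' lk'; move: (l) (k); clear; lia.
  have kl : (k <= 2 * l.+1)%N by move: kl'; move: (l) (k); clear; lia.
  have hp := paircount_le k0 lk; rewrite -(ler_nat K) -/k in hp.
  have f0 : 0 < 2 ^+ l.+1 * l.+1`!%:R :> K by rewrite mulr_gt0 ?exprn_gt0// ltr0n fact_gt0.
  rewrite (ler_pdivrMr _ _ f0).
  have X0 : 0 <= 2 ^+ k * 16 ^+ l.+1 * eps ^+ l.+1.
    by apply: mulr_ge0; [apply: mulr_ge0|]; rewrite exprn_ge0.
  move: (l.+1`!) f0 hp => F f0 hp.
  apply: (le_trans (ler_wpM2l X0 hp)); rewrite !natrM !natrX natrM.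
  rewrite [leLHS](_ : _ = (2 ^+ k * 2 ^+ k) * (16 ^+ l.+1 * eps ^+ l.+1 * (16%:R * k%:R) ^+ l.+1) * (2 ^+ l.+1 * F%:R)); last first.
    rewrite -/k; move: ((16%:R * k%:R) ^+ l.+1) (2 ^+ k) (16 ^+ l.+1) (eps ^+ l.+1) (2 ^+ l.+1) (F%:R) => a1 a2 a3 a4 a5 a6; ring.
  rewrite ler_wpM2r ?(ltW f0)//.
  have -> : (4096 * (eps * k%:R)) ^+ l.+1 = 16 ^+ l.+1 * (16 ^+ l.+1 * eps ^+ l.+1 * (16%:R * k%:R) ^+ l.+1) :> K.
    by rewrite -!exprMn; congr (_ ^+ _); ring.
  rewrite ler_wpM2r//.
    by apply: mulr_ge0; [apply: mulr_ge0|]; rewrite exprn_ge0// mulr_ge0.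
  have -> : 16 ^+ l.+1 = 4 ^+ (2 * l.+1) :> K by rewrite exprM; congr (_ ^+ _); ring.
  have -> : 2 ^+ k * 2 ^+ k = 4 ^+ k :> K by rewrite -exprMn; congr (_ ^+ _); ring.
  by rewrite ler_weXn2l//; lra.
apply: (le_trans (ler_normD _ _)); apply: (le_trans (lerD b1 b2)).
have -> : (2048 * C ^+ 2 + 4096) * (eps * k%:R) =
  2048 * C ^+ 2 * (eps * k%:R) + 4096 * (eps * k%:R) by ring.
have y0 : 0 <= 2048 * C ^+ 2 * (eps * k%:R).
  apply: mulr_ge0 x0; apply: mulr_ge0; [exact: ler0n|exact: sqr_ge0].
have z0 : 0 <= 4096 * (eps * k%:R) by apply: mulr_ge0 x0; exact: ler0n.
exact: add_exp_le.
Qed.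

End star_estimate.

(** * The expectation over the centre of the star *)

Section vertex_expectation.
Context (K : realType) (d : nat) (R : finType).
Notation vec := (d.-tuple (measurableTypeR K)).

(** Makes the inner products with x Gaussian with covariance equal to the
normalized Gram matrix. *)
Definition scaled (X : R -> vec) (u : R) (i : 'I_d) : K := (Num.sqrt d%:R)^-1 * tnth (X u) i.

Lemma Sw_ind (p tau : K) (X : R -> vec) (alpha : {set R}) :
  Sw p tau X alpha = fun x => \prod_(u in alpha) ind tau p (lin (scaled X u) x).
Proof.
apply/funext => x; apply: eq_bigr => u _; rewrite /ind; congr ((_ <= _)%R%:R - _).
by rewrite /lin /inner mulr_sumr; apply: eq_bigr => i _; rewrite mulrA.
Qed.

Lemma scaled_gram (X : R -> vec) u v :
  \sum_i scaled X u i * scaled X v i = d%:R^-1 * inner (X u) (X v).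
Proof.
have e : (Num.sqrt d%:R)^-1 * (Num.sqrt d%:R)^-1 = d%:R^-1 :> K.
  by rewrite -invfM -expr2 sqr_sqrtr.
rewrite /inner mulr_sumr; apply: eq_bigr => i _.
by rewrite /scaled mulrACA e.
Qed.

Lemma expectation_Sw (p tau : K) (X : R -> vec) (alpha : {set R}) : 0 <= p <= 1 ->
  ('E_(gaussian K d) [Sw p tau X alpha])%E = (Eind alpha (fun=> tau) p (scaled X))%:E.
Proof.
have -> : Eind alpha (fun=> tau) p (scaled X) = gaussE (Sw p tau X alpha) by rewrite Sw_ind.
move=> p01; rewrite unlock /gaussE /Rintegral fineK//.
apply: integrable_fin_num => //; apply: (@gint_bounded K d _ 1).
  by rewrite Sw_ind; exact: measurable_prod_ind.
by move=> x; rewrite Sw_ind; exact: prod_ind_le.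
Qed.

Lemma Eind_le1 (p tau : K) (X : R -> vec) (alpha : {set R}) : 0 <= p <= 1 ->
  `|Eind alpha (fun=> tau) p (scaled X)| <= 1.
Proof.
move=> p01; apply: gaussE_bound; first exact: measurable_prod_ind.
by move=> x; exact: prod_ind_le.
Qed.

Lemma Lambda_set0 (tau s : K) (X : R -> vec) : Lambda tau s finset.set0 X = 1.
Proof.
rewrite (Lambda_Tsum _ _ 0) cards0 /= Tsum0 /wt big_set0 fact0 expr0 !mulr1 invr1//.
Qed.

End vertex_expectation.

Theorem proposition2p2 (K : realType) :
  exists2 C : K, 0 < C &
  forall (d : nat) (R : finType) (p tau sigmah rho : K),
    (0 < d)%N -> 0 < p < 1 ->
    is_threshold d p tau -> is_sigma_hat p tau sigmah ->
    (p = 2^-1 \/ 1 <= rho * Num.sqrt d%:R) ->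
  exists Lam r : {set R} -> (R -> d.-tuple (measurableTypeR K)) -> K,
    (forall alpha X, Lam alpha X = Lambda tau sigmah alpha X) /\
    (forall X, Sgood rho X -> forall alpha : {set R},
       let l := uphalf #|alpha| in
       [/\ ('E_(gaussian K d) [Sw p tau X alpha])%E
             = (Lam alpha X + r alpha X)%:E,
           `|Lam alpha X| <= (C * rho * #|alpha|%:R / Num.sqrt d%:R) ^+ l
         & `|r alpha X| <= (C * rho * #|alpha|%:R / Num.sqrt d%:R) ^+ l.+1]).
Proof.
have [C0 C00 hC] := threshold_bounds K.
have [C1 C1E C11] : exists2 C1, C1 = 2 * C0 + 1 & 1 <= C1.
  by exists (2 * C0 + 1); lra.
have [Q QE Q1] : exists2 Q, Q = 2048 * C1 ^+ 2 + 4096 & 4 <= Q.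
  by exists (2048 * C1 ^+ 2 + 4096); have := sqr_ge0 C1; lra.
exists (2 * Q); first by lra.
move=> d R p tau sigmah rho d0 p01 ht hs side.
have p01' : 0 <= p <= 1 by case/andP: p01 => /ltW -> /ltW ->.
exists (fun alpha X => Lambda tau sigmah alpha X), (fun alpha X =>
  Eind alpha (fun=> tau) p (scaled X) - Lambda tau sigmah alpha X); split => // X XS alpha l.
have EE := expectation_Sw tau X alpha p01'.
have [k0|k0] := posnP #|alpha|.
  have a0 : alpha = finset.set0 by apply/eqP; rewrite -cards_eq0 k0.
  have E1 : Eind alpha (fun=> tau) p (scaled X) = 1.
    rewrite a0 /Eind -[RHS](@Rintegral_cstT _ _ _ (gaussian K d)); congr gaussE.
    by apply/funext => x; rewrite big_set0.
  rewrite /l k0 /= EE E1 a0 Lambda_set0 subrr addr0 normr0 normr1 expr0.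
  by split => //; rewrite expr1 mulr0 mul0r.
pose eps := rho / Num.sqrt d%:R; pose x := eps * #|alpha|%:R.
have cE : 2 * Q * rho * #|alpha|%:R / Num.sqrt d%:R = 2 * Q * x by rewrite /x /eps; ring.
have De u v : `|d%:R^-1 * inner (X u) (X v) - (u == v)%:R| <= eps by exact: XS.
have [u0 _] : exists u, u \in alpha by apply/set0Pn; rewrite -card_gt0.
have e0 : 0 <= eps := le_trans (normr_ge0 _) (De u0 u0).
have x0 : 0 <= x by rewrite mulr_ge0.
have [h1 h2] := hC d p tau sigmah d0 ht hs.
have dp : 0 < d%:R :> K by rewrite ltr0n.
have [eta kappa etakappa] : [/\ `|Phi tau - p| <= C1 * eps,
    `|(1 - sigmah ^+ 2) / 2 * gd 1 tau| <= C1 * eps &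
    `|Phi tau - p - (1 - sigmah ^+ 2) / 2 * gd 1 tau| <= C1 * eps ^+ 2].
  case: side => [ph|hr].
    have t0 : tau = 0 by apply: (@sigma_hat_half K tau sigmah); rewrite -ph.
    rewrite t0 Phi0 ph subrr /= mul0r oppr0 mulr0 subr0 normr0.
    have C10 : 0 <= C1 := le_trans ler01 C11.
    by split; apply: mulr_ge0 => //; exact: sqr_ge0.
  (* The side condition is used here: eps is at least 1/d unless p = 1/2. *)
  have de : d%:R^-1 <= eps.
    have sd : 0 < Num.sqrt d%:R :> K by rewrite sqrtr_gt0.
    have e : d%:R = Num.sqrt d%:R * Num.sqrt d%:R :> K by rewrite -expr2 sqr_sqrtr// ltW.
    rewrite /eps {1}e invfM ler_pM2r ?invr_gt0// -[leLHS]mul1r ler_pdivrMr//.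
  have d2 : (d%:R ^+ 2)^-1 <= eps ^+ 2.
    by rewrite -exprVn lerXn2r ?nnegrE// invr_ge0 ltW.
  have d1 : (d%:R ^+ 2)^-1 <= d%:R^-1 :> K.
    rewrite lef_pV2 ?posrE ?exprn_gt0// expr2 ler_peMl ?(ltW dp)//.
    by rewrite ler1n.
  have a1 := ler_wpM2l C00 de; have a2 := ler_wpM2l C00 d2; have a3 := ler_wpM2l C00 d1.
  have C0e : 0 <= C0 * eps by rewrite mulr_ge0.
  have C0e2 : 0 <= C0 * eps ^+ 2 by rewrite mulr_ge0// sqr_ge0.
  have e2 := sqr_ge0 eps.
  have kp : `|(1 - sigmah ^+ 2) / 2 * gd 1 tau| <=
      `|Phi tau - p| + `|Phi tau - p - (1 - sigmah ^+ 2) / 2 * gd 1 tau|.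
    by have := ler_normB (Phi tau - p) (Phi tau - p - (1 - sigmah ^+ 2) / 2 * gd 1 tau); rewrite subKr.
  move: (`|Phi tau - p|) h1 h2 kp => A; move: (`|_ - _ * _|) => B h1 h2; move: (`|_|) => F kp.
  by rewrite C1E; split; clear -e0 C0e C0e2 e2 h1 h2 a1 a2 a3 kp; lra.
have Lle := @Lambda_le K R alpha tau p sigmah p01' k0 C1 eps C11 e0 kappa d X (fun u v _ _ => De u v).
have y0 : 0 <= 2048 * C1 ^+ 2 * x.
  by apply: mulr_ge0 x0; apply: mulr_ge0; [exact: ler0n|exact: sqr_ge0].
have yQ : 2048 * C1 ^+ 2 * x <= Q * x by apply: ler_wpM2r => //; rewrite QE lerDl; exact: ler0n.
have Qx0 : 0 <= Q * x := le_trans y0 yQ.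
have Q2 : Q * x <= 2 * Q * x by rewrite -mulrA ler_peMl// ler1n.
have LQ : `|Lambda tau sigmah alpha X| <= (Q * x) ^+ l.
  exact: le_trans Lle (lerXn2r _ y0 Qx0 yQ).
have Qx2 : 0 <= 2 * Q * x := le_trans Qx0 Q2.
split; rewrite ?cE.
- by rewrite EE addrC subrK.
- exact: le_trans LQ (lerXn2r _ Qx0 Qx2 Q2).
have [xs|xb] := leP x 4^-1.
  have := star_estimate p01' k0 C11 e0 eta etakappa (scaled_gram X) (fun u v _ _ => De u v) xs.
  by rewrite -/l -/x -QE => /le_trans; apply; exact: lerXn2r _ Qx0 Qx2 Q2.
(* Here x > 1/4, and the two terms are bounded separately. *)
have Qxb : 1 <= Q * x.
  have := ler_pM _ _ Q1 (ltW xb) => /(_ (ler0n _ _)).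
  by rewrite invr_ge0 mulfV ?pnatr_eq0//; apply; exact: ler0n.
apply: (le_trans (ler_normB _ _)).
apply: (le_trans (lerD (Eind_le1 tau X alpha p01') LQ)).
have b1 : 1 <= (Q * x) ^+ l.+1 by rewrite exprn_ege1.
have b2 : (Q * x) ^+ l <= (Q * x) ^+ l.+1 by rewrite ler_weXn2l.
apply: (le_trans (lerD b1 b2)).
have b3 : (2 * Q * x) ^+ l.+1 = 2 ^+ l.+1 * (Q * x) ^+ l.+1 by rewrite -mulrA [LHS]exprMn.
have b4 : 2 <= 2 ^+ l.+1 :> K.
  rewrite -natrX ler_nat -[X in (X <= _)%N]expn1.
  by rewrite leq_exp2l.
have := ler_wpM2r (exprn_ge0 l.+1 Qx0) b4; rewrite b3.
by apply: le_trans; rewrite mulr_natl mulr2n.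
Qed.
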